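(* Let $m$ be a positive integer and let $P$ denote the uniform probability measure (Lebesgue measure) on $[0,1]^m$. Then for every $T>0$, as $\delta\to 0$ (with $\delta>0$), $$P\left(\left\{\mathbf{x}\in [0,1]^m:\delta^{\frac{m}{m+1}}Q^m(\mathbf{x},\delta)\leq T\right\}\right)\longrightarrow \mu_{m+1}\left(\left\{\Lambda\in X_{m+1}: F^{m}_1(\Lambda)\leq T\right\}\right).$$
   Context: $\|\cdot\|_m$ denotes the max norm on $\mathbb{R}^m$, and $\mathbb{N}$ denotes the positive integers. For $\mathbf{x}\in[0,1]^m$ and $\delta>0$, $$Q^m(\mathbf{x},\delta)=\min\left\{q\in\mathbb{N}: \text{there exists } \mathbf{p}\in\mathbb{Z}^m \text{ such that } \left\|\mathbf{x}-\tfrac{1}{q}\mathbf{p}\right\|_m<\delta\right\}.$$ $X_{m+1}=SL(m+1,\mathbb{R})/SL(m+1,\mathbb{Z})$ is the space of unimodular (covolume one) lattices in $\mathbb{R}^{m+1}$, where the coset $g\,SL(m+1,\mathbb{Z})$ is identified with the lattice $g\mathbb{Z}^{m+1}$. $\mu_{m+1}$ is the $SL(m+1,\mathbb{R})$-invariant probability measure on $X_{m+1}$ arising from Haar measure. The function $F^m_1:X_{m+1}\to\mathbb{R}$ is $$F^m_1(\Lambda)=\min\left\{u>0: \text{there exists } \mathbf{v}\in\mathbb{R}^m \text{ such that } \begin{bmatrix}u\\ \mathbf{v}\end{bmatrix}\in\Lambda\cap C^m_1\right\},$$ where $C^m_1=\left\{\begin{bmatrix}t\\ t\mathbf{x}\end{bmatrix}\in\mathbb{R}^{m+1}: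 t>0,\ \mathbf{x}\in\mathbb{R}^m,\ \|\mathbf{x}\|_m<1\right\}$. *)

(* Defs.v *)
From HB Require Import structures.
From mathcomp Require Import all_boot all_order all_algebra generic_quotient.
From mathcomp Require Import all_classical all_reals all_analysis.

Set Implicit Arguments.
Unset Strict Implicit.
Unset Printing Implicit Defensive.

Import Order.TTheory GRing.Theory Num.Theory.
Import numFieldNormedType.Exports.
Local Open Scope classical_set_scope.
Local Open Scope ring_scope.
Local Open Scope quotient_scope.

(* The default [x0] is returned only when [A] has no least element. *)
Definition set_min d (T : porderType d) (x0 : T) (A : set T) : T :=
  xget x0 (A `&` lbound A).

Lemma set_minP d (T : porderType d) (x0 : T) (A : set T) :
  (exists x, (A `&` lbound A) x) -> (A `&` lbound A) (set_min x0 A).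
Proof. exact: xgetPex. Qed.

Section Cube.
Variable R : realType.

Let cons_pair n (x : measurableTypeR R * n.-tuple (measurableTypeR R)) :
  n.+1.-tuple (measurableTypeR R) := [tuple of x.1 :: x.2].

Let cons_pair_measurable n : measurable_fun setT (@cons_pair n).
Proof. exact: measurable_cons. Qed.

HB.instance Definition _ n :=
  isMeasurableFun.Build _ _ _ _ (@cons_pair n) (@cons_pair_measurable n).

(* The m-fold product of the uniform probability on [0,1]. *)
Fixpoint uniform_cube (m : nat) :
    probability (m.-tuple (measurableTypeR R)) R :=
  match m with
  | 0%N => \d_([tuple] : 0.-tuple (measurableTypeR R))
  | m'.+1 => distribution (uniform_prob (@ltr01 R) \x uniform_cube m')%E
               (@cons_pair m')
  end.

End Cube.

Lemma uniform_cube_box (R : realType) m (A : 'I_m -> set (measurableTypeR R)) :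
  (forall i, measurable (A i)) ->
  uniform_cube R m [set x | forall i, A i (tnth x i)] =
  (\prod_(i < m) uniform_prob (@ltr01 R) (A i))%E.
Proof.
elim: m A => [|m IH] A mA.
  rewrite big_ord0 /= /dirac indicE mem_set//= => -[].
  by [].
rewrite big_ord_recl -IH; last by move=> i.
rewrite /= /distribution /pushforward.
rewrite -product_measure1E//.
  congr (_ _); apply/seteqP; split => -[a b] /=.
    move=> H; split; first by have := H ord0.
    by move=> i; have := H (lift ord0 i); rewrite tnthS.
  move=> [H0 H] i; case: (unliftP ord0 i) => [j|] ->//.
  by rewrite tnthS; exact: H.
rewrite (_ : [set x | _] = \bigcap_(i in setT)
  ((fun x : m.-tuple (measurableTypeR R) => tnth x i) @^-1` A (lift ord0 i))).
  apply: fin_bigcap_measurable; first exact: finite_finset.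
  move=> i _; rewrite -[X in measurable X]setTI.
  by apply: measurable_tnth.
by apply/seteqP; split => x /= H i; [move=> _|]; exact: H.
Qed.

Section LatticeSpace.
Variables (R : realType) (n : nat).

(* SL(n, R), with the topology induced from 'M[R]_n. *)
Definition SL : Type := [set g : 'M[R]_n | \det g = 1].

HB.instance Definition _ := Topological.on SL.

Definition SLmx (g : SL) : 'M[R]_n := val g.

Lemma SL_det (g : SL) : \det (SLmx g) = 1.
Proof. exact: set_mem (valP g). Qed.

Lemma SL1_subproof : (1%:M : 'M[R]_n) \in [set g : 'M[R]_n | \det g = 1].
Proof. by apply/mem_set => /=; rewrite det1. Qed.

Definition SL1 : SL := @exist _ _ 1%:M SL1_subproof.

HB.instance Definition _ := isPointed.Build SL SL1.

Lemma SL_mul_subproof (g h : SL) :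
  (SLmx g *m SLmx h) \in [set g : 'M[R]_n | \det g = 1].
Proof. by apply/mem_set => /=; rewrite det_mulmx !SL_det mulr1. Qed.

Definition SL_mul (g h : SL) : SL :=
  @exist _ _ (SLmx g *m SLmx h) (SL_mul_subproof g h).

(* g SL(n, Z) = h SL(n, Z) *)
Definition same_coset (g h : SL) : bool :=
  `[< exists z : 'M[int]_n,
      \det z = 1 /\ SLmx h = SLmx g *m map_mx intr z >].

Lemma same_coset_refl : reflexive same_coset.
Proof.
move=> g; apply/asboolP; exists 1%:M.
by rewrite det1 map_mx1 mulmx1.
Qed.

Lemma same_coset_symW g h : same_coset g h -> same_coset h g.
Proof.
move=> /asboolP[z [dz hE]]; apply/asboolP.
have uz : z \in unitmx by rewrite unitmxE dz unitr1.
exists (invmx z); split; first by rewrite det_inv dz invr1.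
by rewrite hE -mulmxA -map_mxM mulmxV // map_mx1 mulmx1.
Qed.

Lemma same_coset_sym : symmetric same_coset.
Proof. by move=> g h; apply/idP/idP => /same_coset_symW. Qed.

Lemma same_coset_trans : transitive same_coset.
Proof.
move=> h g k /asboolP[z [dz hE]] /asboolP[w [dw kE]]; apply/asboolP.
exists (z *m w); split; first by rewrite det_mulmx dz dw mulr1.
by rewrite kE hE map_mxM mulmxA.
Qed.

Definition same_coset_equiv :=
  EquivRel same_coset same_coset_refl same_coset_sym same_coset_trans.

(* X_n = SL(n, R) / SL(n, Z), with the quotient topology. *)
Definition lattice_space : Type := quotient_topology {eq_quot same_coset_equiv}.

HB.instance Definition _ := Quotient.on lattice_space.
HB.instance Definition _ := PointedTopological.on lattice_space.

Definition borel_lattice_space : Type :=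
  g_sigma_algebraType (@open lattice_space).

Definition coset (g : SL) : lattice_space := \pi_lattice_space g.

(* The lattice g Z^n of R^n attached to the coset g SL(n, Z). *)
Definition lattice_of (x : lattice_space) : set 'cV[R]_n :=
  [set v | exists z : 'cV[int]_n, v = SLmx (repr x) *m map_mx intr z].

Definition SL_act (h : SL) (x : lattice_space) : lattice_space :=
  coset (SL_mul h (repr x)).

Lemma coset_eq g h : (coset g = coset h) <-> same_coset g h.
Proof.
split => [E|gh].
  suff : same_coset_equiv g h by [].
  by rewrite -eqmodE; apply/eqP; exact: E.
have /eqP E : \pi_{eq_quot same_coset_equiv} g ==
    \pi_{eq_quot same_coset_equiv} h by rewrite eqmodE.
exact: E.
Qed.

Lemma lattice_of_coset g :
  lattice_of (coset g) =
  [set v | exists z : 'cV[int]_n, v = SLmx g *m map_mx intr z].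
Proof.
have [z [dz gE]] : exists z : 'M[int]_n,
    \det z = 1 /\ SLmx (repr (coset g)) = SLmx g *m map_mx intr z.
  by apply/asboolP/coset_eq; rewrite /coset reprK.
have uz : z \in unitmx by rewrite unitmxE dz unitr1.
apply/seteqP; split => v [w ->] /=.
  by exists (z *m w); rewrite gE -mulmxA map_mxM.
exists (invmx z *m w); rewrite gE -mulmxA -map_mxM mulmxA mulmxV //.
by rewrite mul1mx.
Qed.

Lemma SL_act_coset h g : SL_act h (coset g) = coset (SL_mul h g).
Proof.
apply/coset_eq/asboolP.
have [z [dz gE]] : exists z : 'M[int]_n,
    \det z = 1 /\ SLmx g = SLmx (repr (coset g)) *m map_mx intr z.
  by apply/asboolP/coset_eq; rewrite /coset reprK.
by exists z; split => //; rewrite /SLmx /= -/(SLmx _) gE mulmxA.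
Qed.

(* There is exactly one invariant Borel probability measure on X_n: the
   normalized measure induced by Haar measure on SL(n, R). *)
Definition SL_invariant (mu : set borel_lattice_space -> \bar R) : Prop :=
  forall (h : SL) (A : set borel_lattice_space), measurable A ->
    mu (SL_act h @^-1` A) = mu A.

End LatticeSpace.

Section Approximation.
Variables (R : realType) (m : nat).

(* The norm on 'cV[R]_m is the max norm. *)
Definition denominators (x : 'cV[R]_m) (delta : R) : set nat :=
  [set q | (0 < q)%N /\
    exists p : 'cV[int]_m, `| x - q%:R^-1 *: map_mx intr p | < delta].

Definition Qmin (x : 'cV[R]_m) (delta : R) : nat :=
  set_min 0%N (denominators x delta).

Definition col_cons (u : R) (v : 'cV[R]_m) : 'cV[R]_m.+1 :=
  col_mx (const_mx u : 'cV[R]_1) v.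

Definition cone1 : set 'cV[R]_m.+1 :=
  [set w | exists (t : R) (x : 'cV[R]_m),
    [/\ 0 < t, `|x| < 1 & w = col_cons t (t *: x)]].

Definition cone_heights (L : lattice_space R m.+1) : set R :=
  [set u | 0 < u /\ exists v : 'cV[R]_m,
    (lattice_of L `&` cone1) (col_cons u v)].

Definition F1 (L : lattice_space R m.+1) : R := set_min 0 (cone_heights L).

End Approximation.

Lemma mx_norm_leP (R : realType) m n (A : 'M[R]_(m, n)) (e : R) : 0 <= e ->
  (forall i j, `|A i j| <= e) <-> `|A| <= e.
Proof.
move=> e0; rewrite {2}/Num.norm /= mx_normrE; split=> [H|/bigmax_leP[_ H] i j].
  by apply/bigmax_leP; split=> // -[i j] _; exact: H.
exact: (H (i, j)).
Qed.

Lemma mulmx_norm_le (R : realType) m n (A : 'M[R]_(m, n)) (v : 'cV[R]_n) :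
  `|A *m v| <= n%:R * `|A| * `|v|.
Proof.
apply/mx_norm_leP; first by rewrite !mulr_ge0.
move=> i j; rewrite mxE; apply: le_trans (ler_norm_sum _ _ _) _.
rewrite -mulrA mulr_natl -[X in _ *+ X](card_ord n) -sumr_const.
apply: ler_sum => k _; rewrite normrM ler_pM//.
  exact: (iffRL (mx_norm_leP A _)).
exact: (iffRL (mx_norm_leP v _)).
Qed.

Lemma floor_dist (R : realType) (y : R) : `|y - (Num.floor y)%:~R| <= 1.
Proof.
have := floorD1_gt y; have := floor_le y; rewrite intrD => h1 h2.
by rewrite ger0_norm ?subr_ge0// lerBlDl ltW.
Qed.

(* The default value in [Qmin] is never used. *)
Lemma QminP (R : realType) m (x : 'cV[R]_m) (delta : R) : 0 < delta ->
  (denominators x delta `&` lbound (denominators x delta)) (Qmin x delta).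
Proof.
move=> d0; apply: set_minP.
have ex : exists q, `[< denominators x delta q >].
  pose q := (Num.truncn (delta^-1)).+1.
  exists q; apply/asboolP; split => //.
  exists (\col_i Num.floor (q%:R * x i ord0)).
  have q0 : 0 < q%:R :> R by rewrite ltr0n.
  have qd : q%:R^-1 < delta.
    by rewrite invf_plt ?posrE// /q truncnS_gt.
  apply: le_lt_trans qd; apply/mx_norm_leP; first by rewrite invr_ge0 ltW.
  move=> i j; rewrite !mxE ord1.
  rewrite -(@ler_pM2l _ q%:R)// divff ?gt_eqF// -{1}(gtr0_norm q0) -normrM.
  by rewrite mulrBr mulVKf ?gt_eqF// floor_dist.
exists (ex_minn ex); case: ex_minnP => q /asboolP Aq minq; split => // r Ar.
by rewrite leEnat; apply: minq; apply/asboolP.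
Qed.

Lemma SL_unit (R : realType) n (g : SL R n) : SLmx g \in unitmx.
Proof. by rewrite unitmxE SL_det unitr1. Qed.

Lemma norm_col_cons (R : realType) m (u : R) (v : 'cV[R]_m) (e : R) : 0 <= e ->
  `|col_cons u v| <= e <-> `|u| <= e /\ `|v| <= e.
Proof.
move=> e0; rewrite /col_cons -!mx_norm_leP//; split=> [H|[H1 H2] i j].
  split=> [|i j].
    by have := H (lshift m (@ord0 0)) ord0; rewrite (@col_mxEu _ 1 m) mxE.
  by have := H (rshift 1 i) j; rewrite (@col_mxEd _ 1 m).
case: (@split_ordP 1 m i) => k ->.
  by rewrite (@col_mxEu _ 1 m) mxE.
by rewrite (@col_mxEd _ 1 m); exact: H2.
Qed.

Lemma cone1E (R : realType) m (u : R) (v : 'cV[R]_m) :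
  cone1 (col_cons u v) <-> `|v| < u.
Proof.
split=> [[t [x [t0 x1]]]|vu].
  move/(@eq_col_mx _ 1 m) => [/matrixP/(_ ord0 ord0)].
  rewrite !mxE => -> ->; rewrite normrZ gtr0_norm//.
  by rewrite -[ltRHS]mulr1 ltr_pM2l.
have u0 : 0 < u by exact: le_lt_trans vu.
exists u, (u^-1 *: v); split=> //.
  by rewrite normrZ gtr0_norm ?invr_gt0// ltr_pdivrMl// mulr1.
by rewrite scalerA divff ?gt_eqF// scale1r.
Qed.

Lemma cone_heights_neq0 (R : realType) m (L : lattice_space R m.+1) :
  cone_heights L !=set0.
Proof.
pose g := SLmx (repr L); have ug : g \in unitmx := SL_unit _.
pose K := m.+1%:R * `|g| : R; have K0 : 0 <= K by rewrite mulr_ge0.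
pose w := col_cons (K + K + 1) (0 : 'cV[R]_m).
pose y := invmx g *m w; pose z : 'cV[int]_m.+1 := \col_i Num.floor (y i ord0).
pose v := g *m map_mx intr z.
have vw : `|v - w| <= K.
  have -> : w = g *m y by rewrite mulmxA mulmxV// mul1mx.
  rewrite -mulmxBr; apply: le_trans (mulmx_norm_le _ _) _.
  rewrite -/K -[leRHS]mulr1 ler_wpM2l// distrC; apply/mx_norm_leP => // i j.
  by rewrite !mxE ord1 floor_dist.
pose u := v ord0 ord0; pose b := dsubmx (v : 'cV_(1 + m)).
have vE : v = col_cons u b.
  have e : usubmx (v : 'cV_(1 + m)) = const_mx u.
    apply/matrixP => i j; rewrite [LHS]mxE [RHS]mxE !ord1 /u.
    by congr (fun_of_matrix v _ _); exact: val_inj.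
  by rewrite /col_cons -e (@vsubmxK _ 1 m).
have [uK bK] : `|u - (K + K + 1)| <= K /\ `|b| <= K.
  apply/norm_col_cons => //; apply: le_trans vw.
  rewrite vE /w /col_cons (@opp_col_mx _ 1 m) (@add_col_mx _ 1 m) oppr0 addr0.
  suff -> : const_mx (u - (K + K + 1)) = const_mx u - const_mx (K + K + 1) :> 'cV_1.
    by [].
  apply/matrixP => i j; rewrite [LHS]mxE [RHS]mxE [const_mx u _ _]mxE.
  by congr (_ + _); rewrite mxE; congr (- _); rewrite mxE.
have bu : `|b| < u.
  move: uK; rewrite ler_distlC => /andP[_ h].
  apply: le_lt_trans bK _; rewrite -(ltrD2r K); apply: lt_le_trans h.
  by rewrite ltrDl.
exists u; split; first exact: le_lt_trans bu.
by exists b; split; [exists z; rewrite -vE | exact/cone1E].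
Qed.

(* The minimum in [F1] is attained; its default value is never used. *)
Lemma F1P (R : realType) m (L : lattice_space R m.+1) :
  (cone_heights L `&` lbound (cone_heights L)) (F1 L).
Proof.
apply: set_minP; have [u0 hu0] := cone_heights_neq0 L.
pose g := SLmx (repr L); have ug : g \in unitmx := SL_unit _.
pose K := m.+1%:R * `|invmx g| * u0 : R.
have K0 : 0 <= K by rewrite !mulr_ge0// ltW//; case: hu0.
pose N := (Num.truncn K).+1.
pose Z (f : {ffun 'I_m.+1 -> 'I_(N + N).+1}) : 'cV[int]_m.+1 :=
  \col_i ((f i)%:Z - N%:Z).
pose h f := (g *m map_mx intr (Z f)) ord0 ord0.
have key u : cone_heights L u -> u <= u0 -> exists f, u = h f.
  move=> [up [v [[z gz] /cone1E vu]]] uu0.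
  have zK i : `|(z i ord0)%:~R : R| <= K.
    have zE : map_mx intr z = invmx g *m col_cons u v.
      by rewrite gz mulmxA mulVmx// mul1mx.
    have -> : (z i ord0)%:~R = (map_mx intr z : 'cV[R]_m.+1) i ord0 by rewrite mxE.
    move: i; suff : `|map_mx intr z : 'cV[R]_m.+1| <= K.
      by move=> H i; exact: (iffRL (mx_norm_leP _ K0) H i ord0).
    rewrite zE; apply: le_trans (mulmx_norm_le _ _) _.
    rewrite ler_wpM2l ?mulr_ge0//; apply/norm_col_cons; first exact: le_trans (ltW up) uu0.
    by rewrite gtr0_norm//; split=> //; apply: le_trans uu0; exact: ltW.
  have zN i : (`|z i ord0| <= N%:Z)%R.
    rewrite -(ler_int R) intr_norm; apply: le_trans (zK i) _.
    by apply: ltW; exact: truncnS_gt.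
  pose f : {ffun 'I_m.+1 -> 'I_(N + N).+1} :=
    [ffun i => inord `|(z i ord0 + N%:Z)%R|%N].
  exists f; rewrite /h; have -> : Z f = z.
    apply/matrixP => i j; rewrite !mxE ffunE.
    have := zN i; rewrite ler_norml => /andP[h1 h2].
    have h3 : 0 <= z i ord0 + N%:Z by rewrite -lerBlDr sub0r.
    have h4 : (`|(z i ord0 + N%:Z)%R| < (N + N).+1)%N.
      by rewrite ltnS -lez_nat gez0_abs// PoszD lerD2r.
    by rewrite inordK// gez0_abs// addrK [j]ord1.
  by rewrite -gz -[ord0](_ : lshift m (@ord0 0) = ord0) ?(@col_mxEu _ 1 m) ?mxE//; exact: val_inj.
have [f0 f0E] := key _ hu0 (lexx _).
pose P f := `[< cone_heights L (h f) >].
have Pf0 : P f0 by apply/asboolP; rewrite -f0E.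
case: (arg_minP h Pf0) => f /asboolP hf fmin.
exists (h f); split=> // u Lu; have [uu0|/ltW uu0] := leP u u0.
  have [f' uE] := key _ Lu uu0.
  by rewrite uE; apply: fmin; apply/asboolP; rewrite -uE.
by apply: le_trans uu0; rewrite f0E; exact: fmin.
Qed.

(* Main.v *)
(* Put delta = s^-(m+1).  Then delta^(m/(m+1)) * Q(x, delta) <= T says that the
   lattice dil s * horo x * Z^(m+1) meets a truncated cone, so the claim is an
   equidistribution statement for the expanding translates dil s * horo x.
   Instead of mixing, the proof uses almost invariant averages.  An average of the
   indicator [phi] of a cone event over finitely many horospherical translates whose
   L2 norm is nearly minimal is nearly invariant under all of [horo], hence, by the
   Mautner phenomenon, under all transvections with the same bound; this survives
   conjugation by dil s.  Along s_n -> oo, with averages whose errors are summable,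
   the functions Psi_n = avg_n(dil s_n y) satisfy: sum_n (Psi_n (g y) - Psi_n y)^2 is
   finite for almost all y, for every fixed g.  Fubini against a random matrix g whose
   law is quasi-invariant under SL then yields Psi_n (g y) -> mean phi for every y and
   almost every g, in particular for all y = horo x simultaneously and some g as close
   to 1 as desired.  Such a g only perturbs the cone slightly and translates x, and x
   is uniform on a torus, so probabilities are squeezed between those of slightly
   smaller and larger cones.  The limit law is continuous: if F1 = T had positive
   measure, so would its infinitely many images under dil s, although each lattice
   lies in finitely many of them. *)

Require Import Defs.
From HB Require Import structures.
From mathcomp Require Import all_boot all_order all_algebra perm generic_quotient.
From mathcomp Require Import all_classical all_reals all_analysis.
From mathcomp Require Import measurable_realfun.
From mathcomp Require Import ring lra.

Set Implicit Arguments.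
Unset Strict Implicit.
Unset Printing Implicit Defensive.

Import Order.TTheory GRing.Theory Num.Theory.
Import numFieldNormedType.Exports.
Local Open Scope classical_set_scope.
Local Open Scope ring_scope.

(** * Generation of SL by transvections *)

(** A statement about [mu]-almost every lattice says nothing about the thin family [horo x] Z^(m+1);
    this obstacle is what forces the random matrix. A single lattice y0 that is good for almost
    every g supplies constants c n = Psi_n(y0). Every lattice y is a translate of y0, and
    quasi-invariance of the law of g carries the exceptional null set along, so every y obeys the
    same c n. Only afterwards are the c n identified in the limit with the mean. Summability needs a
    sequence, while the limit runs over real s. Hence an argument by contradiction along bad
    parameters s_n, chosen after the finite averages and so large that conjugation by [dil s_n]
    makes their translations tiny; these then merge with g. An average only shows that some
    translate is not much below the mean and some, perhaps other, translate not much above it, which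
    is enough for a squeeze. Continuity of the law of [F1] serves twice: in the final squeeze, and
    to show that the indicator of a cone event moves continuously in L2, which the Mautner argument
    requires. It also controls changes of aperture, because the image of a cone under [dil s] has an
    event of the same measure. *)

Definition transv (F : fieldType) n (i j : 'I_n) (c : F) : 'M[F]_n :=
  1%:M + c *: delta_mx i j.

Section Transvections.
Variable F : fieldType.

Lemma mul_transv n p (i j : 'I_n) c (A : 'M[F]_(n, p)) k l :
  (transv i j c *m A) k l = A k l + (k == i)%:R * c * A j l.
Proof.
rewrite mulmxDl mul1mx mxE; congr (_ + _).
rewrite mxE (bigD1 j)//= big1 ?addr0 => [|l' /negPf l'j].
  by rewrite !mxE eqxx andbT [c * _]mulrC.
by rewrite !mxE l'j andbF mulr0 mul0r.
Qed.

Lemma mul_transvr n p (i j : 'I_n) c (A : 'M[F]_(p, n)) k l :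
  (A *m transv i j c) k l = A k l + (l == j)%:R * c * A k i.
Proof.
rewrite mulmxDr mulmx1 mxE; congr (_ + _).
rewrite mxE (bigD1 i)//= big1 ?addr0 => [|l' /negPf l'j].
  by rewrite !mxE eqxx /= mulrC [c * _]mulrC.
by rewrite !mxE l'j /= !mulr0.
Qed.

Lemma transvM n (i j : 'I_n) (a b : F) : i != j ->
  transv i j a *m transv i j b = transv i j (a + b).
Proof.
move=> ij; rewrite /transv mulmxDl mul1mx mulmxDr mulmx1.
rewrite -scalemxAl -scalemxAr mul_delta_mx_0 1?eq_sym// !scaler0 addr0 scalerDl.
by rewrite addrAC addrA addrAC.
Qed.

Lemma transv0 n (i j : 'I_n) : transv i j (0 : F) = 1%:M.
Proof. by rewrite /transv scale0r addr0. Qed.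

Lemma det_transv n (i j : 'I_n) (c : F) : i != j -> \det (transv i j c) = 1.
Proof.
move=> ij; pose B : 'M[F]_n := \matrix_(k, l) if k == i then (1%:M : 'M[F]_n) j l else (1%:M : 'M[F]_n) k l.
rewrite (@determinant_multilinear _ _ (transv i j c) 1%:M B i 1 c).
- rewrite det1 (@determinant_alternate _ _ B i j)// ?mulr0 ?addr0 ?mulr1//.
  by move=> l; rewrite !mxE eqxx [j == i]eq_sym (negPf ij).
- apply/matrixP => k l; rewrite !mxE eqxx mul1r.
  by rewrite [l == j]eq_sym.
- apply/matrixP => k l; rewrite !mxE.
  by rewrite [lift i k == i]eq_sym (negPf (neq_lift i k))/= mulr0 addr0.
apply/matrixP => k l; rewrite !mxE.
by rewrite [lift i k == i]eq_sym (negPf (neq_lift i k))/= mulr0 addr0.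
Qed.

(** Gaussian elimination without rescaling rows. The corner entry is made 1 by adding to row 0 a
    multiple of a lower row with a nonzero entry in column 0; then column 0 and row 0 are cleared,
    and the remaining block is treated by induction. *)
Lemma transv_ind n (P : 'M[F]_n -> Prop) : P 1%:M ->
  (forall i j c A, i != j -> \det A = 1 -> P A -> P (transv i j c *m A)) ->
  (forall i j c A, i != j -> \det A = 1 -> P A -> P (A *m transv i j c)) ->
  forall A, \det A = 1 -> P A.
Proof.
elim: n P => [|n IH] P P1 PL PR A dA.
  by rewrite (_ : A = 1%:M)//; apply/matrixP => -[].
(* The inverse of a transvection is a transvection, so it suffices to prove [P] after an elimination
   step. *)
have PLi i j c B : i != j -> \det B = 1 -> P (transv i j c *m B) -> P B.
  move=> ij dB PB; have -> : B = transv i j (- c) *m (transv i j c *m B).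
    by rewrite mulmxA transvM// addNr transv0 mul1mx.
  by apply: (PL i j (- c)) => //; rewrite det_mulmx det_transv// mul1r.
have PRi i j c B : i != j -> \det B = 1 -> P (B *m transv i j c) -> P B.
  move=> ij dB PB; have -> : B = (B *m transv i j c) *m transv i j (- c).
    by rewrite -mulmxA transvM// addrN transv0 mulmx1.
  by apply: (PR i j (- c)) => //; rewrite det_mulmx det_transv// mulr1.
have detL (i j : 'I_n.+1) (c : F) (B : 'M[F]_n.+1) :
    i != j -> \det B = 1 -> \det (transv i j c *m B) = 1.
  by move=> ij dB; rewrite det_mulmx (det_transv _ ij) mul1r.
have detR (i j : 'I_n.+1) (c : F) (B : 'M[F]_n.+1) :
    i != j -> \det B = 1 -> \det (B *m transv i j c) = 1.
  by move=> ij dB; rewrite det_mulmx (det_transv _ ij) mulr1.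
have l0 k : lift ord0 k != ord0 :> 'I_n.+1 by rewrite eq_sym neq_lift.
(* With trivial first row and column, the claim is the induction hypothesis for the lower block,
   applied to the predicate [Q] pulled back along the block embedding. *)
have blk (B : 'M[F]_n.+1) : \det B = 1 -> B ord0 ord0 = 1 ->
    (forall k, B (lift ord0 k) ord0 = 0) ->
    (forall k, B ord0 (lift ord0 k) = 0) -> P B.
  move=> dB B1 Bc Br; pose Q (C : 'M[F]_n) := P (block_mx 1%:M 0 0 C : 'M[F]_(1 + n)).
  have dQ (C : 'M[F]_n) : \det (block_mx 1%:M 0 0 C : 'M[F]_(1 + n)) = \det C.
    by rewrite det_lblock det1 mul1r.
  have tQ i j c : block_mx 1%:M 0 0 (transv i j c) =
      transv (rshift 1 i) (rshift 1 j) c :> 'M[F]_(1 + n).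
    apply/matrixP => k l; rewrite [RHS]mxE [X in _ + X]mxE [X in _ * X]mxE.
    case: (@split_ordP 1 n k) => k' ->; case: (@split_ordP 1 n l) => l' ->.
    - by rewrite block_mxEul !mxE !ord1 !eqxx eq_lrshift/= mulr0 addr0.
    - by rewrite block_mxEur !mxE eq_lrshift eq_lrshift/= mulr0 addr0.
    - by rewrite block_mxEdl !mxE eq_rlshift eq_lrshift/= andbF mulr0 addr0.
    - by rewrite block_mxEdr !mxE !eq_rshift.
  have BE : B = @block_mx F 1 n 1 n 1%:M 0 0 (drsubmx (B : 'M[F]_(1 + n))).
    apply/matrixP => k l.
    case: (@split_ordP 1 n k) => k' ->; case: (@split_ordP 1 n l) => l' ->.
    - rewrite (@block_mxEul _ 1 n 1 n) !mxE !ord1 eqxx.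
      by rewrite (_ : lshift n 0 = ord0)//; apply: ord_inj.
    - rewrite (@block_mxEur _ 1 n 1 n) !mxE !ord1.
      by rewrite ?rshift1 (_ : lshift n 0 = ord0)//; apply: ord_inj.
    - rewrite (@block_mxEdl _ 1 n 1 n) !mxE !ord1.
      by rewrite ?rshift1 (_ : lshift n 0 = ord0)//; apply: ord_inj.
    - by rewrite (@block_mxEdr _ 1 n 1 n) !mxE.
  move: dB; rewrite BE => dB; apply: (IH Q).
  - by rewrite /Q -(@scalar_mx_block _ 1 n).
  - move=> i j c C ij dC PC; rewrite /Q.
    have -> : block_mx 1%:M 0 0 (transv i j c *m C) =
      transv (rshift 1 i) (rshift 1 j) c *m block_mx 1%:M 0 0 C :> 'M[F]_(1 + n).
      by rewrite -tQ mulmx_block !mul0mx !mulmx0 mul1mx !addr0 add0r.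
    by apply: PL; rewrite ?dQ// eq_rshift.
  - move=> i j c C ij dC PC; rewrite /Q.
    have -> : block_mx 1%:M 0 0 (C *m transv i j c) =
      block_mx 1%:M 0 0 C *m transv (rshift 1 i) (rshift 1 j) c :> 'M[F]_(1 + n).
      by rewrite -tQ mulmx_block !mul0mx !mulmx0 mul1mx !addr0 add0r.
    by apply: PR; rewrite ?dQ// eq_rshift.
  - by rewrite -dQ.
have clear_row (s : seq 'I_n) (B : 'M[F]_n.+1) : \det B = 1 ->
    B ord0 ord0 = 1 -> (forall k, B (lift ord0 k) ord0 = 0) ->
    (forall k, k \notin s -> B ord0 (lift ord0 k) = 0) -> P B.
  elim: s B => [|k s IHs] B dB B1 Bc Br; first by apply: blk => // k; apply: Br.
  apply: (PRi ord0 (lift ord0 k) (- B ord0 (lift ord0 k))); rewrite ?neq_lift//.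
  apply: IHs.
  - by apply: detR => //; rewrite neq_lift.
  - by rewrite mul_transvr (negPf (neq_lift _ _))/= !mul0r addr0.
  - by move=> l; rewrite mul_transvr (negPf (neq_lift _ _))/= !mul0r addr0.
  - move=> l ls; rewrite mul_transvr B1 mulr1; have [->|lk] := eqVneq l k.
      by rewrite eqxx mul1r subrr.
    rewrite (inj_eq lift_inj) (negPf lk) mul0r addr0; apply: Br.
    by rewrite in_cons (negPf lk).
have clear_col (s : seq 'I_n) (B : 'M[F]_n.+1) : \det B = 1 ->
    B ord0 ord0 = 1 ->
    (forall k, k \notin s -> B (lift ord0 k) ord0 = 0) -> P B.
  elim: s B => [|k s IHs] B dB B1 Bc.
    by apply: (clear_row (enum 'I_n)) => // k; [exact: Bc|rewrite mem_enum].
  apply: (PLi (lift ord0 k) ord0 (- B (lift ord0 k) ord0)) => //.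
  apply: IHs; first exact: detL.
  - by rewrite mul_transv (negPf (neq_lift _ _))/= !mul0r addr0.
  - move=> l ls; rewrite mul_transv B1 mulr1; have [->|lk] := eqVneq l k.
      by rewrite eqxx mul1r subrr.
    rewrite (inj_eq lift_inj) (negPf lk) mul0r addr0; apply: Bc.
    by rewrite in_cons (negPf lk).
have pivot k (B : 'M[F]_n.+1) : \det B = 1 -> B (lift ord0 k) ord0 != 0 -> P B.
  move=> dB Bk.
  apply: (PLi ord0 (lift ord0 k) ((1 - B ord0 ord0) / B (lift ord0 k) ord0)).
  - by rewrite neq_lift.
  - by [].
  apply: (clear_col (enum 'I_n)).
  - by apply: detL => //; rewrite neq_lift.
  - by rewrite mul_transv eqxx mul1r divfK// addrC subrK.
  - by move=> l; rewrite mem_enum.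
have [[k Ak]|A0] := pselect (exists k, A (lift ord0 k) ord0 != 0).
  exact: (pivot k).
have {}A0 k : A (lift ord0 k) ord0 = 0.
  by apply/eqP/negPn/negP => Ak; apply: A0; exists k.
have A00 : A ord0 ord0 != 0.
  apply/eqP => A00; move: dA; rewrite (expand_det_col _ ord0) big1 => [/eqP|i _].
    by rewrite eq_sym oner_eq0.
  by case: (unliftP ord0 i) => [j|] ->; rewrite ?A0 ?A00 mul0r.
(* No pivot below the corner. In size 1 the determinant forces the identity; otherwise adding row 0
   to row 1 creates a pivot. *)
case: n {IH PL PR PRi detR l0 blk clear_row clear_col} P P1 A dA PLi detL pivot A0 A00
    => [|n] P P1 A dA PLi detL pivot A0 A00.
  rewrite (_ : A = 1%:M)//; apply/matrixP => i j; rewrite !ord1 mxE eqxx.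
  by rewrite -dA det_mx11.
apply: (PLi (lift ord0 ord0) ord0 1) => //.
apply: (pivot ord0); first exact: detL.
by rewrite mul_transv A0 eqxx !mul1r add0r.
Qed.

End Transvections.

(** * The action on the space of lattices *)

Section Continuity.
Variable R : realType.

Lemma continuous_mx (T : topologicalType) p q (f : T -> 'M[R]_(p, q)) :
  (forall i j, continuous (fun x => f x i j)) -> continuous f.
Proof.
move=> cf x U [P nP PU]; apply: filterS PU _.
rewrite nbhs_filterE.
have : \forall y \near x, forall ij : 'I_p * 'I_q, P ij.1 ij.2 (f y ij.1 ij.2).
  by apply: filter_forall => -[i j] /=; apply: cf; exact: nP.
by apply: filterS => y Py i j; exact: (Py (i, j)).
Qed.

Lemma continuous_mulmxl p q r (A : 'M[R]_(p, q)) :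
  continuous (mulmx A : 'M[R]_(q, r) -> 'M[R]_(p, r)).
Proof.
apply: continuous_mx => i j.
rewrite (_ : (fun x => _) = fun x : 'M[R]_(q, r) => \sum_k A i k * x k j); last first.
  by apply/funext => x; rewrite mxE.
apply: continuous_big => [|k _]; first by move=> z; apply: cvgD; [exact: cvg_fst|exact: cvg_snd].
by move=> x; apply: continuousM; [exact: cst_continuous|exact: coord_continuous].
Qed.

Lemma continuous_mulmxr p q r (A : 'M[R]_(q, r)) :
  continuous ((mulmxr A) : 'M[R]_(p, q) -> 'M[R]_(p, r)).
Proof.
apply: continuous_mx => i j.
rewrite (_ : (fun x => _) = fun x : 'M[R]_(p, q) => \sum_k x i k * A k j); last first.
  by apply/funext => x; rewrite mxE.
apply: continuous_big => [|k _]; first by move=> z; apply: cvgD; [exact: cvg_fst|exact: cvg_snd].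
by move=> x; apply: continuousM; [exact: coord_continuous|exact: cst_continuous].
Qed.

Lemma open_SLP n (A : set (SL R n)) :
  open A <-> exists2 U : set 'M[R]_n, open U & @SLmx R n @^-1` U = A.
Proof. by []. Qed.

Lemma open_lattice_spaceP n (A : set (lattice_space R n)) :
  open A <-> open (@coset R n @^-1` A).
Proof. by []. Qed.

End Continuity.

Section Action.
Variables (R : realType) (n : nat).
Implicit Types (A B : 'M[R]_n) (x y : lattice_space R n).

(** Total on matrices, so that the action can be written and rewritten with plain matrices; the
    value off determinant 1 is a default. *)
Definition toSL A : SL R n :=
  if pselect (\det A = 1) is left h then exist _ A (mem_set h) else SL1 R n.

Lemma toSLE A : \det A = 1 -> SLmx (toSL A) = A.
Proof. by move=> dA; rewrite /toSL; case: pselect. Qed.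

Definition act A x : lattice_space R n := SL_act (toSL A) x.

Lemma act_coset A g : \det A = 1 -> act A (coset g) = coset (toSL (A *m SLmx g)).
Proof.
move=> dA; rewrite /act SL_act_coset; congr coset.
apply: val_inj => /=; rewrite -[LHS]/(SLmx (toSL A) *m SLmx g) toSLE//.
by rewrite -[RHS]/(SLmx _) toSLE// det_mulmx dA SL_det mulr1.
Qed.

Lemma coset_repr x : coset (repr x) = x.
Proof. exact: reprK. Qed.

Lemma toSLK (g : SL R n) : toSL (SLmx g) = g.
Proof. by apply: val_inj; rewrite -[LHS]/(SLmx _) toSLE// SL_det. Qed.

Lemma act_mul A B x : \det A = 1 -> \det B = 1 -> act (A *m B) x = act A (act B x).
Proof.
move=> dA dB; rewrite -(coset_repr x) !act_coset ?det_mulmx ?dA ?dB ?mulr1//.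
by rewrite toSLE ?mulmxA// det_mulmx dB SL_det mulr1.
Qed.

Lemma act1 x : act 1%:M x = x.
Proof.
by rewrite -{1}(coset_repr x) act_coset ?det1// mul1mx toSLK coset_repr.
Qed.

Definition hit (O : set 'cV[R]_n) A := exists z : 'cV[int]_n, O (A *m map_mx intr z).

(** Phrased with the chosen representative; [lhit_coset] shows that the choice does not matter. *)
Definition lhit O : set (lattice_space R n) := [set x | hit O (SLmx (repr x))].

Lemma hit_same O (g h : SL R n) : same_coset g h -> hit O (SLmx h) -> hit O (SLmx g).
Proof.
move=> /asboolP[w [dw hE]] [z Oz]; exists (w *m z).
by rewrite map_mxM mulmxA -hE.
Qed.

Lemma lhit_coset O g : lhit O (coset g) <-> hit O (SLmx g).
Proof.
have E : same_coset g (repr (coset g)) by apply/coset_eq; rewrite coset_repr.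
by split; apply: hit_same => //; exact: same_coset_symW.
Qed.

Lemma lhit_act O A x : \det A = 1 -> lhit O (act A x) <-> hit O (A *m SLmx (repr x)).
Proof.
move=> dA; rewrite -{1}(coset_repr x) act_coset//.
apply: iff_trans (lhit_coset _ _) _.
by rewrite toSLE// det_mulmx dA SL_det mulr1.
Qed.

Lemma open_lhit O : open O -> open (lhit O).
Proof.
move=> oO; apply/open_lattice_spaceP/open_SLP.
exists [set A | hit O A].
  rewrite (_ : [set A | _] = \bigcup_z (mulmxr (map_mx intr z) @^-1` O)).
    apply: bigcup_open => z _; move/continuousP: (@continuous_mulmxr R n _ _ (map_mx intr z)).
    exact.
  by apply/seteqP; split=> A [z] => [Oz|_ Oz]; exists z.
by apply/seteqP; split=> g /= H; apply/lhit_coset.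
Qed.

Lemma measurable_lhit O : open O ->
  measurable (lhit O : set (borel_lattice_space R n)).
Proof. by move=> oO; apply: sub_sigma_algebra; exact: open_lhit. Qed.

Lemma measurable_act A : measurable_fun setT
  (act A : borel_lattice_space R n -> borel_lattice_space R n).
Proof.
apply: (@measurability _ _ (borel_lattice_space R n) (borel_lattice_space R n) setT (act A) (@open (lattice_space R n))) => //.
move=> _ [U oU <-]; rewrite setTI; apply: sub_sigma_algebra.
apply/open_lattice_spaceP/open_SLP.
have /open_SLP [V oV VE] := oU.
exists (mulmx (SLmx (toSL A)) @^-1` V).
  by move/continuousP: (@continuous_mulmxl R n n n (SLmx (toSL A))); apply.
apply/seteqP; split=> g /=.
  rewrite /act SL_act_coset => H.
  suff : (coset (n:=n) @^-1` U) (SL_mul (toSL A) g) by [].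
  by rewrite -VE.
rewrite /act SL_act_coset => H.
have : (coset (n:=n) @^-1` U) (SL_mul (toSL A) g) by [].
by rewrite -VE.
Qed.

End Action.

(** * Dilations, horospherical matrices and cones *)

Lemma open_forall (T : topologicalType) (I : finType) (A : I -> set T) :
  (forall i, open (A i)) -> open [set x | forall i, A i x].
Proof.
move=> oA; rewrite openE => x Ax; apply: filter_forall => i.
exact: open_nbhs_nbhs.
Qed.

Section Geometry.
Variables (R : realType) (m : nat).
Implicit Types (x y : 'cV[R]_m) (w : 'cV[R]_m.+1) (s : R).

(** The aperture [c] is a parameter because [dil s] multiplies it by [s ^+ m.+1] and because the
    squeezes need room on both sides. Strict inequalities keep the set open, hence its lattice event
    open. *)
Definition cone (c T : R) : set 'cV[R]_m.+1 :=
  [set w | 0 < w ord0 ord0 < T /\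
    forall i, `|w (lift ord0 i) ord0| < c * w ord0 ord0].

Lemma open_cone c T : open (cone c T).
Proof.
have co i : continuous (fun w => w i ord0 : R) by exact: coord_continuous.
rewrite (_ : cone c T = [set w | 0 < w ord0 ord0] `&` [set w | w ord0 ord0 < T]
    `&` [set w | forall i : 'I_m, `|w (lift ord0 i) ord0| < c * w ord0 ord0]); last first.
  apply/seteqP; split=> w /=.
    by move=> [/andP[w0 wT] wi].
  by move=> [[w0 wT] wi]; split=> //; rewrite w0.
apply: openI; [apply: openI|].
- by apply: (@open_comp _ _ (fun w => w ord0 ord0) [set t : R | 0 < t]) => [w _|];
    [exact: co|exact: open_gt].
- by apply: (@open_comp _ _ (fun w => w ord0 ord0) [set t : R | t < T]) => [w _|];
    [exact: co|exact: open_lt].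
apply: (@open_forall _ _ (fun i w => `|w (lift ord0 i) ord0| < c * w ord0 ord0)) => i.
rewrite (_ : (fun w => _) =
    (fun w => c * w ord0 ord0 - `|w (lift ord0 i) ord0|) @^-1` [set t : R | 0 < t]).
  apply: open_comp => [w _|]; last exact: open_gt.
  apply: (@continuousB _ R^o _ (fun w => c * w ord0 ord0)
      (fun w => `|w (lift ord0 i) ord0|) w).
    by apply: continuousM; [exact: cst_continuous|exact: co].
  by apply: continuous_comp; [exact: co|exact: norm_continuous].
by apply/seteqP; split=> w /=; rewrite subr_gt0.
Qed.

Definition dil s : 'M[R]_m.+1 :=
  diag_mx (\row_j (if j == ord0 then s ^- m else s)).

Lemma det_dil s : 0 < s -> \det (dil s) = 1.
Proof.
move=> s0; rewrite det_diag big_ord_recl mxE eqxx.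
under eq_bigr do rewrite mxE [lift _ _ == _]eq_sym (negPf (neq_lift _ _)).
by rewrite prodr_const card_ord mulVf// expf_neq0// gt_eqF.
Qed.

Lemma dil0 s w : (dil s *m w) ord0 ord0 = s ^- m * w ord0 ord0.
Proof. by rewrite mul_diag_mx !mxE eqxx. Qed.

Lemma dilS s w i : (dil s *m w) (lift ord0 i) ord0 = s * w (lift ord0 i) ord0.
Proof. by rewrite mul_diag_mx !mxE [lift _ _ == _]eq_sym (negPf (neq_lift _ _)). Qed.

Lemma cone_dil c T s w : 0 < s ->
  cone (c * s ^+ m.+1) (s ^- m * T) (dil s *m w) <-> cone c T w.
Proof.
move=> s0; have sm : 0 < s ^- m by rewrite invr_gt0 exprn_gt0.
have sn : s ^+ m != 0 by rewrite expf_neq0// gt_eqF.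
rewrite /cone /= dil0 pmulr_rgt0// ltr_pM2l//.
split=> -[h1 h2]; split=> // i; have := h2 i.
  rewrite dilS normrM gtr0_norm// exprS.
  have -> : c * (s * s ^+ m) * (s ^- m * w ord0 ord0) = s * (c * w ord0 ord0).
    by field.
  by rewrite ltr_pM2l.
rewrite dilS normrM gtr0_norm// exprS.
have -> : c * (s * s ^+ m) * (s ^- m * w ord0 ord0) = s * (c * w ord0 ord0).
  by field.
by rewrite ltr_pM2l.
Qed.

Definition pad x : 'cV[R]_m.+1 :=
  \col_i if unlift ord0 i is Some k then x k ord0 else 0.

(** Sends (q, p) to (q, p - q x), so the lower coordinates of an integer vector become its
    approximation errors. *)
Definition horo x : 'M[R]_m.+1 := 1%:M - pad x *m delta_mx 0 ord0.

Lemma pad0 x : pad x ord0 ord0 = 0.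
Proof. by rewrite mxE unlift_none. Qed.

Lemma padS x i : pad x (lift ord0 i) ord0 = x i ord0.
Proof. by rewrite mxE liftK. Qed.

Lemma horoE x i j : horo x i j = (i == j)%:R - pad x i ord0 * (j == ord0)%:R.
Proof.
rewrite mxE [X in X + _]mxE [X in _ + X]mxE; congr (_ - _).
by rewrite mxE big_ord1 [delta_mx _ _ _ _]mxE eqxx.
Qed.

Lemma mul_horo x p (A : 'M[R]_(m.+1, p)) i j :
  (horo x *m A) i j = A i j - pad x i ord0 * A ord0 j.
Proof.
rewrite mulmxBl mul1mx mxE; congr (_ + _); rewrite mxE; congr (- _).
by rewrite -mulmxA -rowE mxE big_ord1 [row _ _ _ _]mxE.
Qed.

Lemma horo_w0 x w : (horo x *m w) ord0 ord0 = w ord0 ord0.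
Proof. by rewrite mul_horo pad0 mul0r subr0. Qed.

Lemma horo_wS x w i : (horo x *m w) (lift ord0 i) ord0 =
  w (lift ord0 i) ord0 - x i ord0 * w ord0 ord0.
Proof. by rewrite mul_horo padS. Qed.

Lemma horo0 : horo 0 = 1%:M.
Proof.
apply/matrixP => i j; rewrite horoE [RHS]mxE; case: (unliftP ord0 i) => [k|] ->.
  by rewrite padS mxE mul0r subr0.
by rewrite pad0 mul0r subr0.
Qed.

Lemma det_horo x : \det (horo x) = 1.
Proof.
rewrite det_trig; last first.
  apply/is_trig_mxP => i j ij; rewrite horoE.
  have -> : (i == j) = false by apply/negbTE; rewrite -val_eqE/= ltn_eqF.
  case: eqP ij => [->|_]; first by rewrite ltn0.
  by rewrite mulr0 subr0.
apply: big1 => i _; rewrite horoE eqxx; case: eqP => [->|_].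
  by rewrite pad0 mul0r subr0.
by rewrite mulr0 subr0.
Qed.

Lemma mulmx_cV_inj p (A B : 'M[R]_(p, m.+1)) :
  (forall w, A *m w = B *m w) -> A = B.
Proof.
move=> AB; apply/matrixP => i j.
by have := AB (delta_mx j ord0); rewrite -!colE => /matrixP/(_ i ord0); rewrite !mxE.
Qed.

Lemma cVP w w' : w ord0 ord0 = w' ord0 ord0 ->
  (forall i, w (lift ord0 i) ord0 = w' (lift ord0 i) ord0) -> w = w'.
Proof.
move=> e0 eS; apply/matrixP => i j; rewrite ord1.
by case: (unliftP ord0 i) => [k|] ->.
Qed.

Lemma horoM x y : horo x *m horo y = horo (x + y).
Proof.
apply: mulmx_cV_inj => w; rewrite -!mulmxA; apply: cVP => [|i].
  by rewrite !horo_w0.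
by rewrite !horo_wS horo_w0 mxE; ring.
Qed.

(** Read from right to left: a fixed translation to the left of [dil s] is a translation by
    [s ^- m.+1 *: v] to its right, negligible for large [s]. *)
Lemma dil_horo s x : 0 < s -> dil s *m horo x = horo (s ^+ m.+1 *: x) *m dil s.
Proof.
move=> s0; have sn : s ^+ m != 0 by rewrite expf_neq0// gt_eqF.
apply: mulmx_cV_inj => w; rewrite -!mulmxA; apply: cVP => [|i].
  by rewrite horo_w0 !dil0 horo_w0.
rewrite horo_wS !dilS dil0 horo_wS mxE exprS; field => //.
Qed.

End Geometry.

(** * Max-norm estimates and stability of cones under matrices near 1 *)

Section Norm.
Variable R : realType.

Lemma mx_norm_ge p q (A : 'M[R]_(p, q)) i j : `|A i j| <= `|A|.
Proof. exact: (iffRL (mx_norm_leP A (normr_ge0 A))). Qed.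

Lemma mx_norm_ltP p q (A : 'M[R]_(p, q)) (e : R) : 0 < e ->
  (forall i j, `|A i j| < e) <-> `|A| < e.
Proof.
move=> e0; split=> [H|H i j]; last exact: le_lt_trans (mx_norm_ge _ _ _) H.
rewrite /Num.norm /= mx_normrE; apply/bigmax_ltP; split=> // -[i j] _; exact: H.
Qed.

(** A kernel vector [v] satisfies [|v| = |(B - 1) v| <= n e |v|], which forces [v = 0]. *)
Lemma near1_unitmx n (B : 'M[R]_n) (e : R) : n%:R * e < 1 -> `|B - 1%:M| <= e ->
  B \in unitmx.
Proof.
move=> ne Be; rewrite -unitmx_tr -row_free_unit -kermx_eq0; apply/eqP.
have H : B *m (kermx B^T)^T = 0
  by have /(congr1 trmx) := mulmx_ker B^T; rewrite trmx_mul trmxK trmx0.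
apply: trmx_inj; rewrite trmx0; apply/matrixP => i j; rewrite [RHS]mxE.
set v := col j (kermx B^T)^T.
have Bv : B *m v = 0 by rewrite /v colE mulmxA H mul0mx.
have vE : `|v| <= n%:R * e * `|v|.
  have -> : `|v| = `|(B - 1%:M) *m v| by rewrite mulmxBl Bv mul1mx sub0r normrN.
  apply: le_trans (mulmx_norm_le _ _) _.
  rewrite mulmxBl Bv mul1mx sub0r normrN ler_wpM2r// ler_wpM2l//.
have : `|v| <= 0.
  have := normr_ge0 v; nra.
rewrite normr_le0 => /eqP/matrixP/(_ i ord0); rewrite [X in _ = X]mxE => <-.
by rewrite [RHS]mxE.
Qed.

Lemma finite_lattice_ball n (g : 'M[R]_n) (B : R) : g \in unitmx ->
  finite_set [set z : 'cV[int]_n | `|g *m map_mx intr z| <= B].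
Proof.
move=> ug; pose K := n%:R * `|invmx g| * B : R.
pose N := (Num.truncn K).+1.
pose Z (f : {ffun 'I_n -> 'I_(N + N).+1}) : 'cV[int]_n :=
  \col_i ((f i)%:Z - N%:Z).
apply: (@sub_finite_set _ _ [set Z f | f in setT]); last first.
  exact/finite_image/finite_finset.
move=> z /= zB.
have zK i : `|(z i ord0)%:~R : R| <= K.
  have zE : map_mx intr z = invmx g *m (g *m map_mx intr z).
    by rewrite mulmxA mulVmx// mul1mx.
  have -> : (z i ord0)%:~R = (map_mx intr z : 'cV[R]_n) i ord0 by rewrite mxE.
  apply: le_trans (mx_norm_ge _ _ _) _; rewrite zE.
  by apply: le_trans (mulmx_norm_le _ _) _; rewrite ler_wpM2l// mulr_ge0.
have zN i : (`|z i ord0| <= N%:Z)%R.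
  rewrite -(ler_int R) intr_norm; apply: le_trans (zK i) _.
  by apply: ltW; exact: truncnS_gt.
exists [ffun i => inord `|(z i ord0 + N%:Z)%R|%N] => //.
apply/matrixP => i j; rewrite !mxE ffunE.
have := zN i; rewrite ler_norml => /andP[h1 h2].
have h3 : 0 <= z i ord0 + N%:Z by rewrite -lerBlDr sub0r.
have h4 : (`|(z i ord0 + N%:Z)%R| < (N + N).+1)%N.
  by rewrite ltnS -lez_nat gez0_abs// PoszD lerD2r.
by rewrite inordK// gez0_abs// addrK [j]ord1.
Qed.

End Norm.

Section Near.
Variables (R : realType) (m : nat).
Implicit Types (x y : 'cV[R]_m) (w : 'cV[R]_m.+1) (s c T : R).

Lemma cone_norm c T w : 0 < c -> cone c T w -> `|w| <= (1 + c) * w ord0 ord0.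
Proof.
move=> c0 [/andP[w0 _] wi]; apply/mx_norm_leP => [|i j]; first by nra.
rewrite ord1; case: (unliftP ord0 i) => [k|] ->.
  by have := wi k; nra.
by rewrite gtr0_norm//; nra.
Qed.

Lemma cone_near_aux c T c1 T1 : 0 < c -> c < c1 -> 0 < T -> T < T1 ->
  exists2 e, 0 < e & forall w w', (forall i, `|w' i ord0 - w i ord0| <= e * w ord0 ord0) ->
    cone c T w -> cone c1 T1 w'.
Proof.
move=> c0 cc1 T0 TT1.
(* One bound per requirement: the first coordinate stays positive, [c + e <= c1 * (1 - e)] for the
   aperture, and [(1 + e) * T <= T1] for the height. *)
pose e := Num.min (1/2) (Num.min ((c1 - c) / (1 + c1)) ((T1 - T) / T)).
have e0 : 0 < e.
  rewrite !lt_min; apply/and3P; split; first by lra.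
    by rewrite divr_gt0//; lra.
  by rewrite divr_gt0//; lra.
have [e1 e2 e3] : [/\ e <= 1/2, e * (1 + c1) <= c1 - c & e * T <= T1 - T].
  have : e <= e by [].
  rewrite {2}/e !le_min => /and3P[e1 e2 e3]; split => //.
    by rewrite -ler_pdivlMr//; lra.
  by rewrite -ler_pdivlMr.
exists e => // w w' ww' [/andP[w0 wT] wi].
have := ww' ord0; rewrite ler_norml => /andP[h1 h2].
have w'0 : (1 - e) * w ord0 ord0 <= w' ord0 ord0 by lra.
split; first by apply/andP; split; nra.
move=> i; have h3 := ww' (lift ord0 i); have h4 := wi i.
have h5 : `|w' (lift ord0 i) ord0| <= `|w (lift ord0 i) ord0| + e * w ord0 ord0.
  have -> : w' (lift ord0 i) ord0 = w (lift ord0 i) ord0 +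
    (w' (lift ord0 i) ord0 - w (lift ord0 i) ord0) by ring.
  by apply: le_trans (ler_normD _ _) _; rewrite lerD2l.
nra.
Qed.

(** The displacement [b *m w - w] is a small multiple of [|w|], and inside a cone [|w|] is
    controlled by the height. The second half needs no inverse of [b]: the displacement is at most
    [|w| / 2], so [|w| <= 2 |b w|]. *)
Lemma cone_near c T c1 T1 : 0 < c -> c < c1 -> 0 < T -> T < T1 ->
  exists2 e, 0 < e & forall b : 'M[R]_m.+1, `|b - 1%:M| <= e ->
    (forall w, cone c T w -> cone c1 T1 (b *m w)) /\
    (forall w, cone c T (b *m w) -> cone c1 T1 w).
Proof.
move=> c0 cc1 T0 TT1.
have [e e0 H] := cone_near_aux c0 cc1 T0 TT1.
pose N := m.+1%:R : R; have N0 : 0 < N by rewrite ltr0n.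
pose k := Num.min (1 / (2 * N)) (e / (2 * N * (1 + c))).
have k0 : 0 < k.
  by rewrite lt_min; apply/andP; split; rewrite divr_gt0// ?mulr_gt0//; lra.
have [k1 k2] : k * (2 * N) <= 1 /\ k * (2 * N * (1 + c)) <= e.
  have : k <= k by [].
  rewrite {2}/k !le_min => /andP[k1 k2]; split.
    by rewrite -ler_pdivlMr// mulr_gt0.
  by rewrite -ler_pdivlMr// ?mulr_gt0//; lra.
exists k => // b bk.
have bw w : `|b *m w - w| <= N * k * `|w|.
  rewrite (_ : b *m w - w = (b - 1%:M) *m w); last by rewrite mulmxBl mul1mx.
  apply: le_trans (mulmx_norm_le _ _) _.
  by rewrite ler_wpM2r// ler_wpM2l// ltW.
split=> w cw.
  apply: (H w) => // i.
  have -> : (b *m w) i ord0 - w i ord0 = (b *m w - w) i ord0.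
    by rewrite [RHS]mxE [(- w) _ _]mxE.
  apply: le_trans (mx_norm_ge _ _ _) _; apply: le_trans (bw w) _.
  have := cone_norm c0 cw; have : 0 < w ord0 ord0 by case: cw => /andP[].
  by have := normr_ge0 w; nra.
apply: (H (b *m w)) => // i.
have -> : w i ord0 - (b *m w) i ord0 = (w - b *m w) i ord0.
  by rewrite [RHS]mxE [X in _ = _ + X]mxE.
apply: le_trans (mx_norm_ge _ _ _) _; rewrite distrC; apply: le_trans (bw w) _.
have h1 := cone_norm c0 cw; have h2 : 0 < (b *m w) ord0 ord0 by case: cw => /andP[].
have h3 : `|w| <= `|b *m w| + `|b *m w - w|.
  by rewrite [X in X <= _](_ : _ = `|b *m w - (b *m w - w)|) ?ler_normB// opprB addrC subrK.
have h4 := bw w; have h5 := normr_ge0 w.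
have h6 : N * k * `|w| <= `|w| / 2 by nra.
have h7 : `|w| <= 2 * (1 + c) * (b *m w) ord0 ord0 by nra.
have h8 : N * k * `|w| <= N * k * (2 * (1 + c) * (b *m w) ord0 ord0).
  by rewrite ler_wpM2l// mulr_ge0// ltW.
nra.
Qed.

Lemma mul_mx_horo p (A : 'M[R]_(p, m.+1)) x i j : (A *m horo x) i j =
  A i j - (j == ord0)%:R * \sum_k A i (lift ord0 k) * x k ord0.
Proof.
rewrite mulmxBr mulmx1 mxE; congr (_ + _); rewrite mxE; congr (- _).
rewrite mulmxA mxE big_ord1 [delta_mx _ _ _ _]mxE eqxx /= mulrC; congr (_ * _).
rewrite mxE big_ord_recl pad0 mulr0 add0r.
by apply: eq_bigr => k _; rewrite padS.
Qed.

(** [x] is chosen, before [s], so that column 0 of [b] vanishes below the corner; the equation is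
    [B *m x = - c]. Conjugation by [dil s] would expand exactly these entries. It multiplies the
    rest of row 0 by [s ^- m.+1] and fixes all other entries, so [b] stays near 1 for every
    [s >= 1]. *)
Lemma horo_decomp (e : R) : 0 < e -> exists2 k, 0 < k &
  forall g : 'M[R]_m.+1, `|g - 1%:M| <= k -> exists b x, g = b *m horo x /\
    forall s, 1 <= s -> exists2 b', `|b' - 1%:M| <= e & dil m s *m b = b' *m dil m s.
Proof.
move=> e0; pose N := m.+1%:R : R; have N0 : 0 < N by rewrite ltr0n.
pose k := Num.min (1 / (2 * N)) (e / 2).
have k0 : 0 < k.
  by rewrite lt_min; apply/andP; split; rewrite divr_gt0// mulr_gt0.
have [k1 k2] : k * (2 * N) <= 1 /\ k * 2 <= e.
  have : k <= k by [].
  rewrite {2}/k !le_min => /andP[k1 k2]; split.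
    by rewrite -ler_pdivlMr// mulr_gt0.
  by rewrite -ler_pdivlMr.
exists k => // g gk.
have gE i j : `|g i j - (i == j)%:R| <= k.
  apply: le_trans gk; have := mx_norm_ge (g - 1%:M) i j.
  by rewrite [(g - _) i j]mxE [X in _ + X]mxE [(1%:M) i j]mxE.
pose B : 'M[R]_m := \matrix_(i, j) g (lift ord0 i) (lift ord0 j).
pose c : 'cV[R]_m := \col_i g (lift ord0 i) ord0.
have Bk : `|B - 1%:M| <= k.
  apply/mx_norm_leP => [|i j]; first exact: ltW.
  rewrite 3!mxE [(1%:M) i j]mxE -(inj_eq (@lift_inj _ ord0)).
  exact: gE.
have mk : m%:R * k <= 1/2.
  have : m%:R <= N by rewrite ler_nat.
  by nra.
have uB : B \in unitmx by apply: (near1_unitmx _ Bk); lra.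
pose x := - (invmx B *m c).
have Bx : B *m x = - c by rewrite mulmxN mulmxA mulmxV// mul1mx.
have ck : `|c| <= k.
  apply/mx_norm_leP => [|i j]; first exact: ltW.
  rewrite mxE; have := gE (lift ord0 i) ord0.
  by rewrite [lift _ _ == _]eq_sym (negPf (neq_lift _ _)) subr0.
have xk : `|x| <= 2 * k.
  have h1 : `|(B - 1%:M) *m x| <= m%:R * k * `|x|.
    apply: le_trans (mulmx_norm_le _ _) _.
    by rewrite ler_wpM2r// ler_wpM2l.
  have h2 : `|x| <= k + `|(B - 1%:M) *m x|.
    rewrite (_ : `|x| = `|- c - (B - 1%:M) *m x|).
      by apply: le_trans (ler_normB _ _) _; rewrite normrN lerD2r.
    by rewrite mulmxBl Bx mul1mx opprB addrC subrK.
  have := normr_ge0 x; nra.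
pose b := g *m horo (- x).
have bE i j : b i j = g i j + (j == ord0)%:R *
    \sum_k g i (lift ord0 k) * x k ord0.
  rewrite /b mul_mx_horo -mulrN -sumrN; congr (_ + _ * _).
  by apply: eq_bigr => l _; rewrite mxE mulrN opprK.
have b0 i : b (lift ord0 i) ord0 = 0.
  have /matrixP/(_ i ord0) := Bx; rewrite bE mul1r [X in X = _ -> _]mxE.
  under eq_bigr do rewrite mxE.
  by move=> ->; rewrite !mxE addrN.
have b00 : `|b ord0 ord0 - 1| <= 2 * k.
  rewrite bE mul1r addrAC.
  have h1 : `|\sum_l g ord0 (lift ord0 l) * x l ord0| <= m%:R * (k * (2 * k)).
    apply: le_trans (ler_norm_sum _ _ _) _.
    rewrite -[m in leRHS]card_ord mulr_natl -sumr_const; apply: ler_sum => l _.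
    rewrite normrM ler_pM//; last exact: le_trans (mx_norm_ge _ _ _) xk.
    by have := gE ord0 (lift ord0 l); rewrite (negPf (neq_lift _ _)) subr0.
  apply: le_trans (ler_normD _ _) _.
  by have := gE ord0 ord0; rewrite eqxx => h2; nra.
have bj i j : j != ord0 -> b i j = g i j.
  by move=> /negPf j0; rewrite bE j0 mul0r addr0.
have gb : g = b *m horo x by rewrite /b -mulmxA horoM addNr horo0 mulmx1.
clearbody b.
exists b, x; split=> //.
move=> s s1.
exists (\matrix_(i, j) if (i == ord0) && (j != ord0) then s ^- m.+1 * b i j else b i j).
  apply/mx_norm_leP => [|i j]; first exact: ltW.
  rewrite !mxE.
  have [->|j0] /= := eqVneq j ord0.
    rewrite andbF; case: (unliftP ord0 i) => [l|] ->.
      by rewrite b0 [lift _ _ == _]eq_sym (negPf (neq_lift _ _)) subr0 normr0 ltW.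
    by rewrite eqxx (le_trans b00)// mulrC.
  rewrite andbT bj//; have [->|i0] := eqVneq i ord0.
    have := gE ord0 j; rewrite eq_sym (negPf j0) !subr0 normrM => h.
    have s1' : `|s ^- m.+1| <= 1.
      by rewrite ger0_norm ?invr_ge0 ?exprn_ge0 ?invf_le1 ?exprn_gt0 ?exprn_ege1//; lra.
    have := normr_ge0 (g ord0 j); have := normr_ge0 (s ^- m.+1); nra.
  by have := gE i j; lra.
have s0 : s != 0 by rewrite gt_eqF//; lra.
have sm : s ^+ m != 0 by rewrite expf_neq0.
apply/matrixP => i j; rewrite mul_diag_mx mul_mx_diag !mxE.
have [->|j0] /= := eqVneq j ord0; have [->|i0] /= := eqVneq i ord0.
- by rewrite mulrC.
- by case: (unliftP ord0 i) i0 => [l|] ->; rewrite ?b0 ?mulr0 ?mul0r// eqxx.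
- by rewrite exprS; field; rewrite s0 sm.
- by rewrite mulrC.
Qed.

End Near.

(** * Continuity of the law of F1 *)

Lemma finite_set_nat_ub (A : set nat) : finite_set A ->
  exists N, forall k, A k -> (k < N)%N.
Proof.
move=> /finite_fsetP[X ->]; exists (\max_(i <- finmap.enum_fset X) i).+1 => k kX.
by rewrite ltnS; apply: leq_bigmax_seq.
Qed.

Section HeightF1.
Variables (R : realType) (m : nat).
Local Notation X := (lattice_space R m.+1).
Implicit Types (x y : 'cV[R]_m) (w : 'cV[R]_m.+1) (s c T : R) (L : X).

Lemma col_cons0 (u : R) x : col_cons u x ord0 ord0 = u.
Proof.
rewrite /col_cons (_ : ord0 = lshift m (@ord0 0)); last exact: val_inj.
by rewrite (@col_mxEu _ 1 m) mxE.
Qed.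

Lemma col_consS (u : R) x i : col_cons u x (lift ord0 i) ord0 = x i ord0.
Proof.
rewrite /col_cons (_ : lift ord0 i = rshift 1 i); last exact: val_inj.
by rewrite (@col_mxEd _ 1 m).
Qed.

Lemma col_cons_eta w : w = col_cons (w ord0 ord0) (\col_i w (lift ord0 i) ord0).
Proof. by apply: cVP => [|i]; rewrite ?col_cons0 ?col_consS ?mxE. Qed.

Lemma cone_heightsP L u : cone_heights L u <-> exists z : 'cV[int]_m.+1,
  let w := SLmx (repr L) *m map_mx intr z in
  [/\ 0 < u, w ord0 ord0 = u & forall i, `|w (lift ord0 i) ord0| < u].
Proof.
split=> [[u0 [v [[z zE] /cone1E vu]]]|[z [u0 wu wi]]].
  exists z => /=; rewrite -zE col_cons0; split=> // i; rewrite col_consS.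
  exact: le_lt_trans (mx_norm_ge _ _ _) vu.
split=> //; exists (\col_i (SLmx (repr L) *m map_mx intr z) (lift ord0 i) ord0).
split; last by apply/cone1E/mx_norm_ltP => // i j; rewrite mxE.
by exists z; rewrite [RHS]col_cons_eta wu.
Qed.

Lemma F1_gt0 L : 0 < F1 L.
Proof. by have [[]] := F1P L. Qed.

Lemma F1_attained L : exists z : 'cV[int]_m.+1,
  let w := SLmx (repr L) *m map_mx intr z in
  w ord0 ord0 = F1 L /\ forall i, `|w (lift ord0 i) ord0| < w ord0 ord0.
Proof.
have [/cone_heightsP[z [_ h1 h2]] _] := F1P L.
by exists z => /=; rewrite h1.
Qed.

Lemma F1_act L A : \det A = 1 -> exists z : 'cV[int]_m.+1,
  let w := A *m SLmx (repr L) *m map_mx intr z in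
  w ord0 ord0 = F1 (act A L) /\ forall i, `|w (lift ord0 i) ord0| < w ord0 ord0.
Proof.
move=> dA; pose O := [set w : 'cV[R]_m.+1 | w ord0 ord0 = F1 (act A L) /\
  forall i, `|w (lift ord0 i) ord0| < w ord0 ord0].
have : lhit O (act A L) by have [z] := F1_attained (act A L); exists z.
by move=> /(lhit_act _ _ dA)[z]; exists z.
Qed.

Lemma F1_lb L (z : 'cV[int]_m.+1) (w := SLmx (repr L) *m map_mx intr z) :
  0 < w ord0 ord0 -> (forall i, `|w (lift ord0 i) ord0| < w ord0 ord0) ->
  F1 L <= w ord0 ord0.
Proof.
move=> w0 wi; have [_] := F1P L; apply.
by apply/cone_heightsP; exists z.
Qed.

Lemma F1_ltP L T : F1 L < T <-> lhit (cone 1 T) L.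
Proof.
split=> [FT|[z [/andP[w0 wT] wi]]].
  have [z /= [zF zi]] := F1_attained L; exists z.
  by split=> [|i]; rewrite ?zF ?F1_gt0// mul1r -zF.
by apply: le_lt_trans wT; apply: F1_lb => // i; have := wi i; rewrite mul1r.
Qed.

End HeightF1.

Lemma exprn_near1 (R : realFieldType) (n : nat) (a : R) : 1 < a ->
  exists2 r, 1 < r & r ^+ n < a.
Proof.
move=> a1; elim: n => [|n [r r1 rn]]; first by exists 2; rewrite ?expr0 ?ltr1n.
have rn0 : 0 < r ^+ n by rewrite exprn_gt0// (lt_trans _ r1).
pose b := a / r ^+ n; have b1 : 1 < b by rewrite ltr_pdivlMr// mul1r.
pose t := Num.min r ((1 + b) / 2).
have t1 : 1 < t by rewrite lt_min r1/=; lra.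
exists t => //; rewrite exprS.
have tr : t ^+ n <= r ^+ n by rewrite lerXn2r// ?nnegrE ?ge_min ?lexx//; lra.
have tb : t < b by rewrite gt_min; apply/orP; right; lra.
have h1 : r ^+ n * t < r ^+ n * b by rewrite ltr_pM2l.
have h2 : t * t ^+ n <= r ^+ n * t by rewrite mulrC ler_wpM2r//; lra.
by apply: le_lt_trans h2 _; rewrite (lt_le_trans h1)// /b mulrCA divff ?gt_eqF// mulr1.
Qed.

Section Distribution.
Variables (R : realType) (m : nat).
Local Notation X := (borel_lattice_space R m.+1).
Hypothesis m0 : (0 < m)%N.
Variables (mu : probability X R) (mu_inv : SL_invariant mu).

Lemma mu_act A (E : set X) : measurable E -> mu (act A @^-1` E) = mu E.
Proof. exact: mu_inv. Qed.

Lemma measurable_F1_lt (T : R) : measurable ([set L | F1 L < T] : set X).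
Proof.
rewrite (_ : [set _ | _] = lhit (cone 1 T)).
  by apply: measurable_lhit; exact: open_cone.
by apply/seteqP; split=> L /F1_ltP.
Qed.

Lemma measurable_fun_F1 : measurable_fun setT (fun L : X => F1 L).
Proof.
apply: (measurability _ (measurable_realfun.RGenInftyO.measurableE R)) => _ /= [_ [T ->] <-]; rewrite setTI.
rewrite (_ : _ @^-1` _ = [set L : X | F1 L < T]); first exact: measurable_F1_lt.
by apply/seteqP; split=> L /=; rewrite in_itv.
Qed.

Lemma measurable_F1_le (T : R) : measurable ([set L | F1 L <= T] : set X).
Proof.
rewrite (_ : [set _ | _] = setT `&` (fun L : X => F1 L) @^-1` `]-oo, T]).
  by apply: measurable_fun_F1.
by apply/seteqP; split=> L /=; rewrite in_itv /=; [move=> ?; split|case].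
Qed.

Lemma measurable_F1_eq (T : R) : measurable ([set L | F1 L = T] : set X).
Proof.
rewrite (_ : [set _ | _] = setT `&` (fun L : X => F1 L) @^-1` [set T]).
  by apply: measurable_fun_F1.
by apply/seteqP; split=> L /=; [move=> ?; split|case].
Qed.

(* The dilates of the event F1 = T along infinitely many parameters have the
   same probability, yet a lattice lies in only finitely many of them. *)
Lemma F1_atomless (T : R) : mu [set L | F1 L = T] = 0%E.
Proof.
(* Distinct parameters in ]1, 2]: bounded, so that all the lattice points involved lie in one
   ball. *)
pose s k : R := 1 + k.+1%:R^-1.
have s0 k : 0 < s k by rewrite /s addr_gt0// invr_gt0.
have s2 k : s k <= 2.
  by rewrite /s -[2]/(1 + 1) lerD2l invf_le1// ler1n.
pose E k := act (dil m (s k)) @^-1` [set L : X | F1 L = T].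
have mE k : measurable (E k : set X).
  rewrite -[E k]setTI; apply: measurable_act => //.
  exact: measurable_F1_eq.
pose A N := \bigcup_(k in [set k | (N <= k)%N]) E k.
have mA N : measurable (A N : set X) by apply: bigcup_measurable.
have A0 : \bigcap_N A N = set0.
  apply/seteqP; split=> // L AL.
  pose g := SLmx (repr L).
  have T0 : 0 < T by have [k _ <-] := AL 0%N I; exact: F1_gt0.
  (* If [L] lies in [E k], it has a point of height exactly [s k ^+ m * T] in the ball of radius
     [2 ^+ m * T]. These heights are distinct since [m > 0], and the ball contains finitely many
     lattice points. *)
  have [N NP] : exists N, forall k, E k L -> (k < N)%N.
    apply: finite_set_nat_ub.
    pose S := [set z : 'cV[int]_m.+1 | `|g *m map_mx intr z| <= 2 ^+ m * `|T|].
    have fS : finite_set S by apply: finite_lattice_ball; exact: SL_unit.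
    pose h (z : 'cV[int]_m.+1) : R := (g *m map_mx intr z) ord0 ord0.
    pose f k := s k ^+ m * T.
    apply: (@sub_finite_set _ _ (f @^-1` (h @` S))); last first.
      apply: finite_preimage; last exact: finite_image.
      move=> k l _ _ /(mulIf (lt0r_neq0 T0))/eqP.
      rewrite eqrXn2 ?(ltW (s0 _))//.
      by move=> /eqP/addrI/invr_inj/eqP; rewrite eqr_nat => /eqP[].
    move=> k Ek; have [z] := F1_act L (@det_dil _ m _ (s0 k)).
    move: Ek; rewrite /E /= => ->; rewrite -/g -mulmxA => -[z0 zi].
    have u0 : h z = f k.
      by rewrite /f -z0 dil0 mulrA divff ?mul1r// expf_neq0// gt_eqF.
    exists z => //; apply/mx_norm_leP => [|i j]; first by rewrite mulr_ge0.
    have s1 : 1 <= s k by rewrite /s lerDl invr_ge0.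
    have sm1 : 1 <= s k ^+ m by rewrite exprn_ege1.
    have sm2 : s k ^+ m <= 2 ^+ m by rewrite lerXn2r// ?nnegrE// ltW.
    have T2 : T <= 2 ^+ m * `|T| by rewrite gtr0_norm//; nra.
    rewrite ord1; case: (unliftP ord0 i) => [l|] ->.
      have := zi l; rewrite z0 dilS normrM gtr0_norm// => h1.
      by have := normr_ge0 ((g *m map_mx intr z) (lift ord0 l) ord0); nra.
    rewrite -/(h z) u0 /f gtr0_norm ?mulr_gt0 ?exprn_gt0//.
    by rewrite gtr0_norm// ler_wpM2r// ltW.
  have [k /= Nk Ek] := AL N I.
  by have := NP _ Ek; rewrite ltnNge Nk.
have : mu \o A @ \oo --> mu (\bigcap_N A N).
  apply: nonincreasing_cvg_mu => //.
  - by rewrite (le_lt_trans (probability_le1 _ _))// ltry.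
  - exact: bigcap_measurable.
  - apply/nonincreasing_seqP => N; apply/subsetPset => L [k /= Nk Ek].
    by exists k => //=; exact: ltnW.
rewrite A0 measure0 => cv0; apply/eqP; rewrite eq_le measure_ge0 andbT.
apply: (cvge_to_ge cv0); apply: nearW => N /=.
rewrite -(mu_act (dil m (s N)) (measurable_F1_eq T)).
by apply: le_measure; rewrite ?inE; [exact: (mE N)|exact: mA|move=> L LE; exists N => /=].
Qed.

(** The cone is the image of [cone 1 T] under [dil s], so by invariance its event has a measure
    independent of [s]. A change of aperture thereby costs no measure, and continuity in the height
    alone suffices. *)
Definition cone_event (s T : R) : set X := lhit (cone (s ^+ m.+1) (s ^- m * T)).

Lemma measurable_cone_event (s T : R) : measurable (cone_event s T).
Proof. by apply: measurable_lhit; exact: open_cone. Qed.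

Lemma cone_event1 (T : R) : cone_event 1 T = [set L | F1 L < T].
Proof.
rewrite /cone_event !expr1n invr1 mul1r.
by apply/seteqP; split=> L /F1_ltP.
Qed.

Lemma mu_cone_event (s T : R) : 0 < s -> mu (cone_event s T) = mu [set L | F1 L < T].
Proof.
move=> s0; rewrite -(mu_act (dil m s) (measurable_cone_event s T)); congr (mu _).
apply/seteqP; split=> L.
  rewrite /preimage /= => /(lhit_act _ _ (det_dil m s0))[z].
  rewrite -mulmxA -[s ^+ m.+1]mul1r => /(cone_dil _ _ _ s0) H.
  by apply/F1_ltP; exists z.
move=> /F1_ltP[z /(cone_dil _ _ _ s0)]; rewrite mul1r => H.
by apply/(lhit_act _ _ (det_dil m s0)); exists z; rewrite -mulmxA.
Qed.

Lemma mu_F1_le (T : R) : mu [set L | F1 L <= T] = mu [set L | F1 L < T].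
Proof.
rewrite (_ : [set _ | _] = [set L | F1 L < T] `|` [set L | F1 L = T]); last first.
  apply/seteqP; split=> L /=; first by rewrite le_eqVlt => /orP[/eqP|]; [right|left].
  by move=> [/ltW|->].
rewrite measureU//; [|exact: measurable_F1_lt|exact: measurable_F1_eq|].
  by rewrite [X in (_ + X)%E](F1_atomless T) adde0.
by apply/seteqP; split=> // L /= [/lt_eqF/eqP].
Qed.

(** The events at heights [a k] increase to [F1 < T], those at heights [b k] decrease to [F1 <= T];
    both limits have the same measure because [F1 = T] is null. *)
Lemma mu_F1_continuous (T e : R) : 0 < T -> 0 < e -> exists T1 T2,
  [/\ 0 < T1, T1 < T, T < T2 &
  (mu [set L | F1 L < T2]%R <= mu [set L | F1 L < T1]%R + e%:E)%E].
Proof.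
move=> T0 e0.
pose a k : R := T * (1 - k.+2%:R^-1).
pose b k : R := T * (1 + k.+2%:R^-1).
have mF := measurable_F1_lt.
have k2 k : 0 < (k.+2%:R^-1 : R) <= 2^-1.
  by rewrite invr_gt0 ltr0n/= lef_pV2 ?posrE// ler_nat.
have ak k : 0 < a k < T.
  rewrite /a; case/andP: (k2 k); move: (k.+2%:R^-1 : R) => x x0 x1.
  by apply/andP; split; nra.
have bk k : T < b k.
  by rewrite /b; case/andP: (k2 k); move: (k.+2%:R^-1 : R) => x x0 x1; nra.
have k1 k l : (k <= l)%N -> l.+2%:R^-1 <= k.+2%:R^-1 :> R.
  by move=> kl; rewrite lef_pV2 ?posrE// ler_nat.
have kT (t : R) : 0 < t -> exists k, T * k.+2%:R^-1 < t.
  move=> t0; exists (Num.truncn (T / t)).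
  rewrite ltr_pdivrMr// mulrC -ltr_pdivrMr//.
  by rewrite (lt_le_trans (truncnS_gt _))// ler_nat.
have ca : (mu \o (fun k => [set L | F1 L < a k])) @ \oo --> mu [set L | F1 L < T].
  rewrite (_ : [set L | F1 L < T] = \bigcup_k [set L | F1 L < a k]).
    apply: nondecreasing_cvg_mu => //; first exact: bigcupT_measurable.
    move=> k l kl; apply/subsetPset => L /= /lt_le_trans; apply.
    by rewrite /a ler_pM2l// lerD2l lerN2; exact: k1.
  apply/seteqP; split=> L /= => [FT|[k _]]; last first.
    by move/lt_trans; apply; case/andP: (ak k).
  have [k kF] := kT (T - F1 L) ltac:(lra).
  by exists k => //=; rewrite /a mulrBr mulr1 ltrBrDl -ltrBrDr.
have cb : (mu \o (fun k => [set L | F1 L < b k])) @ \oo --> mu [set L | F1 L < T].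
  rewrite -mu_F1_le (_ : [set L | F1 L <= T] = \bigcap_k [set L | F1 L < b k]).
    apply: nonincreasing_cvg_mu => //.
    - by rewrite (le_lt_trans (probability_le1 _ _))// ltry.
    - exact: bigcap_measurable.
    move=> k l kl; apply/subsetPset => L /= /lt_le_trans; apply.
    by rewrite /b ler_pM2l// lerD2l; exact: k1.
  apply/seteqP; split=> L /= => [FT k _|FT].
    by apply: le_lt_trans FT _.
  rewrite leNgt; apply/negP => TF.
  have [k kF] := kT (F1 L - T) ltac:(lra).
  have := FT k I; rewrite /b /= mulrDr mulr1 -ltrBlDl => /lt_trans/(_ kF).
  by rewrite ltxx.
pose h := fine (mu [set L | F1 L < T]).
have fin A : measurable A -> mu A \is a fin_num.
  by move=> mA; exact: fin_num_measure.
have hE : mu [set L | F1 L < T] = h%:E by rewrite fineK// fin.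
rewrite hE in ca cb.
have e2 : 0 < e / 2 by lra.
have /fine_cvgP[_ /cvgrPdist_lt/(_ _ e2) na] := ca.
have /fine_cvgP[_ /cvgrPdist_lt/(_ _ e2) nb] := cb.
have [k [ka kb]] := filter_ex (filterI na nb).
exists (a k), (b k); split.
- by case/andP: (ak k).
- by case/andP: (ak k).
- exact: bk.
move: ka kb; rewrite /= !ltr_norml => /andP[_ ka] /andP[kb _].
rewrite -[X in (X <= _)%E]fineK ?fin// -[X in (_ <= X + _)%E]fineK ?fin//.
by rewrite -EFinD lee_fin; lra.
Qed.

(** The heights [T1] and [T2] come from continuity of the law, the apertures from moving [s]. Moving
    [s] also rescales heights, by [r1 ^+ m] or [r2 ^- m], so [r1] and [r2] are taken close enough to
    1 not to undo the gain from [T1] and [T2]. *)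
Lemma cone_event_margin (s T e : R) : 0 < s -> 0 < T -> 0 < e ->
  exists s1 T1 s2 T2, [/\ [/\ 0 < s1, s1 < s & s < s2],
   [/\ 0 < T1, s1 ^- m * T1 < s ^- m * T & s ^- m * T < s2 ^- m * T2] &
   (mu (cone_event s2 T2) <= mu (cone_event s1 T1) + e%:E)%E].
Proof.
move=> s0 T0 e0; have [T1 [T2 [T10 T1T TT2 H]]] := mu_F1_continuous T0 e0.
have sm (t : R) : 0 < t -> 0 < t ^+ m by move=> t0; rewrite exprn_gt0.
have [r1 r11 rT1] : exists2 r, 1 < r & r ^+ m < T / T1.
  by apply: exprn_near1; rewrite ltr_pdivlMr// mul1r.
have [r2 r21 rT2] : exists2 r, 1 < r & r ^+ m < T2 / T.
  by apply: exprn_near1; rewrite ltr_pdivlMr// mul1r.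
exists (s / r1), T1, (s * r2), T2.
have r10 : 0 < r1 by lra.
have r20 : 0 < r2 by lra.
split; last by (rewrite mu_cone_event ?mulr_gt0//; rewrite mu_cone_event ?divr_gt0//).
  by split; rewrite ?divr_gt0// ?ltr_pdivrMr// ?ltr_pMr.
split=> //.
  rewrite expr_div_n invf_div mulrAC [X in _ < X]mulrC ltr_pM2r ?invr_gt0 ?sm//.
  by rewrite -ltr_pdivlMr.
rewrite exprMn invfM -mulrA ltr_pM2l ?invr_gt0 ?sm//.
rewrite mulrC ltr_pdivlMr ?sm//.
by rewrite mulrC -ltr_pdivlMr.
Qed.

End Distribution.

(** * Almost invariant averages and the Mautner phenomenon *)

Section BoundedMeasurable.
Context d (T : measurableType d) (R : realType).
Implicit Types f g : T -> R.

(** On a probability space this class makes every integrability condition automatic and is closed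
    under the operations used below. *)
Definition bmeas f := measurable_fun setT f /\ exists M : R, forall x, `|f x| <= M.

Lemma bmeas_cst (r : R) : bmeas (fun=> r).
Proof. by split; [exact: measurable_cst|exists `|r|]. Qed.

Lemma bmeas_indic (A : set T) : measurable A -> bmeas (\1_A).
Proof.
move=> mA; split; first exact: measurable_indic.
by exists 1 => x; rewrite indicE; case: (_ \in _); rewrite ?normr1 ?normr0.
Qed.

Lemma bmeasD f g : bmeas f -> bmeas g -> bmeas (fun x => f x + g x).
Proof.
move=> [mf [M fM]] [mg [N gN]]; split; first exact: measurable_funD.
by exists (M + N) => x; apply: le_trans (ler_normD _ _) _; exact: lerD.
Qed.

Lemma bmeasB f g : bmeas f -> bmeas g -> bmeas (fun x => f x - g x).
Proof.
move=> [mf [M fM]] [mg [N gN]]; split; first exact: measurable_funB.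
by exists (M + N) => x; apply: le_trans (ler_normB _ _) _; exact: lerD.
Qed.

Lemma bmeasM f g : bmeas f -> bmeas g -> bmeas (fun x => f x * g x).
Proof.
move=> [mf [M fM]] [mg [N gN]]; split; first exact: measurable_funM.
by exists (M * N) => x; rewrite normrM; exact: ler_pM.
Qed.

Lemma bmeasX2 f : bmeas f -> bmeas (fun x => f x ^+ 2).
Proof. by move=> bf; exact: (bmeasM bf bf). Qed.

Lemma bmeas_sum (I : Type) (s : seq I) (h : I -> T -> R) :
  (forall i, bmeas (h i)) -> bmeas (fun x => \sum_(i <- s) h i x).
Proof.
move=> bh; elim: s => [|i s IH].
  rewrite (_ : (fun x => _) = fun=> 0); first exact: bmeas_cst.
  by apply/funext => x; rewrite big_nil.
rewrite (_ : (fun x => _) = fun x => h i x + \sum_(j <- s) h j x).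
  exact: bmeasD.
by apply/funext => x; rewrite big_cons.
Qed.

End BoundedMeasurable.

Lemma bmeas_comp d1 d2 (T1 : measurableType d1) (T2 : measurableType d2)
    (R : realType) (f : T2 -> R) (h : T1 -> T2) :
  measurable_fun setT h -> bmeas f -> bmeas (f \o h).
Proof.
move=> mh [mf [M fM]]; split; first exact: measurableT_comp.
by exists M => x; exact: fM.
Qed.

Section Expectation.
Context d (T : measurableType d) (R : realType) (P : probability T R).
Implicit Types f g : T -> R.

Definition mean f : R := \int[P]_x f x.

Lemma bmeas_integrable f : bmeas f -> P.-integrable setT (EFin \o f).
Proof.
move=> [mf [M fM]]; apply: measurable_bounded_integrable => //.
  by rewrite (le_lt_trans (probability_le1 _ _))// ltry.
exists M; split; first exact: num_real.
by move=> N MN x _; exact: le_trans (fM x) (ltW MN).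
Qed.

Lemma meanE f : bmeas f -> (mean f)%:E = (\int[P]_x (f x)%:E)%E.
Proof.
move=> bf; rewrite /mean /Rintegral fineK//.
by apply: integrable_fin_num => //; exact: bmeas_integrable.
Qed.

Lemma meanD f g : bmeas f -> bmeas g -> mean (fun x => f x + g x) = mean f + mean g.
Proof. by move=> bf bg; apply: RintegralD => //; exact: bmeas_integrable. Qed.

Lemma meanB f g : bmeas f -> bmeas g -> mean (fun x => f x - g x) = mean f - mean g.
Proof. by move=> bf bg; apply: RintegralB => //; exact: bmeas_integrable. Qed.

Lemma meanZ (r : R) f : bmeas f -> mean (fun x => r * f x) = r * mean f.
Proof. by move=> bf; apply: RintegralZl => //; exact: bmeas_integrable. Qed.

Lemma mean_cst (r : R) : mean (fun=> r) = r.
Proof. by rewrite /mean Rintegral_cst// [X in fine X]probability_setT mulr1. Qed.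

Lemma mean_le f g : bmeas f -> bmeas g -> (forall x, f x <= g x) -> mean f <= mean g.
Proof.
by move=> bf bg fg; apply: le_Rintegral => //; exact: bmeas_integrable.
Qed.

Lemma mean_ge0 f : (forall x, 0 <= f x) -> 0 <= mean f.
Proof. by move=> f0; apply: Rintegral_ge0. Qed.

Lemma mean_indic (A : set T) : measurable A -> (mean (\1_A))%:E = P A.
Proof.
by move=> mA; rewrite meanE; [rewrite integral_indic// setIT|exact: bmeas_indic].
Qed.

Lemma mean_sum (I : Type) (s : seq I) (h : I -> T -> R) :
  (forall i, bmeas (h i)) ->
  mean (fun x => \sum_(i <- s) h i x) = \sum_(i <- s) mean (h i).
Proof.
move=> bh; elim: s => [|i s IH].
  rewrite big_nil -[RHS](mean_cst 0); congr mean.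
  by apply/funext => x; rewrite big_nil.
rewrite big_cons -IH -meanD//; last exact: bmeas_sum.
by congr mean; apply/funext => x; rewrite big_cons.
Qed.

Lemma mean_invariant f (h : T -> T) : measurable_fun setT h ->
  (forall A, measurable A -> P (h @^-1` A) = P A) -> bmeas f ->
  mean (f \o h) = mean f.
Proof.
move=> mh inv bf; apply: EFin_inj; rewrite !meanE//; last exact: bmeas_comp.
have -> : (\int[P]_x (f x)%:E = \int[pushforward P h]_x (f x)%:E)%E.
  by apply: eq_measure_integral => A mA _; apply: esym; exact: inv.
rewrite integral_pushforward//; first by case: bf => mf _; exact/measurable_EFinP.
by apply: bmeas_integrable; exact: bmeas_comp.
Qed.

Lemma mean_cvg (f : nat -> T -> R) (l M : R) (N : set T) :
  (forall k, bmeas (f k)) -> (forall k x, `|f k x| <= M) ->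
  measurable N -> P N = 0%E -> (forall x, ~ N x -> f ^~ x @ \oo --> l) ->
  (fun k => mean (f k)) @ \oo --> l.
Proof.
move=> bf fM mN N0 fl.
have [||||| _ _] := @dominated_convergence _ T R P setT measurableT
  (fun k x => (f k x)%:E) (fun=> l%:E) (fun=> M%:E).
- by move=> k; apply/measurable_EFinP; case: (bf k).
- exact: measurable_cst.
- exists N; split=> // x /= /not_implyP[_ H]; apply: contrapT => Nx; apply: H.
  by apply/fine_cvgP; split; [exact: nearW|exact: fl].
- exact: (bmeas_integrable (bmeas_cst T M)).
- by apply: aeW => x k _; rewrite lee_fin.
rewrite -(meanE (bmeas_cst T l)) mean_cst => /fine_cvgP[_]; apply: cvg_trans.
by apply: near_eq_cvg; apply: nearW => k /=.
Qed.

End Expectation.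

Lemma mulmx_norm_le_mx (R : realType) p q r (A : 'M[R]_(p, q)) (B : 'M[R]_(q, r)) :
  `|A *m B| <= q%:R * `|A| * `|B|.
Proof.
apply/mx_norm_leP => [|i j]; first by rewrite !mulr_ge0.
rewrite (_ : (A *m B) i j = (A *m col j B) i ord0); last first.
  by rewrite !mxE; apply: eq_bigr => k _; rewrite mxE.
apply: le_trans (mx_norm_ge _ _ _) _; apply: le_trans (mulmx_norm_le _ _) _.
rewrite ler_wpM2l// ?mulr_ge0//; apply/mx_norm_leP => // k l.
by rewrite mxE; exact: mx_norm_ge.
Qed.

Section Averages.
Variables (R : realType) (m : nat).
Local Notation X := (borel_lattice_space R m.+1).
Variables (mu : probability X R) (mu_inv : SL_invariant mu).
Implicit Types (psi : X -> R) (A B : 'M[R]_m.+1).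

Lemma bmeas_act psi A : bmeas psi -> bmeas (fun x : X => psi (act A x)).
Proof. by apply: bmeas_comp; exact: measurable_act. Qed.

Lemma mean_act psi A : bmeas psi -> mean mu (fun x : X => psi (act A x)) = mean mu psi.
Proof.
move=> bpsi; apply: (@mean_invariant _ X R mu psi (act A)) => //.
  exact: measurable_act.
by move=> E mE; apply: mu_act.
Qed.

(** The squared L2 distance from [psi] to its translate. Being squared, it obeys the triangle
    inequality only up to the factors 2 of [disp_mul]. *)
Definition disp psi A := mean mu (fun x : X => (psi (act A x) - psi x) ^+ 2).

Lemma bmeas_disp psi A : bmeas psi -> bmeas (fun x : X => (psi (act A x) - psi x) ^+ 2).
Proof. by move=> bpsi; apply: bmeasX2; apply: bmeasB => //; exact: bmeas_act. Qed.

Lemma disp_mul psi A B : bmeas psi -> \det A = 1 -> \det B = 1 ->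
  disp psi (A *m B) <= 2 * disp psi A + 2 * disp psi B.
Proof.
move=> bpsi dA dB.
have bA := bmeas_disp A bpsi; have bB := bmeas_disp B bpsi.
have bAB := bmeas_act B bA.
rewrite {2}/disp -(mean_act B bA) -!meanZ// -meanD; last 2 first.
  by apply: bmeasM => //; exact: bmeas_cst.
  by apply: bmeasM => //; exact: bmeas_cst.
apply: mean_le.
- exact: bmeas_disp.
- by apply: bmeasD; apply: bmeasM => //; exact: bmeas_cst.
move=> x; rewrite act_mul//.
set a := psi (act A _); set b := psi (act B x); set c := psi x.
by have := sqr_ge0 (a - b - (b - c)); nra.
Qed.

Lemma disp_addl psi1 psi2 A : bmeas psi1 -> bmeas psi2 ->
  disp (fun x : X => psi1 x + psi2 x) A <= 2 * disp psi1 A + 2 * disp psi2 A.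
Proof.
move=> b1 b2; have c1 := bmeas_disp A b1; have c2 := bmeas_disp A b2.
rewrite -!meanZ// -meanD; last 2 first.
  by apply: bmeasM => //; exact: bmeas_cst.
  by apply: bmeasM => //; exact: bmeas_cst.
apply: mean_le.
- by apply: bmeas_disp; exact: bmeasD.
- by apply: bmeasD; apply: bmeasM => //; exact: bmeas_cst.
move=> x.
set a := psi1 (act A _); set b := psi1 x; set c := psi2 (act A x); set d := psi2 x.
by have := sqr_ge0 (a - b - (c - d)); nra.
Qed.

Lemma dispZ psi A (r : R) : bmeas psi -> disp (fun x : X => r * psi x) A = r ^+ 2 * disp psi A.
Proof.
move=> b; rewrite -meanZ; last exact: bmeas_disp.
by congr mean; apply/funext => x; rewrite -mulrBr exprMn.
Qed.

Lemma disp_conj psi A B : bmeas psi -> \det A = 1 -> \det B = 1 ->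
  disp (fun x : X => psi (act B x)) A = disp psi (B *m A *m invmx B).
Proof.
move=> b dA dB; have uB : B \in unitmx by rewrite unitmxE dB unitr1.
rewrite [RHS]/disp -(mean_act B); last exact: bmeas_disp.
congr mean; apply/funext => x.
by rewrite -!act_mul ?det_mulmx ?dA ?dB ?det_inv ?dB ?invr1 ?mulr1// mulmxKV.
Qed.

(** Strong continuity at the identity of the translation action on L2, for the single vector
    [psi]. *)
Definition cont1 psi := forall e : R, 0 < e -> exists2 k, 0 < k &
  forall A, \det A = 1 -> `|A - 1%:M| <= k -> disp psi A <= e.

Lemma cont1D psi1 psi2 : bmeas psi1 -> bmeas psi2 -> cont1 psi1 -> cont1 psi2 ->
  cont1 (fun x : X => psi1 x + psi2 x).
Proof.
move=> b1 b2 c1 c2 e e0.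
have e4 : 0 < e / 4 by lra.
have [k1 k10 h1] := c1 _ e4; have [k2 k20 h2] := c2 _ e4.
exists (Num.min k1 k2); first by rewrite lt_min k10.
move=> A dA; rewrite le_min => /andP[A1 A2].
apply: le_trans (disp_addl _ b1 b2) _.
have := h1 A dA A1; have := h2 A dA A2; lra.
Qed.

Lemma cont1Z psi (r : R) : bmeas psi -> cont1 psi -> cont1 (fun x : X => r * psi x).
Proof.
move=> b c e e0; have r0 : 0 < r ^+ 2 + 1 by have := sqr_ge0 r; lra.
have [|k k0 h] := c (e / (r ^+ 2 + 1)); first by rewrite divr_gt0.
exists k => // A dA Ak; rewrite dispZ//.
have := h A dA Ak; rewrite ler_pdivlMr//.
have : 0 <= disp psi A by apply: mean_ge0 => x; exact: sqr_ge0.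
by have := sqr_ge0 r; nra.
Qed.

Lemma cont1_act psi B : bmeas psi -> \det B = 1 -> cont1 psi ->
  cont1 (fun x : X => psi (act B x)).
Proof.
move=> b dB c e e0; have [k k0 h] := c e e0.
have uB : B \in unitmx by rewrite unitmxE dB unitr1.
(* Bounds the factor by which conjugation by [B] enlarges the distance to 1; the added 1 keeps it
   positive. *)
pose N := m.+1%:R * (m.+1%:R * `|B|) * `|invmx B| + 1 : R.
have N0 : 0 < N by rewrite ltr_wpDl// !mulr_ge0.
exists (k / N); first by rewrite divr_gt0.
move=> A dA; rewrite ler_pdivlMr// => Ak; rewrite disp_conj//; apply: h.
  by rewrite !det_mulmx det_inv dA dB invr1 !mulr1.
rewrite (_ : _ - _ = B *m (A - 1%:M) *m invmx B); last first.
  by rewrite mulmxBr mulmxBl mulmx1 mulmxV.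
apply: le_trans (mulmx_norm_le_mx _ _) _; apply: le_trans Ak.
rewrite /N mulrDr mulr1.
apply: le_trans (_ : `|A - 1%:M| * (m.+1%:R * (m.+1%:R * `|B|) * `|invmx B|) <= _);
  last by rewrite lerDl.
rewrite [X in _ <= X](_ : _ =
    m.+1%:R * (m.+1%:R * `|B| * `|A - 1%:M|) * `|invmx B|); last by ring.
by rewrite ler_wpM2r// ler_wpM2l//; exact: mulmx_norm_le_mx.
Qed.

Definition avg (phi : X -> R) (L : seq 'cV[R]_m) (x : X) : R :=
  (size L)%:R^-1 * \sum_(v <- L) phi (act (horo v) x).

Lemma bmeas_avg phi L : bmeas phi -> bmeas (avg phi L).
Proof.
move=> b; apply: bmeasM; first exact: bmeas_cst.
by apply: bmeas_sum => v; exact: bmeas_act.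
Qed.

Lemma mean_avg phi L : bmeas phi -> L != [::] -> mean mu (avg phi L) = mean mu phi.
Proof.
move=> b L0; rewrite meanZ; last by apply: bmeas_sum => v; exact: bmeas_act.
rewrite mean_sum => [|v]; last exact: bmeas_act.
under eq_bigr do rewrite mean_act//.
rewrite big_const_seq count_predT iter_addr_0 -[X in _ * X]mulr_natl mulrA mulVf ?mul1r//.
by rewrite pnatr_eq0 size_eq0.
Qed.

(** The neighbourhood of 1 may shrink as [L] grows. This is harmless, since the bound in [mautner]
    does not depend on its size. *)
Lemma cont1_avg phi L : bmeas phi -> cont1 phi -> cont1 (avg phi L).
Proof.
move=> b c; apply: cont1Z; first by apply: bmeas_sum => v; exact: bmeas_act.
elim: L => [|v L IH].
  move=> e e0; exists 1 => // A _ _.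
  rewrite (_ : disp _ _ = 0) ?ltW// -[RHS](mean_cst mu 0); congr mean.
  by apply/funext => x; rewrite !big_nil subrr expr0n.
rewrite (_ : (fun x => _) = fun x : X => phi (act (horo v) x) + \sum_(v <- L) phi (act (horo v) x)).
  apply: cont1D => //; first exact: bmeas_act.
    by apply: bmeas_sum => w; exact: bmeas_act.
  by apply: cont1_act => //; exact: det_horo.
by apply/funext => x; rewrite big_cons.
Qed.

(* Parallelogram law: a translate of avg phi L that is far from it gives a longer
   average of smaller norm, and norms cannot decrease forever. *)
Lemma exists_almost_invariant_avg phi (e : R) : bmeas phi -> 0 < e ->
  exists2 L : seq 'cV[R]_m, L != [::] & forall v, disp (avg phi L) (horo v) <= e.
Proof.
move=> b e0; apply: contrapT => no.
have bad L : L != [::] -> exists v, e < disp (avg phi L) (horo v).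
  move=> L0; apply: contrapT => H; apply: no; exists L => // v.
  by rewrite leNgt; apply/negP => ev; apply: H; exists v.
pose nrm L := mean mu (fun x : X => avg phi L x ^+ 2).
(* If [L'] is [L] together with its translate by [v], the parallelogram law reads
   [disp = 4 * nrm L - 4 * nrm L']. A displacement above [e] thus costs more than [e / 4] of
   norm. *)
have step k : exists2 L, L != [::] & nrm L <= nrm [:: 0] - k%:R * (e / 4).
  elim: k => [|k [L L0 kL]]; first by exists [:: 0]; rewrite ?mul0r ?subr0.
  have [v vL] := bad L L0.
  exists (L ++ map (fun u => u + v) L); first by case: L L0 {kL vL}.
  have bL := bmeas_avg L b; have bLv := bmeas_act (horo v) bL.
  have E x : avg phi (L ++ map (fun u => u + v) L) x =
      (avg phi L x + avg phi L (act (horo v) x)) / 2.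
    rewrite /avg big_cat big_map size_cat size_map /= natrD.
    under [X in _ * (_ + X)]eq_bigr do
      rewrite -horoM act_mul ?det_horo//.
    have n0 : (size L)%:R != 0 :> R by rewrite pnatr_eq0 size_eq0.
    have n1 : (size L)%:R + (size L)%:R != 0 :> R.
      by rewrite -natrD pnatr_eq0 addn_eq0 size_eq0 (negPf L0).
    by field; rewrite n0 n1.
  have : disp (avg phi L) (horo v) = 2 * (nrm L + nrm L) -
      4 * nrm (L ++ map (fun u => u + v) L).
    rewrite /nrm -[X in 2 * (_ + X)](mean_act (horo v) (bmeasX2 bL)).
    rewrite -meanD; [|exact: bmeasX2|exact: bmeasX2].
    rewrite -!meanZ; last 2 first.
    - by apply: bmeasX2; exact: bmeas_avg.
    - by apply: bmeasD; exact: bmeasX2.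
    rewrite -meanB; last 2 first.
    - apply: bmeasM; first exact: bmeas_cst.
      by apply: bmeasD; exact: bmeasX2.
    - apply: bmeasM; first exact: bmeas_cst.
      by apply: bmeasX2; exact: bmeas_avg.
    by congr mean; apply/funext => x; rewrite E; field.
  by rewrite -natr1; lra.
have := truncnS_gt (nrm [:: 0] / (e / 4)); set k := (Num.truncn _).+1.
rewrite ltr_pdivrMr; last by lra.
have [L _] := step k; have : 0 <= nrm L by apply: mean_ge0 => x; exact: sqr_ge0.
lra.
Qed.

End Averages.

(** * Words in transvections for the Mautner phenomenon *)

Section Matrices.
Variables (R : realType) (m : nat).
Implicit Types (i j : 'I_m) (a b c : R).

Definition diag2 i a : 'M[R]_m.+1 := diag_mx
  (\row_j (if j == ord0 then a else if j == lift ord0 i then a^-1 else 1)).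

Let lift_neq0 i : (lift ord0 i == ord0) = false.
Proof. by rewrite eq_sym (negPf (neq_lift _ _)). Qed.

Lemma det_diag2 i a : a != 0 -> \det (diag2 i a) = 1.
Proof.
move=> a0; rewrite det_diag big_ord_recl mxE eqxx (bigD1 i)//= mxE eqxx lift_neq0.
rewrite big1 ?mulr1 ?mulfV// => j ji; rewrite mxE lift_neq0 (inj_eq lift_inj).
by rewrite (negPf ji).
Qed.

(** The lower factors are horospherical and may be large; for fixed [a] the upper parameters [b] and
    [- b / a] can be made arbitrarily small. *)
Lemma diag2_transv i a b : a != 0 -> b != 0 ->
  transv (lift ord0 i) ord0 ((a^-1 - 1) / b) *m transv ord0 (lift ord0 i) b *m
  transv (lift ord0 i) ord0 ((a - 1) / b) *m transv ord0 (lift ord0 i) (- b / a) =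
  diag2 i a.
Proof.
move=> a0 b0; apply: mulmx_cV_inj => w; apply/matrixP => k l; rewrite ord1.
rewrite -!mulmxA !mul_transv mul_diag_mx !mxE !lift_neq0 !eqxx.
rewrite [ord0 == lift _ _]eq_sym !lift_neq0 /=.
case: (unliftP ord0 k) => [k'|] ->.
  rewrite lift_neq0 (inj_eq lift_inj).
  by case: (eqVneq k' i) => [->|_] /=; field; rewrite ?a0 ?b0.
by rewrite eqxx [ord0 == lift _ _]eq_sym lift_neq0 /=; field; rewrite ?a0 ?b0.
Qed.

Lemma diag2_conj i a b : a != 0 ->
  diag2 i a^-1 *m transv ord0 (lift ord0 i) (a ^+ 2 * b) *m diag2 i a =
  transv ord0 (lift ord0 i) b.
Proof.
move=> a0; apply: mulmx_cV_inj => w; apply/matrixP => k l; rewrite ord1.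
rewrite -!mulmxA !mul_diag_mx mul_transv [LHS]mxE mul_transv !mxE.
rewrite lift_neq0 eqxx.
case: (unliftP ord0 k) => [k'|] ->.
  rewrite lift_neq0 (inj_eq lift_inj).
  by case: (eqVneq k' i) => [->|_] /=; field.
by rewrite eqxx /=; field.
Qed.

(** Reaches the transvections that avoid index 0, which are neither horospherical nor transposes of
    horospherical ones. *)
Lemma transv_commutator i j c : i != j ->
  transv (lift ord0 i) ord0 c *m transv ord0 (lift ord0 j) 1 *m
  transv (lift ord0 i) ord0 (- c) *m transv ord0 (lift ord0 j) (- 1) =
  transv (lift ord0 i) (lift ord0 j) c.
Proof.
move=> ij; apply: mulmx_cV_inj => w; apply/matrixP => k l; rewrite ord1.
rewrite -!mulmxA !mul_transv !eqxx !lift_neq0 !(inj_eq lift_inj).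
rewrite [j == i]eq_sym (negPf ij) ![ord0 == lift _ _]eq_sym !lift_neq0.
by case: (unliftP ord0 k) => [k'|] ->; rewrite ?lift_neq0 ?eqxx /=; ring.
Qed.

Lemma transv_horo i c :
  transv (lift ord0 i) ord0 c = horo (- c *: delta_mx i ord0 : 'cV[R]_m).
Proof.
apply: mulmx_cV_inj => w; apply: cVP => [|k].
  by rewrite horo_w0 mul_transv [ord0 == lift _ _]eq_sym lift_neq0 !mul0r addr0.
rewrite horo_wS mul_transv !mxE eqxx andbT (inj_eq lift_inj); ring.
Qed.

End Matrices.

(** Each use of [disp_mul] doubles, so words of four letters carry weights 8, 8, 4, 2 and words of
    three 4, 4, 2. This gives 22, 148 and, with the rounded 150, 1512 times [e] for diagonal
    matrices, upper transvections and commutators. Only independence from [psi] and from the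
    parameter matters. *)
Lemma mautner_constants (R : realFieldType) (e : R) : 0 < e ->
  [/\ 8 * e + 8 * e + 4 * e + 2 * e <= 24 * e,
      4 * (24 * e) + 4 * e + 2 * (24 * e) <= 150 * e,
      8 * e + 8 * (150 * e) + 4 * e + 2 * (150 * e) <= 2000 * e,
      e <= 2000 * e & 150 * e <= 2000 * e].
Proof. by move=> e0; split; lra. Qed.

Section Mautner.
Variables (R : realType) (m : nat).
Local Notation X := (borel_lattice_space R m.+1).
Variables (mu : probability X R) (mu_inv : SL_invariant mu).
Implicit Types (psi : X -> R) (A B : 'M[R]_m.+1).

Lemma disp_word3 psi A B C (a b c e : R) : bmeas psi ->
  \det A = 1 -> \det B = 1 -> \det C = 1 ->
  disp mu psi A <= a -> disp mu psi B <= b -> disp mu psi C <= c ->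
  4 * a + 4 * b + 2 * c <= e -> disp mu psi (A *m B *m C) <= e.
Proof.
move=> bpsi dA dB dC; have dAB : \det (A *m B) = 1 by rewrite det_mulmx dA dB mulr1.
have := disp_mul mu_inv bpsi dA dB; have := disp_mul mu_inv bpsi dAB dC; lra.
Qed.

Lemma disp_word4 psi A B C D (a b c d e : R) : bmeas psi ->
  \det A = 1 -> \det B = 1 -> \det C = 1 -> \det D = 1 ->
  disp mu psi A <= a -> disp mu psi B <= b -> disp mu psi C <= c -> disp mu psi D <= d ->
  8 * a + 8 * b + 4 * c + 2 * d <= e -> disp mu psi (A *m B *m C *m D) <= e.
Proof.
move=> bpsi dA dB dC dD hA hB hC hD.
have dABC : \det (A *m B *m C) = 1 by rewrite !det_mulmx dA dB dC !mulr1.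
have := disp_mul mu_inv bpsi dABC dD.
have := disp_word3 bpsi dA dB dC hA hB hC (lexx _); lra.
Qed.

Lemma transv_near1 n (i j : 'I_n) (k : R) : 0 < k ->
  forall b, `|b| <= k -> `|transv i j b - 1%:M| <= k.
Proof.
move=> k0 b bk; rewrite /transv addrAC subrr add0r.
apply/mx_norm_leP => [|u v]; first exact: ltW.
rewrite !mxE; case: (_ && _); rewrite ?mulr1// mulr0 normr0 ltW//.
Qed.

(* The Mautner phenomenon: (horo * small * horo' * small') is the diagonal matrix
   diag2 i a, so diag2 nearly fixes psi; conjugation by diag2 shrinks the transposed
   unipotents into the neighbourhood where continuity applies. *)
Lemma mautner psi (e : R) : bmeas psi -> cont1 mu psi -> 0 < e ->
  (forall v, disp mu psi (horo v) <= e) ->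
  forall (i j : 'I_m.+1) (c : R), i != j -> disp mu psi (transv i j c) <= 2000 * e.
Proof.
move=> bp cp e0 He; have [E1 E2 E3 E4 E5] := mautner_constants e0.
have n0 (i : 'I_m) : ord0 != lift ord0 i by rewrite neq_lift.
have n0' (i : 'I_m) : lift ord0 i != ord0 by rewrite eq_sym neq_lift.
pose D A := disp mu psi A.
have DM A B : \det A = 1 -> \det B = 1 -> D (A *m B) <= 2 * D A + 2 * D B.
  exact: disp_mul.
have Hu (i : 'I_m) c : D (transv (lift ord0 i) ord0 c) <= e.
  by rewrite transv_horo.
have dL (i : 'I_m) (c : R) : \det (transv (lift ord0 i) ord0 c) = 1.
  exact: det_transv.
have dU (i : 'I_m) (c : R) : \det (transv ord0 (lift ord0 i) c) = 1.
  exact: det_transv.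
have [k k0 Hk] := cp _ e0.
have small (i : 'I_m) b : `|b| <= k -> D (transv ord0 (lift ord0 i) b) <= e.
  by move=> bk; apply: Hk; [exact: dU|exact: transv_near1].
have Hd (i : 'I_m) a : 0 < a -> D (diag2 i a) <= 24 * e.
  (* Makes both [b] and [b / a] at most [k]. *)
  move=> a0; pose b := Num.min k (k * a).
  have b0 : 0 < b by rewrite lt_min k0 mulr_gt0.
  have b1 : b <= k by rewrite ge_min lexx.
  have b2 : b <= k * a by rewrite ge_min lexx orbT.
  rewrite -(@diag2_transv _ _ i a b) ?gt_eqF//.
  apply: (disp_word4 bp (dL _ _) (dU _ _) (dL _ _) (dU _ _) (Hu _ _) _ (Hu _ _) _ E1).
    by apply: small; rewrite gtr0_norm.
  by apply: small; rewrite mulNr normrN gtr0_norm ?divr_gt0// ler_pdivrMr.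
have Hv (i : 'I_m) b : D (transv ord0 (lift ord0 i) b) <= 150 * e.
  (* Small enough that the contracted parameter [a ^+ 2 * b] has absolute value at most [k]. *)
  pose a := Num.min 1 (k / (`|b| + 1)).
  have b1 : 0 < `|b| + 1 by rewrite ltr_wpDl.
  have a0 : 0 < a by rewrite lt_min ltr01/= divr_gt0.
  have a1 : a <= 1 by rewrite ge_min lexx.
  have a2 : a * (`|b| + 1) <= k.
    by rewrite -ler_pdivlMr// ge_min lexx orbT.
  have da : \det (diag2 i a) = 1 by rewrite det_diag2 ?gt_eqF.
  have da' : \det (diag2 i a^-1) = 1 by rewrite det_diag2 ?invr_eq0 ?gt_eqF.
  have a0' : 0 < a^-1 by rewrite invr_gt0.
  rewrite -(@diag2_conj _ _ i a b) ?gt_eqF//.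
  apply: (disp_word3 bp da' (dU _ _) da (Hd _ _ a0') _ (Hd _ _ a0) E2).
  apply: small; rewrite normrM ger0_norm ?sqr_ge0//.
  apply: le_trans a2; rewrite expr2 -mulrA ler_pM2l//.
  apply: le_trans (_ : `|b| <= _); last by rewrite lerDl.
  by rewrite ler_piMl.
move=> i j c; case: (unliftP ord0 i) => [i'|] ->; case: (unliftP ord0 j) => [j'|] ->.
- rewrite (inj_eq lift_inj) => ij; rewrite -transv_commutator//.
  exact: (disp_word4 bp (dL _ _) (dU _ _) (dL _ _) (dU _ _)
    (Hu _ _) (Hv _ _) (Hu _ _) (Hv _ _) E3).
- by move=> _; exact: le_trans (Hu i' c) E4.
- by move=> _; exact: le_trans (Hv j' c) E5.
- by rewrite eqxx.
Qed.

End Mautner.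

(** * Null sets of products and random matrices *)

Section NullPreserving.
Local Open Scope ereal_scope.

(** Nonsingularity: the image of [P] under [f] is absolutely continuous with respect to [P]. It
    survives composition and fibred products, and replaces invariance of a Haar measure. *)
Definition nullpres d (T : measurableType d) (R : realType)
    (P : set T -> \bar R) (f : T -> T) :=
  measurable_fun setT f /\
  forall E, measurable E -> P E = 0 -> P (f @^-1` E) = 0.

Lemma nullpres_comp d (T : measurableType d) (R : realType)
    (P : set T -> \bar R) (f g : T -> T) :
  nullpres P f -> nullpres P g -> nullpres P (f \o g).
Proof.
move=> [mf nf] [mg ng]; split; first exact: measurableT_comp.
move=> E mE E0; rewrite comp_preimage; apply: ng; last exact: nf.
by rewrite -[X in measurable X]setTI; exact: mf.
Qed.

Lemma ge0_integral_eq0 d (T : measurableType d) (R : realType)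
    (P : {measure set T -> \bar R}) (h : T -> \bar R) :
  measurable_fun setT h -> (forall x, 0 <= h x) ->
  \int[P]_x h x = 0 <-> P [set x | h x != 0] = 0.
Proof.
move=> mh h0; have mN : measurable [set x | h x != 0].
  rewrite (_ : [set x | _] = setT `&` h @^-1` (~` [set 0])).
    by apply: mh => //; exact: measurableC.
  by rewrite setTI; apply/seteqP; split=> x /= /eqP.
have hA : \int[P]_x h x = \int[P]_x `|h x|.
  by apply: eq_integral => x _; rewrite gee0_abs.
rewrite hA; split=> [/(ae_eq_integral_abs P measurableT mh)|H].
  move=> [N [mN' N0 NN]]; apply/eqP; rewrite eq_le measure_ge0 andbT -[X in _ <= X]N0.
  apply: le_measure; rewrite ?inE// => x /= hx; apply: NN => /= H.
  by move/eqP: hx; apply; exact: H.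
apply/(ae_eq_integral_abs P measurableT mh).
by exists [set x | h x != 0]; split=> // x /= /not_implyP[_ /eqP].
Qed.

Section Product.
Context d1 d2 (T1 : measurableType d1) (T2 : measurableType d2) (R : realType).
Variables (P : probability T1 R) (Q : probability T2 R).

Lemma prod_null1 F : measurable F ->
  (P \x Q) F = 0 <-> P [set x | Q (xsection F x) != 0] = 0.
Proof.
by move=> mF; apply: ge0_integral_eq0 => //; exact: measurable_fun_xsection.
Qed.

Lemma product_measure12 F : measurable F -> (P \x Q) F = (P \x^ Q) F.
Proof.
move=> mF; apply: (@product_measure_unique _ _ _ _ R P Q (P \x^ Q)%E) => // A B mA mB.
exact: product_measure2E.
Qed.

Lemma prod_null2 F : measurable F ->
  (P \x Q) F = 0 <-> Q [set y | P (ysection F y) != 0] = 0.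
Proof.
move=> mF; rewrite product_measure12//; apply: ge0_integral_eq0 => //.
exact: measurable_fun_ysection.
Qed.

Lemma measurable_neq0 d (T : measurableType d) (h : T -> \bar R) :
  measurable_fun setT h -> measurable [set x | h x != 0].
Proof.
move=> mh; rewrite (_ : [set x | _] = setT `&` h @^-1` (~` [set 0])).
  by apply: mh => //; exact: measurableC.
by rewrite setTI; apply/seteqP; split=> x /= /eqP.
Qed.

(** By Tonelli, nullity of a set is nullity of almost all its sections, and the map acts on each
    section separately. *)
Lemma nullpres_fiber1 (g : T1 -> T2 -> T2) :
  measurable_fun setT (fun p : T1 * T2 => (p.1, g p.1 p.2)) ->
  (forall x, nullpres Q (g x)) ->
  nullpres (P \x Q) (fun p => (p.1, g p.1 p.2)).
Proof.
move=> mg ng; split => // F mF /(prod_null1 mF) F0.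
have mgF : measurable ((fun p : T1 * T2 => (p.1, g p.1 p.2)) @^-1` F).
  by rewrite -[X in measurable X]setTI; exact: mg.
apply/(prod_null1 mgF); apply/eqP; rewrite eq_le measure_ge0 andbT -[X in _ <= X]F0.
apply: le_measure; rewrite ?inE.
- by apply: measurable_neq0; exact: measurable_fun_xsection.
- by apply: measurable_neq0; exact: measurable_fun_xsection.
move=> x /=; apply: contra => /eqP Q0; apply/eqP.
have [_ /(_ _ (measurable_xsection x mF) Q0)] := ng x.
congr (Q _ = _); apply/seteqP; split=> y; rewrite /xsection /= !inE//.
Qed.

Lemma nullpres_fiber2 (f : T1 -> T2 -> T1) :
  measurable_fun setT (fun p : T1 * T2 => (f p.1 p.2, p.2)) ->
  (forall y, nullpres P (f^~ y)) ->
  nullpres (P \x Q) (fun p => (f p.1 p.2, p.2)).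
Proof.
move=> mg ng; split => // F mF /(prod_null2 mF) F0.
have mgF : measurable ((fun p : T1 * T2 => (f p.1 p.2, p.2)) @^-1` F).
  by rewrite -[X in measurable X]setTI; exact: mg.
apply/(prod_null2 mgF); apply/eqP; rewrite eq_le measure_ge0 andbT -[X in _ <= X]F0.
apply: le_measure; rewrite ?inE.
- by apply: measurable_neq0; exact: measurable_fun_ysection.
- by apply: measurable_neq0; exact: measurable_fun_ysection.
move=> y /=; apply: contra => /eqP P0; apply/eqP.
have [_ /(_ _ (measurable_ysection y mF) P0)] := ng y.
congr (P _ = _); apply/seteqP; split=> x; rewrite /ysection /= !inE//.
Qed.

End Product.

End NullPreserving.

Section IterProd.
Context d (T : measurableType d) (R : realType).

Definition tcons n (x : T * n.-tuple T) : n.+1.-tuple T := [tuple of x.1 :: x.2].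

Lemma tnth_tcons0 n (x : T * n.-tuple T) : tnth (tcons x) ord0 = x.1.
Proof. exact: tnth0. Qed.

Lemma tnth_tconsS n (x : T * n.-tuple T) i : tnth (tcons x) (lift ord0 i) = tnth x.2 i.
Proof. exact: tnthS. Qed.

Lemma measurable_tcons n : measurable_fun setT (@tcons n).
Proof. exact: measurable_cons. Qed.

HB.instance Definition _ n :=
  isMeasurableFun.Build _ _ _ _ (@tcons n) (@measurable_tcons n).

Variable P : probability T R.

Fixpoint iprob n : probability (n.-tuple T) R :=
  match n with
  | 0%N => \d_([tuple] : 0.-tuple T)
  | n'.+1 => distribution (P \x iprob n')%E (@tcons n')
  end.

Lemma iprobS n E : iprob n.+1 E =
  (P \x iprob n)%E (@tcons n @^-1` E).
Proof. by []. Qed.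

Lemma measurable_cons_preimage n (E : set (n.+1.-tuple T)) : measurable E ->
  measurable (@tcons n @^-1` E).
Proof.
move=> mE; rewrite -[X in measurable X]setTI.
exact: (@measurable_tcons n measurableT E mE).
Qed.

Lemma nullpres_cons n (f : T * n.-tuple T -> T * n.-tuple T)
    (g : n.+1.-tuple T -> n.+1.-tuple T) : measurable_fun setT g ->
  (forall p, g (tcons p) = tcons (f p)) ->
  nullpres (P \x iprob n)%E f -> nullpres (iprob n.+1) g.
Proof.
move=> mg gf [mf nf]; split=> // E mE; rewrite !iprobS => E0.
rewrite -(nf _ _ E0); last exact: measurable_cons_preimage.
by congr (_ _); apply/seteqP; split=> p /=; rewrite gf.
Qed.

Lemma tuple_nullpres n (f : T -> T) : nullpres P f ->
  nullpres (iprob n) (map_tuple f : n.-tuple T -> n.-tuple T).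
Proof.
move=> nf; have mf := nf.1.
have mmap k : measurable_fun setT (map_tuple f : k.-tuple T -> k.-tuple T).
  apply/measurable_fun_tnthP => i.
  rewrite (_ : _ \o _ = f \o (@tnth _ T ^~ i)).
    by apply: measurableT_comp => //; exact: measurable_tnth.
  by apply/funext => x /=; rewrite tnth_map.
elim: n => [|n IH].
  split; [exact: mmap|move=> E mE E0].
  by rewrite [map_tuple f @^-1` E](_ : _ = E)//; apply/seteqP; split=> x /=;
    rewrite [x]tuple0 [map_tuple _ _]tuple0.
apply: (@nullpres_cons n ((fun p => (f p.1, p.2)) \o
    (fun p => (p.1, map_tuple f p.2)))) => //.
  by move=> p; apply: val_inj.
apply: nullpres_comp.
  apply: (@nullpres_fiber2 _ _ _ _ _ P (iprob n) (fun x _ => f x)) => //.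
  apply/measurable_fun_pairP; split; [exact: (measurableT_comp mf measurable_fst)|exact: measurable_snd].
apply: (@nullpres_fiber1 _ _ _ _ _ P (iprob n) (fun _ => map_tuple f)) => //.
apply/measurable_fun_pairP; split; first exact: measurable_fst.
exact: (measurableT_comp (mmap n) measurable_snd).
Qed.

End IterProd.

Section OneDim.
Variable R : realType.
Local Notation leb := (@lebesgue_measure R).

Lemma measurable_shift (c : R) : measurable_fun setT (fun x : measurableTypeR R => x + c : measurableTypeR R).
Proof. exact: measurable_funD. Qed.

Lemma lebesgue_measure_shift (c : R) (A : set (measurableTypeR R)) : measurable A ->
  leb ((fun x => x + c) @^-1` A) = leb A.
Proof.
move=> mA; apply: esym.
pose f : {mfun measurableTypeR R >-> measurableTypeR R} :=
  mfun_Sub (mem_set (measurable_shift c)).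
rewrite (@lebesgue_measure_unique R (pushforward leb f) _ A mA)//.
move=> X [[a b] _ <-] /=; rewrite -[RHS]/(leb (+%R^~ c @^-1` `]a, b]%classic)).
rewrite (_ : _ @^-1` _ = `]a - c, b - c]%classic); last first.
  by apply/seteqP; split=> x /=; rewrite !in_itv/= ltrBlDr lerBrDr.
rewrite !lebesgue_measure_itv/= !lte_fin ltrD2r.
by case: ifP => // _; rewrite !EFinB -!EFinB; congr EFin; ring.
Qed.

(** A probability with exactly the null sets of Lebesgue measure, so that translations are
    nonsingular and Fubini applies to finite measures. *)
Definition gauss : probability (measurableTypeR R) R := normal_prob 0 1.

Lemma gauss_null (A : set (measurableTypeR R)) : measurable A ->
  gauss A = 0%E <-> leb A = 0%E.
Proof.
move=> mA; split=> [A0|A0].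
  have mp : measurable_fun A (fun x => (normal_pdf 0 1 x)%:E).
    by apply/measurable_EFinP/measurable_funTS; exact: measurable_normal_pdf.
  have : (\int[leb]_(x in A) `|(normal_pdf 0 1 x)%:E| = 0)%E.
    rewrite -A0; apply: eq_integral => x _.
    by rewrite gee0_abs// lee_fin normal_pdf_ge0.
  move=> /(ae_eq_integral_abs _ mA mp)[N [mN N0 AN]].
  apply/eqP; rewrite eq_le measure_ge0 andbT -[X in (_ <= X)%E]N0.
  apply: le_measure; rewrite ?inE// => x Ax; apply: AN => /= /(_ Ax)/eqP.
  have s0 : (1 : R) != 0 by exact: oner_neq0.
  rewrite eqe normal_pdfE// /= mulf_eq0 gt_eqF ?normal_peak_gt0//=.
  by rewrite gt_eqF// expR_gt0.
by have := @normal_prob_dominates R 0 1; rewrite null_content_dominatesP; apply.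
Qed.

Lemma gauss_shift (c : R) : nullpres gauss (fun x => x + c).
Proof.
split=> [|A mA]; first exact: measurable_shift.
move=> /(gauss_null mA) A0; apply/gauss_null.
  by rewrite -[X in measurable X]setTI; exact: measurable_shift.
by rewrite lebesgue_measure_shift.
Qed.

Lemma gauss_itv (a b : R) : a < b -> gauss `]a, b[%classic != 0%E.
Proof.
move=> ab; apply/eqP => /gauss_null.
rewrite lebesgue_measure_itv/= lte_fin ab => /(_ (measurable_itv _))/eqP.
by rewrite -EFinB eqe subr_eq0 gt_eqF.
Qed.

Definition shear n (j : 'I_n) (a : 'I_n -> R) (c : R)
    (r : n.-tuple (measurableTypeR R)) : n.-tuple (measurableTypeR R) :=
  [tuple (if k == j then tnth r k + (c + \sum_i a i * tnth r i) else tnth r k) | k < n].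

Lemma measurable_shear n (j : 'I_n) a c : measurable_fun setT (shear j a c).
Proof.
apply/measurable_fun_tnthP => k.
rewrite (_ : _ \o _ = fun r => if k == j then tnth r k + (c + \sum_i a i * tnth r i) else tnth r k).
  case: (k == j); last exact: measurable_tnth.
  apply: measurable_funD; first exact: measurable_tnth.
  apply: measurable_funD; first exact: measurable_cst.
  apply: measurable_sum => i; apply: measurable_funM; first exact: measurable_cst.
  exact: measurable_tnth.
by apply/funext => r; rewrite /= /shear tnth_mktuple.
Qed.

(** The constant [c] is there for the induction: when [j] is not coordinate 0, freezing coordinate 0
    moves its contribution into [c]. When [j] is coordinate 0, freezing the others leaves a
    translation of the line. *)
Lemma nullpres_shear n (j : 'I_n) a c : a j = 0 ->
  nullpres (iprob gauss n) (shear j a c).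
Proof.
elim: n j a c => [[]//|n IH] j a c aj.
have ms := @measurable_shear n.+1 j a c.
case: (unliftP ord0 j) => [j'|] jE; subst j.
  apply: (@nullpres_cons _ _ _ gauss n (fun p => (p.1,
    shear j' (a \o lift ord0) (c + a ord0 * p.1) p.2))) => //.
    move=> [x t]; apply: eq_from_tnth => k; rewrite tnth_mktuple.
    rewrite big_ord_recl; under eq_bigr do rewrite tnth_tconsS.
    case: (unliftP ord0 k) => [l|] ->.
      by rewrite !tnth_tconsS tnth_tcons0 (inj_eq lift_inj) tnth_mktuple -!addrA.
    by rewrite (negPf (neq_lift _ _)) !tnth_tcons0.
  apply: (@nullpres_fiber1 _ _ _ _ _ gauss (iprob gauss n)
    (fun x => shear j' (a \o lift ord0) (c + a ord0 * x))).
    apply/measurable_fun_pairP; split; first exact: measurable_fst.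
    apply/measurable_fun_tnthP => k.
    rewrite (_ : _ \o _ = fun p : measurableTypeR R * n.-tuple (measurableTypeR R) =>
        if k == j' then tnth p.2 k + (c + a ord0 * p.1 +
          \sum_i a (lift ord0 i) * tnth p.2 i) else tnth p.2 k); last first.
      by apply/funext => p; rewrite /= tnth_mktuple.
    have mk i : measurable_fun setT
        (fun p : measurableTypeR R * n.-tuple (measurableTypeR R) => tnth p.2 i).
      exact: (measurableT_comp (measurable_tnth i) measurable_snd).
    case: (k == j'); last exact: mk.
    apply: measurable_funD; first exact: mk.
    apply: measurable_funD.
      apply: measurable_funD; first exact: measurable_cst.
      by apply: measurable_funM; [exact: measurable_cst|exact: measurable_fst].
    by apply: measurable_sum => i; apply: measurable_funM; [exact: measurable_cst|exact: mk].
  by move=> x; apply: IH.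
apply: (@nullpres_cons _ _ _ gauss n (fun p =>
  (p.1 + (c + \sum_i a (lift ord0 i) * tnth p.2 i), p.2))) => //.
  move=> [x t]; apply: eq_from_tnth => k; rewrite tnth_mktuple.
  rewrite big_ord_recl; under eq_bigr do rewrite tnth_tconsS.
  case: (unliftP ord0 k) => [l|] ->.
    by rewrite eq_sym (negPf (neq_lift _ _)) !tnth_tconsS.
  by rewrite eqxx !tnth_tcons0 aj mul0r add0r.
apply: (@nullpres_fiber2 _ _ _ _ _ gauss (iprob gauss n)
  (fun x t => x + (c + \sum_i a (lift ord0 i) * tnth t i))).
  apply/measurable_fun_pairP; split; last exact: measurable_snd.
  rewrite (_ : _ \o _ = fun p : measurableTypeR R * n.-tuple (measurableTypeR R) =>
    p.1 + (c + \sum_i a (lift ord0 i) * tnth p.2 i))//.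
  apply: measurable_funD; first exact: measurable_fst.
  apply: measurable_funD; first exact: measurable_cst.
  apply: measurable_sum => i; apply: measurable_funM; first exact: measurable_cst.
  exact: (measurableT_comp (measurable_tnth i) measurable_snd).
by move=> t; apply: gauss_shift.
Qed.

End OneDim.

Lemma measurable_ltset d (T : measurableType d) (R : realType) (f g : T -> R) :
  measurable_fun setT f -> measurable_fun setT g -> measurable [set x | f x < g x].
Proof.
move=> mf mg; have := measurable_fun_ltr mf mg.
move=> /(_ measurableT [set true] I); rewrite setTI => H.
rewrite (_ : [set x | _] = (fun x => f x < g x) @^-1` [set true])//.
Qed.

Lemma measurable_forall d (T : measurableType d) (I : finType) (A : I -> set T) :
  (forall i, measurable (A i)) -> measurable [set x | forall i, A i x].
Proof.
move=> mA; rewrite (_ : [set x | _] = \bigcap_(i in setT) A i).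
  by apply: fin_bigcap_measurable => // i _; exact: mA.
by apply/seteqP; split=> x /= H i; [move=> _; exact: H|exact: H].
Qed.

(** * Joint measurability of cone events in the matrix and the lattice *)

Section JointMeasurability.
Context d1 d2 (T1 : measurableType d1) (T2 : measurableType d2) (R : realType) (m : nat).
Variables (A : T1 -> 'M[R]_m.+1) (G : T2 -> 'M[R]_m.+1).

Definition box n (q : 'cV[R]_n) (r : R) : set 'cV[R]_n :=
  [set w | forall i, `|w i ord0 - q i ord0| < r].

Hypothesis mA : forall i j, measurable_fun setT (fun x => A x i j).
Hypothesis mG : forall q r, measurable [set y | hit (box q r) (G y)].

Let nA x := \sum_i \sum_j `|A x i j|.

Let nA_ge x i : \sum_j `|A x i j| <= nA x.
Proof.
by rewrite /nA [leRHS](bigD1 i)//= lerDl sumr_ge0// => k _; rewrite sumr_ge0.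
Qed.

Lemma mulmx_box_le x (v q : 'cV[R]_m.+1) (r : R) i :
  (forall j, `|v j ord0 - q j ord0| <= r) ->
  `|(A x *m v) i ord0 - (A x *m q) i ord0| <= nA x * r.
Proof.
move=> vq; have r0 : 0 <= r := le_trans (normr_ge0 _) (vq ord0).
rewrite [X in `|X|](_ : _ = \sum_j A x i j * (v j ord0 - q j ord0)); last first.
  by rewrite !mxE -sumrB; apply: eq_bigr => j _; rewrite mulrBr.
apply: le_trans (ler_norm_sum _ _ _) _.
apply: le_trans (ler_wpM2r r0 (nA_ge x i)); rewrite mulr_suml.
by apply: ler_sum => j _; rewrite normrM ler_wpM2l.
Qed.

(** A sufficient condition for [A x] to map the whole box of radius [k.+1%:R^-1] about [q] into the
    cone: [e] bounds the error in each coordinate. *)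
Let cond (c t : R) (q : 'cV[rat]_m.+1) (k : nat) x :=
  let w := A x *m map_mx ratr q in let e := nA x * k.+1%:R^-1 in
  (e < w ord0 ord0 /\ w ord0 ord0 + e < t) /\
  forall i : 'I_m, e + `|w (lift ord0 i) ord0| < c * (w ord0 ord0 - e).

Let measurable_cond c t q k : measurable [set x | cond c t q k x].
Proof.
have mw i : measurable_fun setT (fun x => (A x *m map_mx ratr q) i ord0).
  rewrite (_ : (fun x => _) = fun x => \sum_j A x i j * (map_mx ratr q : 'cV[R]_m.+1) j ord0).
    by apply: measurable_sum => j; apply: measurable_funM.
  by apply/funext => x; rewrite mxE.
have me : measurable_fun setT (fun x => nA x * k.+1%:R^-1).
  apply: measurable_funM; last exact: measurable_cst.
  apply: measurable_sum => i; apply: measurable_sum => j.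
  exact: measurableT_comp.
rewrite (_ : [set x | _] =
  ([set x | nA x * k.+1%:R^-1 < (A x *m map_mx ratr q) ord0 ord0] `&`
   [set x | (A x *m map_mx ratr q) ord0 ord0 + nA x * k.+1%:R^-1 < t]) `&`
   [set x | forall i : 'I_m, nA x * k.+1%:R^-1 + `|(A x *m map_mx ratr q) (lift ord0 i) ord0|
     < c * ((A x *m map_mx ratr q) ord0 ord0 - nA x * k.+1%:R^-1)])//.
apply: measurableI; first apply: measurableI.
- exact: measurable_ltset.
- by apply: measurable_ltset => //; exact: measurable_funD.
apply: measurable_forall => i; apply: measurable_ltset.
  by apply: measurable_funD => //; apply: measurableT_comp.
by apply: measurable_funM; [exact: measurable_cst|exact: measurable_funB].
Qed.

(** The product sigma-algebra only knows rectangles. As the cone is open, a lattice vector in it may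
    be replaced by a rational box around it, on which the conditions on [x] and on [y] separate;
    there are countably many boxes. *)
Lemma hit_cone_mul (c t : R) : 0 < c ->
  [set p : T1 * T2 | hit (cone c t) (A p.1 *m G p.2)] =
  \bigcup_(qk : 'cV[rat]_m.+1 * nat) ([set x | cond c t qk.1 qk.2 x] `*`
    [set y | hit (box (map_mx ratr qk.1) qk.2.+1%:R^-1) (G y)]).
Proof.
move=> c0; apply/seteqP; split=> -[x y] /=; last first.
  move=> [[q k] _ /= [[]]]; cbn [fst snd] => -[h1 h2] h3 [z hz]; exists z.
  rewrite -mulmxA; set v := G y *m _.
  have vq i : `|(A x *m v) i ord0 - (A x *m map_mx ratr q) i ord0| <=
      nA x * k.+1%:R^-1 by apply: mulmx_box_le => j; exact: ltW (hz j).
  have := vq ord0; rewrite ler_norml => /andP[v1 v2].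
  set e := nA x * _ in v1 v2 h1 h2 h3 vq *.
  split=> [|i]; first by apply/andP; split; lra.
  have := vq (lift ord0 i); have := h3 i.
  set W := (A x *m v) (lift ord0 i) ord0; set W' := (_ *m map_mx _ _) (lift ord0 i) _.
  have h4 : `|W| <= `|W - W'| + `|W'| by apply: le_trans (ler_normD _ _); rewrite subrK.
  move=> h5 h6; apply: le_lt_trans h4 _; apply: le_lt_trans (lerD h6 (lexx _)) _.
  by apply: lt_le_trans h5 _; rewrite ler_pM2l//; lra.
move=> [z]; rewrite -mulmxA; set v := G y *m _ => -[/andP[w0 wt] wi].
set w := A x *m v in w0 wt wi.
pose W := `|\col_(i < m) w (lift ord0 i) ord0|.
have Wc : W < c * w ord0 ord0.
  by apply/mx_norm_ltP => [|i j]; [exact: mulr_gt0|rewrite mxE].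
have Wi i : `|w (lift ord0 i) ord0| <= W.
  by have := mx_norm_ge (\col_(i < m) w (lift ord0 i) ord0) i ord0; rewrite mxE.
(* The margin of [w] inside the cone. Twice the error must fit into it: once for passing from [w] to
   the image of [q], once for the margin that [cond] demands. *)
pose eta := Num.min ((c * w ord0 ord0 - W) / (2 * (1 + c)))
  (Num.min (w ord0 ord0 / 2) ((t - w ord0 ord0) / 2)).
have eta0 : 0 < eta.
  by rewrite !lt_min; apply/and3P; split; rewrite divr_gt0//; lra.
have [e1 e2 e3] : [/\ eta * (2 * (1 + c)) <= c * w ord0 ord0 - W,
    eta <= w ord0 ord0 / 2 & eta <= (t - w ord0 ord0) / 2].
  have : eta <= eta by [].
  rewrite {2}/eta !le_min => /and3P[h1 h2 h3]; split => //.
  by rewrite -ler_pdivlMr//; lra.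
have nA0 : 0 <= nA x by rewrite sumr_ge0// => i _; rewrite sumr_ge0.
pose k := Num.truncn (2 * nA x / eta).
have ke : 2 * (nA x * k.+1%:R^-1) <= eta.
  rewrite mulrA ler_pdivrMr// [leRHS]mulrC -ler_pdivrMr//.
  by apply: ltW; exact: truncnS_gt.
have k0 : 0 < k.+1%:R^-1 :> R by rewrite invr_gt0.
have qex i : exists q : rat, `|v i ord0 - ratr q| < k.+1%:R^-1.
  move: (k.+1%:R^-1 : R) k0 => r r0.
  have [|q] := @rat_in_itvoo R (v i ord0 - r) (v i ord0 + r); first by lra.
  rewrite in_itv/= => /andP[q1 q2]; exists q.
  by rewrite ltr_norml; apply/andP; split; lra.
have [f fP] := choice qex.
pose q := \col_i f i.
have vq j : `|v j ord0 - (map_mx ratr q : 'cV[R]_m.+1) j ord0| < k.+1%:R^-1.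
  have -> : (map_mx ratr q : 'cV[R]_m.+1) j ord0 = ratr (f j) by rewrite !mxE.
  exact: fP.
exists (q, k) => //=; split; last by exists z => i; exact: vq.
have wq i : `|w i ord0 - (A x *m map_mx ratr q) i ord0| <= nA x * k.+1%:R^-1.
  by apply: mulmx_box_le => j; exact: ltW.
rewrite /cond; set e := nA x * _ in ke wq *; set u := A x *m _ in wq *.
have e0 : 0 <= e by rewrite mulr_ge0// ltW.
have := wq ord0; rewrite ler_norml => /andP[v1 v2].
split; first by split; lra.
move=> i; have := wq (lift ord0 i); have := Wi i.
have : `|u (lift ord0 i) ord0| <= `|w (lift ord0 i) ord0 - u (lift ord0 i) ord0| +
    `|w (lift ord0 i) ord0|.
  rewrite distrC; apply: le_trans (ler_normD _ _); by rewrite subrK.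
nra.
Qed.

Lemma measurable_hit_mul (c t : R) : 0 < c ->
  measurable [set p : T1 * T2 | hit (cone c t) (A p.1 *m G p.2)].
Proof.
move=> c0; rewrite hit_cone_mul//.
apply: countable_bigcupT_measurable => [|[q k]]; first exact: countableP.
by apply: measurableX; [exact: measurable_cond|exact: mG].
Qed.

End JointMeasurability.

Section RandomMatrix.
Variable R : realType.

(* Stands in for Haar measure on SL(n, R): all that is needed is that right
   multiplication by SL(n, R) preserves null sets. *)
Definition gauss_mx n : probability (n.-tuple (n.-tuple (measurableTypeR R))) R :=
  iprob (iprob (gauss R) n) n.

Local Notation Omega n := (n.-tuple (n.-tuple (measurableTypeR R))).

Definition mx_of n (w : Omega n) : 'M[R]_n := \matrix_(i, j) tnth (tnth w i) j.

Definition rmul n (h : 'M[R]_n) (w : Omega n) : Omega n :=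
  [tuple [tuple (mx_of w *m h) i j | j < n] | i < n].

Lemma mx_of_inj n : injective (@mx_of n).
Proof.
move=> w w' /matrixP E; apply: eq_from_tnth => i; apply: eq_from_tnth => j.
by have := E i j; rewrite !mxE.
Qed.

Lemma mx_of_rmul n (h : 'M[R]_n) w : mx_of (rmul h w) = mx_of w *m h.
Proof. by apply/matrixP => i j; rewrite mxE !tnth_mktuple. Qed.

Lemma rmul_transv n (i j : 'I_n) (c : R) : i != j ->
  rmul (transv i j c) = map_tuple (shear j (fun k => (k == i)%:R * c) 0).
Proof.
move=> ij; apply/funext => w; apply: eq_from_tnth => k; apply: eq_from_tnth => l.
rewrite tnth_mktuple tnth_mktuple tnth_map tnth_mktuple mul_transvr !mxE.
case: eqP => [->|_]; last by rewrite !mul0r addr0.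
rewrite mul1r add0r (bigD1 i)//= eqxx mul1r big1 ?addr0// => k' /negPf ->.
by rewrite !mul0r.
Qed.

(** Right multiplication by a transvection applies one shear to each of the independent rows;
    generation by transvections does the rest. *)
Lemma nullpres_rmul n (h : 'M[R]_n) : \det h = 1 -> nullpres (gauss_mx n) (rmul h).
Proof.
pose P (h : 'M[R]_n) := nullpres (gauss_mx n) (rmul h).
have rM (h1 h2 : 'M[R]_n) : rmul (h1 *m h2) = rmul h2 \o rmul h1.
  by apply/funext => w; apply: mx_of_inj; rewrite /= !mx_of_rmul mulmxA.
have PT (i j : 'I_n) c : i != j -> P (transv i j c).
  move=> ij; rewrite /P rmul_transv//; apply: tuple_nullpres; apply: nullpres_shear.
  by rewrite eq_sym (negPf ij) mul0r.
apply: (@transv_ind _ _ P).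
- rewrite /P (_ : rmul 1%:M = id); first by split => // E mE; rewrite preimage_id.
  by apply/funext => w; apply: mx_of_inj; rewrite mx_of_rmul mulmx1.
- by move=> i j c A ij dA PA; rewrite /P rM; apply: nullpres_comp => //; exact: PT.
- by move=> i j c A ij dA PA; rewrite /P rM; apply: nullpres_comp => //; exact: PT.
Qed.

Lemma measurable_mx_of n (i j : 'I_n) : measurable_fun setT (fun w : Omega n => mx_of w i j).
Proof.
rewrite (_ : (fun w => _) = (@tnth _ _ ^~ j) \o (@tnth _ _ ^~ i)).
  by apply: measurableT_comp; exact: measurable_tnth.
by apply/funext => w; rewrite mxE.
Qed.

Lemma measurable_det_mx_of n : measurable_fun setT (fun w : Omega n => \det (mx_of w)).
Proof.
apply: measurable_sum => s; apply: measurable_funM; first exact: measurable_cst.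
by apply: measurable_prod => i _; exact: measurable_mx_of.
Qed.

Lemma measurable_inv d (T : measurableType d) (f : T -> R) :
  measurable_fun setT f -> measurable_fun setT (fun x => (f x)^-1).
Proof.
move=> mf; rewrite (_ : (fun x => _) = fun x => f x * (f x ^+ 2) `^ (-1)).
  apply: measurable_funM => //; apply: (measurableT_comp (measurable_powR (-1))).
  exact: measurable_funM.
apply/funext => x; rewrite powR_inv1 ?sqr_ge0// expr2.
have [->|f0] := eqVneq (f x) 0; first by rewrite invr0 mul0r.
by rewrite invfM mulrA divff// mul1r.
Qed.

Variable m : nat.

(* Rescaling the first row commutes with right multiplication. *)
Definition gam (w : Omega m.+1) : 'M[R]_m.+1 :=
  if \det (mx_of w) == 0 then 1%:M else
  diag_mx (\row_i (if i == ord0 then (\det (mx_of w))^-1 else 1)) *m mx_of w.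

Lemma det_gam w : \det (gam w) = 1.
Proof.
rewrite /gam; case: eqP => [_|/eqP d0]; first by rewrite det1.
rewrite det_mulmx det_diag big_ord_recl mxE eqxx big1 ?mulr1 ?mulVf// => i _.
by rewrite mxE eq_sym (negPf (neq_lift _ _)).
Qed.

Lemma gam_rmul w h : \det h = 1 -> \det (mx_of w) != 0 -> gam (rmul h w) = gam w *m h.
Proof.
move=> dh w0; rewrite /gam mx_of_rmul det_mulmx dh mulr1 (negPf w0).
by rewrite mulmxA.
Qed.

Lemma measurable_gam i j : measurable_fun setT (fun w => gam w i j).
Proof.
rewrite (_ : (fun w => _) = fun w => if \det (mx_of w) == 0 then (i == j)%:R else
    (if i == ord0 then (\det (mx_of w))^-1 else 1) * mx_of w i j); last first.
  apply/funext => w; rewrite /gam; case: ifP => _; first by rewrite mxE.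
  by rewrite mul_diag_mx !mxE.
apply: measurable_fun_ifT.
- apply: measurable_fun_eqr; [exact: measurable_det_mx_of|exact: measurable_cst].
- exact: measurable_cst.
apply: measurable_funM; last exact: measurable_mx_of.
case: (i == ord0); last exact: measurable_cst.
by apply: measurable_inv; exact: measurable_det_mx_of.
Qed.

Lemma measurable_mulgam (A : 'M[R]_m.+1) i j :
  measurable_fun setT (fun w => (A *m gam w) i j).
Proof.
rewrite (_ : (fun w => _) = fun w => \sum_k A i k * gam w k j).
  apply: measurable_sum => k; apply: measurable_funM; first exact: measurable_cst.
  exact: measurable_gam.
by apply/funext => w; rewrite mxE.
Qed.

Lemma iprob_box_neq0 d (T : measurableType d) (P : probability T R) n (B : 'I_n -> set T) :
  (forall i, measurable (B i)) -> (forall i, P (B i) != 0%E) ->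
  measurable [set t : n.-tuple T | forall i, B i (tnth t i)] /\
  iprob P n [set t : n.-tuple T | forall i, B i (tnth t i)] != 0%E.
Proof.
move=> mB PB; have mS k (C : 'I_k -> set T) : (forall i, measurable (C i)) ->
    measurable [set t : k.-tuple T | forall i, C i (tnth t i)].
  move=> mC; apply: measurable_forall => i.
  by rewrite -[X in measurable X]setTI; exact: measurable_tnth.
split; first exact: mS.
elim: n B mB PB => [|n IH] B mB PB.
  rewrite (_ : [set _ | _] = setT) ?probability_setT ?oner_neq0//.
  by apply/seteqP; split => // t _ -[].
rewrite iprobS (_ : tcons (n:=n) @^-1` _ =
    B ord0 `*` [set t : n.-tuple T | forall i, B (lift ord0 i) (tnth t i)]).
  rewrite product_measure1E//; last by apply: (mS _ (fun i => B (lift ord0 i))).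
  by rewrite mule_eq0 negb_or PB (IH (fun i => B (lift ord0 i))).
apply/seteqP; split => -[x t] /=.
  move=> H; split; first by have := H ord0; rewrite tnth_tcons0.
  by move=> i; have := H (lift ord0 i); rewrite tnth_tconsS.
move=> [H0 H] i; case: (unliftP ord0 i) => [k|] ->; rewrite ?tnth_tcons0 ?tnth_tconsS//.
Qed.

(** Neighbourhoods of the identity have positive probability, so a property of almost every random
    matrix holds for some matrix as close to 1 as desired. *)
Lemma gauss_mx_box n (e : R) : 0 < e ->
  measurable [set w : Omega n | forall i j, `|mx_of w i j - (i == j)%:R| < e] /\
  gauss_mx n [set w : Omega n | forall i j, `|mx_of w i j - (i == j)%:R| < e] != 0%E.
Proof.
move=> e0; pose I i j : set (measurableTypeR R) := `](i == j :> 'I_n)%:R - e, (i == j)%:R + e[%classic.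
pose B i := [set t : n.-tuple (measurableTypeR R) | forall j, I i j (tnth t j)].
have BP i : measurable (B i) /\ iprob (gauss R) n (B i) != 0%E.
  apply: iprob_box_neq0 => j; first exact: measurable_itv.
  by apply: gauss_itv; lra.
have -> : [set w : Omega n | forall i j, `|mx_of w i j - (i == j)%:R| < e] =
    [set w : Omega n | forall i, B i (tnth w i)].
  apply/seteqP; split=> w H i j; have := H i j; rewrite /I /= in_itv/= mxE;
    by rewrite ltr_distl.
by apply: iprob_box_neq0 => i; have [] := BP i.
Qed.

Lemma continuous_det n : continuous (fun M : 'M[R]_n => \det M).
Proof.
have co i j : continuous (fun M : 'M[R]_n => M i j : R) by exact: coord_continuous.
rewrite (_ : (fun M => _) = fun M : 'M[R]_n =>
    \sum_(s : {perm 'I_n}) (((-1) ^+ s : R) * (\prod_i M i (s i) : R)))//.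
apply: continuous_big => [|s _]; first by move=> z; apply: cvgD; [exact: cvg_fst|exact: cvg_snd].
move=> M; apply: (@continuousM R 'M[R]_n (fun=> (-1) ^+ s) (fun M : 'M[R]_n => \prod_i M i (s i)) M); first exact: cst_continuous.
apply: (@continuous_big R _ (fun x y : R => x * y) 1 xpredT _ _ _ (fun i (M : 'M[R]_n) => M i (s i))) => [|i _].
  by move=> z; apply: cvgM; [exact: cvg_fst|exact: cvg_snd].
exact: co.
Qed.

Lemma gam_near1 (e : R) : 0 < e -> exists2 k, 0 < k & forall w : Omega m.+1,
  (forall i j, `|mx_of w i j - (i == j)%:R| < k) ->
  \det (mx_of w) != 0 /\ `|gam w - 1%:M| <= e.
Proof.
move=> e0.
have co i j : continuous (fun M : 'M[R]_m.+1 => M i j : R) by exact: coord_continuous.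
have near_ball (Q : set 'M[R]_m.+1) : nbhs (1%:M : 'M[R]_m.+1) Q ->
    exists2 k : R, 0 < k & forall M : 'M[R]_m.+1,
      (forall i j, `|M i j - (i == j)%:R| < k) -> Q M.
  move=> /nbhs_ballP[k /= k0 kQ]; exists k => // M HM; apply: kQ; split=> // i j.
  by have := HM i j; rewrite /ball /= mxE distrC.
have nd : \forall M \near (1%:M : 'M[R]_m.+1), \det M != 0.
  have := @continuous_det m.+1 (1%:M); rewrite /continuous_at det1.
  move=> /(_ [set x | x != 0]); apply; apply: open_nbhs_nbhs; split => /=.
    exact: open_neq.
  exact: oner_neq0.
have nr i j : \forall M \near (1%:M : 'M[R]_m.+1),
    `|(\det M)^-1 * M i j - (i == j)%:R| < e.
  have : {for 1%:M, continuous (fun M : 'M[R]_m.+1 => (\det M)^-1 * M i j)}.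
    apply: continuousM; last exact: co.
    apply: continuousV; first by rewrite det1 oner_neq0.
    exact: continuous_det.
  rewrite /prop_for /continuous_at /= det1 invr1 mul1r mxE => /cvgrPdist_lt/(_ _ e0).
  by apply: filterS => M; rewrite distrC.
have [k1 k10 H1] := near_ball _ nd.
have [k2 k20 H2] : exists2 k : R, 0 < k & forall M : 'M[R]_m.+1,
    (forall i j, `|M i j - (i == j)%:R| < k) ->
    forall ij : 'I_m.+1 * 'I_m.+1, `|(\det M)^-1 * M ij.1 ij.2 - (ij.1 == ij.2)%:R| < e.
  apply: near_ball; apply: (@filter_forall _ _ (fun (ij : 'I_m.+1 * 'I_m.+1) M =>
    `|(\det M)^-1 * M ij.1 ij.2 - (ij.1 == ij.2)%:R| < e) (nbhs (1%:M : 'M[R]_m.+1)) (@nbhs_filter _ _)) => ij.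
  exact: nr.
exists (Num.min e (Num.min k1 k2)); first by rewrite !lt_min e0 k10.
move=> w Hw.
have d0 : \det (mx_of w) != 0.
  by apply: H1 => i j; apply: lt_le_trans (Hw i j) _; rewrite !ge_min lexx !orbT.
split => //; apply/mx_norm_leP => [|i j]; first exact: ltW.
rewrite [(gam w - _) i j]mxE [X in _ + X]mxE [1%:M i j]mxE.
rewrite /gam (negPf d0) mul_diag_mx [X in X - _]mxE [X in X * _]mxE; case: eqP => [->|_].
  apply: ltW; apply: (H2 (mx_of w) _ (ord0, j)) => i' j'.
  by apply: lt_le_trans (Hw i' j') _; rewrite !ge_min lexx !orbT.
by rewrite mul1r; apply: ltW; apply: lt_le_trans (Hw i j) _; rewrite ge_min lexx.
Qed.

End RandomMatrix.

(** * Convergence along a random matrix *)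

Lemma sqr_summable_cvg0 (R : realType) (v : nat -> R) :
  (\sum_(k <oo) (v k ^+ 2)%:E != +oo)%E -> v @ \oo --> (0 : R).
Proof.
move=> voo.
have /nnseries_is_cvg/cvg_series_cvg_0 : (\sum_(k <oo) (v k ^+ 2)%:E < +oo)%E.
  by rewrite ltey.
move=> /(_ (fun k => sqr_ge0 _)) /cvgrPdist_lt H.
apply/cvgrPdist_lt => e e0; have e2 : 0 < e ^+ 2 by rewrite exprn_gt0.
have := H _ e2; apply: filterS => k; rewrite !sub0r !normrN normrX.
by rewrite ltr_pXn2r// ?nnegrE// ltW.
Qed.

Lemma geometric_summable (R : realType) (u : nat -> R) (N : R) :
  (forall k, 0 <= u k) -> (forall k, u k <= N / (2 ^ k.+1)%:R) ->
  (\sum_(k <oo) (u k)%:E < +oo)%E.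
Proof.
move=> u0 uN; have N0 : 0 <= N.
  by have := le_trans (u0 0%N) (uN 0%N); rewrite pmulr_lge0// invr_gt0 ltr0n.
apply: (@le_lt_trans _ _ N%:E); last exact: ltry.
apply: le_trans (epsilon_trick0 xpredT N0).
by apply: lee_nneseries => k *; rewrite lee_fin.
Qed.

Lemma measurable_sqr_divergent d (T : measurableType d) (R : realType) (f : nat -> T -> R) :
  (forall k, measurable_fun setT (f k)) ->
  measurable [set x | (\sum_(k <oo) (f k x ^+ 2)%:E)%E = +oo%E].
Proof.
move=> mf; rewrite (_ : [set x | _] =
    setT `&` (fun x => \sum_(k <oo) (f k x ^+ 2)%:E)%E @^-1` [set +oo%E]).
  apply: (@ge0_emeasurable_sum _ _ _ setT (fun k x => (f k x ^+ 2)%:E) xpredT) => //.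
    by move=> k x _ _; rewrite lee_fin sqr_ge0.
  by move=> k _; apply/measurable_EFinP; exact: measurable_funM.
by rewrite setTI.
Qed.

Lemma measurable_det_neq0 (R : realType) n :
  measurable [set w : n.-tuple (n.-tuple (measurableTypeR R)) | \det (mx_of w) != 0].
Proof.
rewrite (_ : [set w | _] = (setT `&` (fun w => \det (mx_of w)) @^-1` (~` [set 0]))).
  by apply: measurable_det_mx_of => //; exact: measurableC.
by rewrite setTI; apply/seteqP; split=> x /= /eqP.
Qed.

Section Ergodic.
Variables (R : realType) (m : nat).
Local Notation X := (borel_lattice_space R m.+1).
Local Notation Omega := (m.+1.-tuple (m.+1.-tuple (measurableTypeR R))).
Variables (mu : probability X R) (mu_inv : SL_invariant mu).
Variables (Psi : nat -> X -> R) (h : R).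
Hypothesis mPsi : forall k, measurable_fun setT (Psi k).
Hypothesis Psi01 : forall k x, 0 <= Psi k x <= 1.
Hypothesis jPsi : forall k,
  measurable_fun setT (fun p : Omega * X => Psi k (act (gam p.1) p.2)).
Hypothesis sPsi : forall A, \det A = 1 ->
  (\sum_(k <oo) (disp mu (Psi k) A)%:E < +oo)%E.
Hypothesis hPsi : forall k, mean mu (Psi k) = h.

Let bPsi k : bmeas (Psi k).
Proof.
split; first exact: mPsi.
by exists 1 => x; have /andP[? ?] := Psi01 k x; rewrite ger0_norm.
Qed.

Let S (c : nat -> R) (x : X) : \bar R := (\sum_(k <oo) ((Psi k x - c k) ^+ 2)%:E)%E.

Let S2 (p : Omega * X) : \bar R :=
  (\sum_(k <oo) ((Psi k (act (gam p.1) p.2) - Psi k p.2) ^+ 2)%:E)%E.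

Let mbad : measurable [set p | S2 p = +oo%E].
Proof.
apply: measurable_sqr_divergent => k; apply: measurable_funB; first exact: jPsi.
exact: (measurableT_comp (mPsi k) measurable_snd).
Qed.

(** For fixed [w] the integral of the series is the sum of the displacements, which is finite; hence
    the series is finite almost everywhere. *)
Let bad_fiber w : mu [set x | S2 (w, x) = +oo%E] = 0%E.
Proof.
pose f k (x : X) : \bar R := ((Psi k (act (gam w) x) - Psi k x) ^+ 2)%:E.
have f0 k x : (0 <= f k x)%E by rewrite lee_fin sqr_ge0.
have mf k : measurable_fun setT (f k).
  by apply/measurable_EFinP; case: (bmeas_disp (gam w) (bPsi k)).
have If : (\int[mu]_x (\sum_(k <oo) f k x) < +oo)%E.
  rewrite integral_nneseries//.
  rewrite (_ : (\sum_(k <oo) _)%E = (\sum_(k <oo) (disp mu (Psi k) (gam w))%:E)%E).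
    by apply: sPsi; exact: det_gam.
  by apply: eq_eseriesr => k _; rewrite meanE//; exact: bmeas_disp.
have mS : measurable_fun setT (fun x => \sum_(k <oo) f k x)%E.
  by apply: (@ge0_emeasurable_sum _ _ _ setT f xpredT).
have S0 x : (0 <= \sum_(k <oo) f k x)%E by apply: nneseries_ge0.
have /(integrable_ae measurableT)[N [mN N0 HN]] :
    mu.-integrable setT (fun x => \sum_(k <oo) f k x)%E.
  apply/integrableP; split => //.
  by under eq_integral do rewrite gee0_abs//.
apply/eqP; rewrite eq_le measure_ge0 andbT -[X in (_ <= X)%E]N0.
apply: le_measure; rewrite ?inE//.
  rewrite (_ : [set x | _] = xsection [set p | S2 p = +oo%E] w).
    exact: measurable_xsection.
  by apply/seteqP; split=> x; rewrite /xsection /= inE.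
move=> x /= Sx; apply: HN => /= /(_ I).
by rewrite (_ : (\sum_(k <oo) f k x)%E = +oo%E).
Qed.

(** Fubini exchanges the quantifiers: almost every lattice is good for almost every [w], so one such
    lattice exists. *)
Let good_point : exists y0, gauss_mx R m.+1 [set w | S2 (w, y0) = +oo%E] = 0%E.
Proof.
have /(prod_null1 _ _ mbad)/(prod_null2 _ _ mbad) :
  gauss_mx R m.+1 [set w | mu (xsection [set p | S2 p = +oo%E] w) != 0%E] = 0%E.
  rewrite (_ : [set w | _] = set0) ?measure0//; apply/seteqP; split=> // w /=.
  rewrite (_ : xsection _ _ = [set x | S2 (w, x) = +oo%E]) ?bad_fiber ?eqxx//.
  by apply/seteqP; split=> x; rewrite /xsection /= inE.
set B := [set y | _] => B0; apply: contrapT => H.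
have BT : B = setT.
  apply/seteqP; split => // y _ /=; apply/eqP => H'; apply: H; exists y.
  rewrite -[RHS]H'; congr (gauss_mx _ _ _).
  by apply/seteqP; split=> x; rewrite /ysection /= inE.
by have := @probability_setT _ _ _ mu; rewrite -BT B0 => /eqP; rewrite eqe eq_sym oner_eq0.
Qed.

Let measurable_divergent (c : nat -> R) : measurable [set x | S c x = +oo%E].
Proof.
apply: measurable_sqr_divergent => k; apply: measurable_funB; first exact: mPsi.
exact: measurable_cst.
Qed.

(** The constants are the values at the good lattice [y0]. Writing [y = k y0], the matrix [gam w]
    acts on [y] as [gam (rmul k w)] acts on [y0], and [rmul k] pulls null sets back to null sets. *)
Let good_everywhere : exists2 c : nat -> R, (forall k, 0 <= c k <= 1) & forall y, exists N,
  [/\ measurable N, gauss_mx R m.+1 N = 0%E &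
    forall w, \det (mx_of w) != 0 -> ~ N w -> S c (act (gam w) y) != +oo%E].
Proof.
have [y0 y00] := good_point; exists (fun k => Psi k y0) => // y.
have mN0 : measurable [set w | S2 (w, y0) = +oo%E].
  rewrite (_ : [set w | _] = ysection [set p | S2 p = +oo%E] y0).
    exact: measurable_ysection.
  by apply/seteqP; split=> x; rewrite /ysection /= inE.
pose k := SLmx (repr y) *m invmx (SLmx (repr y0)).
have dk : \det k = 1 by rewrite det_mulmx det_inv !SL_det invr1 mulr1.
have ky : act k y0 = y.
  rewrite -{1}(coset_repr y0) act_coset// /k mulmxKV ?SL_unit//.
  by rewrite toSLK coset_repr.
have [mr nr] := nullpres_rmul dk.
exists (rmul k @^-1` [set w | S2 (w, y0) = +oo%E]); split.
- by rewrite -[X in measurable X]setTI; exact: mr.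
- exact: nr.
move=> w w0 /=; rewrite /S2 /= gam_rmul// act_mul ?det_gam// ky.
by move=> /eqP.
Qed.

(** Fubini in the other direction yields one [w] good for almost every lattice; invariance of [mu]
    under [gam w] then removes [w]. *)
Let limit_ae (c : nat -> R) : (forall y, exists N,
  [/\ measurable N, gauss_mx R m.+1 N = 0%E &
    forall w, \det (mx_of w) != 0 -> ~ N w -> S c (act (gam w) y) != +oo%E]) ->
  mu [set x | S c x = +oo%E] = 0%E.
Proof.
move=> Hc; pose F := [set p : Omega * X | \det (mx_of p.1) != 0 /\
  S c (act (gam p.1) p.2) = +oo%E].
have md := @measurable_det_neq0 R m.+1.
have mF : measurable F.
  rewrite (_ : F = ([set w : Omega | \det (mx_of w) != 0] `*` setT) `&`
    [set p | S c (act (gam p.1) p.2) = +oo%E]).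
    apply: measurableI; first by apply: measurableX.
    apply: measurable_sqr_divergent => k; apply: measurable_funB; first exact: jPsi.
    exact: measurable_cst.
  by apply/seteqP; split=> p /=; [move=> []|move=> [[]]].
have F0 : mu [set y | gauss_mx R m.+1 (ysection F y) != 0%E] = 0%E.
  rewrite (_ : [set y | _] = set0) ?measure0//; apply/seteqP; split=> // y /= /eqP; apply.
  have [N [mN N0 HN]] := Hc y.
  apply/eqP; rewrite eq_le measure_ge0 andbT -[X in (_ <= X)%E]N0.
  apply: (@le_measure _ _ _ (gauss_mx R m.+1)); [apply: mem_set; exact: measurable_ysection|exact: mem_set|].
  move=> w; rewrite /ysection /= inE => -[w0 Sw]; apply: contrapT => Nw.
  by have /eqP := HN w w0 Nw.
have /(prod_null1 _ _ mF) F1 := (prod_null2 _ _ mF).2 F0.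
(* A null set of matrices cannot contain the neighbourhood of 1 on which the determinant is
   nonzero. *)
have [w w0 Fw] : exists2 w : Omega, \det (mx_of w) != 0 & mu (xsection F w) = 0%E.
  apply: contrapT => H.
  have [k k0 Hk] := @gam_near1 R m 1 ltr01.
  have [mB /eqP] := @gauss_mx_box R m.+1 k k0; apply.
  apply/eqP; rewrite eq_le measure_ge0 andbT -[X in (_ <= X)%E]F1.
  apply: (@le_measure _ _ _ (gauss_mx R m.+1)); rewrite ?inE//.
    by apply: measurable_neq0; exact: measurable_fun_xsection.
  move=> w /= /Hk[w0 _]; apply/eqP => H'; apply: H; by exists w.
rewrite -Fw -(mu_act mu_inv (gam w))//; congr (mu _).
by apply/seteqP; split=> x; rewrite /xsection /= inE; [move=> ?; split|case].
Qed.

(* The constants c k approach the mean h, so the orbit averages converge to h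
   along almost every random matrix, from every starting lattice. *)
Lemma equidistribution_of_almost_invariant : exists2 c : nat -> R,
  c @ \oo --> h & forall y, exists N,
  [/\ measurable N, gauss_mx R m.+1 N = 0%E &
    forall w, \det (mx_of w) != 0 -> ~ N w ->
      (\sum_(k <oo) ((Psi k (act (gam w) y) - c k) ^+ 2)%:E != +oo)%E].
Proof.
have [c c01 Hc] := good_everywhere; have E0 := limit_ae Hc.
exists c => //.
  have bf k : bmeas (fun x => Psi k x - c k).
    by apply: bmeasB => //; exact: bmeas_cst.
  have H : (fun k => h - c k) @ \oo --> (0 : R).
    rewrite (_ : (fun k => h - c k) = fun k => mean mu (fun x => Psi k x - c k)).
      apply: (@mean_cvg _ X R mu _ 0 1 [set x | S c x = +oo%E]) => //.
        move=> k x; rewrite ler_norml; have /andP[? ?] := Psi01 k x.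
        by have /andP[? ?] := c01 k; apply/andP; split; lra.
      by move=> x /eqP Sx; exact: sqr_summable_cvg0.
    by apply/funext => k; rewrite meanB ?mean_cst ?hPsi//; exact: bmeas_cst.
  rewrite (_ : c = fun k => h - (h - c k)); last first.
    by apply/funext => k; rewrite subKr.
  by rewrite -[X in _ --> X]subr0; apply: cvgB => //; exact: cvg_cst.
Qed.

End Ergodic.

(** * Translations of the torus *)

Section Torus.
Variable R : realType.
Local Notation leb := (@lebesgue_measure R).
Local Open Scope ereal_scope.

Lemma ge0_integral_shift (f : measurableTypeR R -> \bar R) (a b s : R) :
  measurable_fun setT f -> (forall x, 0 <= f x) ->
  \int[leb]_(x in `[a, b[) f (x + s)%R = \int[leb]_(x in `[(a + s)%R, (b + s)%R[) f x.
Proof.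
move=> mf f0.
pose h : {mfun measurableTypeR R >-> measurableTypeR R} :=
  mfun_Sub (mem_set (measurable_shift s)).
rewrite [RHS](@eq_measure_integral _ _ R _ (pushforward leb h) leb); last first.
  by move=> A mA _; apply: esym; exact: lebesgue_measure_shift.
rewrite ge0_integral_pushforward//; last exact: measurable_funTS.
congr integral; apply/seteqP; split=> x /=; rewrite !in_itv/= lerD2r ltrD2r//.
Qed.

(** After reducing [s] to [r] in [0, 1], the shifted interval splits at 1, and periodicity moves its
    part beyond 1 back to [0, r[. *)
Lemma ge0_integral_period (f : measurableTypeR R -> \bar R) (s : R) :
  measurable_fun setT f -> (forall x, 0 <= f x) ->
  (forall x (z : int), f (x + z%:~R)%R = f x) ->
  \int[uniform_prob (@ltr01 R)]_x f (x + s)%R = \int[uniform_prob (@ltr01 R)]_x f x.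
Proof.
move=> mf f0 fz.
have msh t : measurable_fun setT (fun x : measurableTypeR R => f (x + t)%R).
  apply: measurableT_comp => //; exact: measurable_shift.
pose r := (s - (Num.floor s)%:~R)%R.
have r0 : (0 <= r)%R by rewrite subr_ge0 floor_le.
have r1 : (r <= 1)%R by rewrite lerBlDr addrC -[X in (_ <= _ + X)%R]/(1%:~R) -intrD ltW// floorD1_gt.
have -> : (fun x => f (x + s)%R) = (fun x => f (x + r)%R).
  by apply/funext => x; rewrite -(fz (x + r)%R (Num.floor s)) -addrA subrK.
rewrite !integral_uniform//; congr (_ * _).
rewrite -!integral_itv_bndo_bndc; last 2 first.
- exact: measurable_funTS.
- by apply: measurable_funTS; exact: msh.
rewrite ge0_integral_shift// add0r.
rewrite (@itv_bndbnd_setU _ _ (BLeft r) (BLeft 1%R)) ?bnd_simp ?lerDl//.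
rewrite ge0_integral_setU//=; last 2 first.
  exact: measurable_funTS.
  by apply/disj_setPS => x [] /=; rewrite !in_itv/= => /andP[_ +] /andP[+ _]; rewrite ltNge => /negP.
have := @ge0_integral_shift f 0 r 1 mf f0.
rewrite add0r [(r + 1)%R]addrC => <-.
have f1 x : f (x + 1)%R = f x by exact: (fz x 1%Z).
under [X in _ + X = _]eq_integral do rewrite f1.
rewrite addeC -ge0_integral_setU//=; last 2 first.
  exact: measurable_funTS.
  by apply/disj_setPS => x [] /=; rewrite !in_itv/= => /andP[_ +] /andP[+ _]; rewrite ltNge => /negP.
by rewrite -itv_bndbnd_setU ?bnd_simp.
Qed.

(** The law lives on the cube rather than on the torus, hence the periodicity hypothesis on [A]. The
    measure of a section is itself a periodic function of the first coordinate, so the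
    one-dimensional case and induction combine. *)
Lemma uniform_cube_shift m (A : set (m.-tuple (measurableTypeR R))) (s : 'I_m -> R) :
  measurable A ->
  (forall (x : m.-tuple R) (z : 'I_m -> int),
    A [tuple (tnth x i + (z i)%:~R)%R | i < m] <-> A x) ->
  uniform_cube R m [set x | A [tuple (tnth x i + s i)%R | i < m]] = uniform_cube R m A.
Proof.
have msh k (t : 'I_k -> R) : measurable_fun setT
    (fun x : k.-tuple (measurableTypeR R) => [tuple (tnth x i + t i)%R | i < k] :
      k.-tuple (measurableTypeR R)).
  apply/measurable_fun_tnthP => i.
  rewrite (_ : _ \o _ = fun x => (tnth x i + t i)%R); last first.
    by apply/funext => x /=; rewrite tnth_mktuple.
  by apply: measurable_funD; [exact: measurable_tnth|exact: measurable_cst].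
elim: m A s => [|m IH] A s mA Az.
  rewrite (_ : [set x | _] = A)//; apply/seteqP; split=> x /=;
    by rewrite [x]tuple0 [mktuple _]tuple0.
pose tc (p : measurableTypeR R * m.-tuple (measurableTypeR R)) :
  m.+1.-tuple (measurableTypeR R) := [tuple of p.1 :: p.2].
have mtc : measurable_fun setT tc by exact: measurable_cons.
have ucS E : uniform_cube R m.+1 E = (uniform_prob (@ltr01 R) \x uniform_cube R m) (tc @^-1` E).
  by [].
pose phi a := uniform_cube R m (xsection (tc @^-1` A) a).
have mtA : measurable (tc @^-1` A) by rewrite -[X in measurable X]setTI; exact: mtc.
have secE E a : xsection (tc @^-1` E) a = [set t | E (tc (a, t))].
  by apply/seteqP; split=> t; rewrite /xsection /= inE.
have tcD a t b (u : 'I_m -> R) : [tuple (tnth (tc (a, t)) i +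
    (if unlift ord0 i is Some k then u k else b))%R | i < m.+1] =
    tc ((a + b)%R, [tuple (tnth t i + u i)%R | i < m]).
  apply: eq_from_tnth => i; rewrite tnth_mktuple.
  case: (unliftP ord0 i) => [k|] ->; first by rewrite !tnthS tnth_mktuple.
  by rewrite !tnth0.
have key a t (b : int) (u : 'I_m -> int) :
    A (tc ((a + b%:~R)%R, [tuple (tnth t i + (u i)%:~R)%R | i < m])) <-> A (tc (a, t)).
  apply: iff_trans (Az (tc (a, t)) (fun i => if unlift ord0 i is Some k then u k else b)).
  rewrite -tcD (_ : [tuple _ | i < m.+1] = [tuple (tnth (tc (a, t)) i +
    (if unlift ord0 i is Some k then u k else b)%:~R)%R | i < m.+1])//.
  by apply: eq_from_tnth => i; rewrite !tnth_mktuple; case: unlift.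
have phi_per a (z : int) : phi (a + z%:~R)%R = phi a.
  have t0 t : [tuple (tnth t i + ((fun=> 0%Z) i)%:~R)%R | i < m] = t.
    by apply: eq_from_tnth => i; rewrite tnth_mktuple addr0.
  rewrite /phi !secE; congr (uniform_cube R m _); apply/seteqP; split=> t /=.
    by move=> H; apply/(key a t z (fun=> 0%Z)); rewrite t0.
  by move=> /(key a t z (fun=> 0%Z)); rewrite t0.
rewrite !ucS /product_measure1.
rewrite -(@ge0_integral_period phi (s ord0)) => [|||//]; last 2 first.
- exact: measurable_fun_xsection.
- by move=> x; exact: measure_ge0.
apply: eq_integral => a _; rewrite /phi /= !secE.
rewrite -[RHS](IH _ (s \o lift ord0)); last 2 first.
- by rewrite -secE; exact: measurable_xsection.
- move=> x z /=.
  have := key (a + s ord0)%R x 0%Z z; rewrite addr0; apply.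
congr (uniform_cube R m _).
suff E t : [tuple (tnth (tc (a, t)) i + s i)%R | i < m.+1] =
    tc ((a + s ord0)%R, [tuple (tnth t i + s (lift ord0 i))%R | i < m]).
  by apply/seteqP; split=> t /=; rewrite E.
rewrite -tcD; apply: eq_from_tnth => i; rewrite !tnth_mktuple.
by case: (unliftP ord0 i) => [k|] ->.
Qed.

End Torus.

(** * Equidistribution of expanding translates *)

Section HitMeasurability.
Context d (T : measurableType d) (R : realType) (m : nat) (A : T -> 'M[R]_m.+1).
Hypothesis mA : forall i j, measurable_fun setT (fun x => A x i j).

Let mAz (z : 'cV[int]_m.+1) i :
  measurable_fun setT (fun x => (A x *m map_mx intr z) i ord0).
Proof.
rewrite (_ : (fun x => _) = fun x => \sum_j A x i j * (map_mx intr z : 'cV[R]_m.+1) j ord0).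
  apply: measurable_sum => j; apply: measurable_funM; first exact: mA.
  exact: measurable_cst.
by apply/funext => x; rewrite mxE.
Qed.

Lemma measurable_hit (O : set 'cV[R]_m.+1) :
  (forall z, measurable [set x | O (A x *m map_mx intr z)]) -> measurable [set x | hit O (A x)].
Proof.
move=> mO; rewrite (_ : [set x | _] = \bigcup_(z : 'cV[int]_m.+1) [set x | O (A x *m map_mx intr z)]).
  by apply: countable_bigcupT_measurable => //; exact: countableP.
by apply/seteqP; split=> x [z]; exists z.
Qed.

Lemma measurable_hit_box q r : measurable [set x | hit (box q r) (A x)].
Proof.
apply: measurable_hit => z.
apply: (@measurable_forall _ _ _ (fun i x =>
  `|(A x *m map_mx intr z) i ord0 - q i ord0| < r)) => i.
apply: measurable_ltset; last exact: measurable_cst.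
apply: measurableT_comp => //.
by apply: measurable_funB; [exact: mAz|exact: measurable_cst].
Qed.

Lemma measurable_hit_cone c t : measurable [set x | hit (cone c t) (A x)].
Proof.
apply: measurable_hit => z.
pose w x := A x *m map_mx intr z.
rewrite (_ : [set x | _] = [set x | 0 < w x ord0 ord0] `&` [set x | w x ord0 ord0 < t]
    `&` [set x | forall i : 'I_m, `|w x (lift ord0 i) ord0| < c * w x ord0 ord0]).
  apply: measurableI; first apply: measurableI.
  - by apply: measurable_ltset; [exact: measurable_cst|exact: mAz].
  - by apply: measurable_ltset; [exact: mAz|exact: measurable_cst].
  apply: (@measurable_forall _ _ _ (fun i x =>
    `|w x (lift ord0 i) ord0| < c * w x ord0 ord0)) => i.
  apply: measurable_ltset.
    by apply: measurableT_comp => //; exact: mAz.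
  by apply: measurable_funM; [exact: measurable_cst|exact: mAz].
apply/seteqP; split=> x /=.
  by move=> [/andP[w0 wT] wi].
by move=> [[w0 wT] wi]; split=> //; apply/andP.
Qed.

End HitMeasurability.

Section Translates.
Variables (R : realType) (m : nat).
Local Notation Y := (m.-tuple (measurableTypeR R)).
Implicit Types (x : Y) (A B g : 'M[R]_m.+1).

Definition colt (x : Y) : 'cV[R]_m := \col_i tnth x i.

Lemma measurable_horo_colt i j : measurable_fun setT (fun x : Y => horo (colt x) i j).
Proof.
rewrite (_ : (fun x => _) = fun x : Y => (i == j)%:R -
    (if unlift ord0 i is Some k then tnth x k else 0) * (j == ord0)%:R).
  apply: measurable_funB; first exact: measurable_cst.
  apply: measurable_funM; last exact: measurable_cst.
  by case: unlift => [k|]; [exact: measurable_tnth|exact: measurable_cst].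
apply/funext => x; rewrite horoE mxE; case: unlift => [k|]//.
by rewrite mxE.
Qed.

Lemma measurable_mul_horo_colt A i j :
  measurable_fun setT (fun x : Y => (A *m horo (colt x)) i j).
Proof.
rewrite (_ : (fun x => _) = fun x : Y => \sum_k A i k * horo (colt x) k j).
  apply: measurable_sum => k; apply: measurable_funM; first exact: measurable_cst.
  exact: measurable_horo_colt.
by apply/funext => x; rewrite mxE.
Qed.

Definition hitset (c T : R) A : set Y := [set x | hit (cone c T) (A *m horo (colt x))].

Lemma measurable_hitset c T A : measurable (hitset c T A).
Proof. by apply: measurable_hit_cone => i j; exact: measurable_mul_horo_colt. Qed.

Lemma hit_mul_intr (O : set 'cV[R]_m.+1) A (z : 'M[int]_m.+1) : \det z = 1 ->
  hit O (A *m map_mx intr z) <-> hit O A.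
Proof.
move=> dz; have uz : z \in unitmx by rewrite unitmxE dz unitr1.
split=> -[w Ow].
  by exists (z *m w); rewrite map_mxM mulmxA.
by exists (invmx z *m w); rewrite -mulmxA -map_mxM mulmxA mulmxV// mul1mx.
Qed.

Definition zhoro (z : 'I_m -> int) : 'M[int]_m.+1 :=
  \matrix_(i, j) ((i == j)%:R -
    (if unlift ord0 i is Some k then z k else 0) * (j == ord0)%:R).

Lemma map_zhoro z : map_mx intr (zhoro z) = horo (\col_i (z i)%:~R : 'cV[R]_m).
Proof.
apply/matrixP => i j; rewrite horoE !mxE rmorphB rmorphM/= !rmorph_nat.
by case: unlift => [k|]; rewrite ?mxE.
Qed.

Lemma det_zhoro z : \det (zhoro z) = 1.
Proof.
by apply: (@intr_inj R); rewrite -det_map_mx map_zhoro det_horo.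
Qed.

(* x |-> hit (A *m horo x) is periodic: integer horospherical matrices lie in SL(m+1, Z). *)
Lemma uniform_cube_hitset c T A (v : 'cV[R]_m) :
  uniform_cube R m (hitset c T (A *m horo v)) = uniform_cube R m (hitset c T A).
Proof.
rewrite -[RHS](@uniform_cube_shift _ _ _ (fun i => v i ord0)); last 2 first.
- exact: measurable_hitset.
- move=> x z; rewrite /hitset /=.
  rewrite (_ : colt _ = colt x + \col_i (z i)%:~R); last first.
    by apply/matrixP => i j; rewrite !mxE tnth_mktuple.
  by rewrite -horoM -map_zhoro mulmxA; apply: hit_mul_intr; exact: det_zhoro.
have E (x : Y) : colt [tuple tnth x i + v i ord0 | i < m] = v + colt x.
  by apply/matrixP => i j; rewrite !mxE tnth_mktuple addrC [j]ord1.
by congr (uniform_cube R m _); apply/seteqP; split=> x; rewrite /hitset /= E -horoM mulmxA.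
Qed.

(** With [g = b *m horo v], the factor [b] passes to the left of [dil s], stays near 1 and only
    perturbs the cone. The translation [v] is the same for all [s]; periodicity will remove it. *)
Lemma hitset_sandwich c T c1 T1 : 0 < c -> c < c1 -> 0 < T -> T < T1 ->
  exists2 k, 0 < k & forall g, `|g - 1%:M| <= k -> exists v, forall s, 1 <= s ->
    hitset c T (dil m s *m g) `<=` hitset c1 T1 (dil m s *m horo v) /\
    hitset c T (dil m s *m horo v) `<=` hitset c1 T1 (dil m s *m g).
Proof.
move=> c0 cc1 T0 TT1; have [e e0 He] := @cone_near R m _ _ _ _ c0 cc1 T0 TT1.
have [k k0 Hk] := @horo_decomp R m e e0.
exists k => // g /Hk[b [v [gE Hb]]]; exists v => s s1.
have [b' /He[H1 H2] bE] := Hb _ s1.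
split=> x [z].
  rewrite gE mulmxA bE -!(mulmxA b') => /H2 H; exists z.
  by rewrite -!mulmxA in H *.
move=> H; exists z; rewrite gE mulmxA bE -!(mulmxA b'); apply: H1.
by rewrite -!mulmxA in H *.
Qed.

Lemma act_translateE c T (s : R) (v : 'cV[R]_m) g x : 0 < s -> \det g = 1 ->
  lhit (cone c T) (act (horo v) (act (dil m s) (act g (act (horo (colt x)) (coset (SL1 R m.+1))))))
  <-> hitset c T (dil m s *m (horo (s ^- m.+1 *: v) *m g)) x.
Proof.
move=> s0 dg.
rewrite -!act_mul ?det_mulmx ?det_horo ?dg ?det_dil ?mulr1//.
rewrite act_coset ?det_mulmx ?det_horo ?dg ?det_dil ?mulr1//.
apply: iff_trans (lhit_coset _ _) _.
rewrite toSLE; last by rewrite mulmx1 !det_mulmx ?det_horo ?dg ?det_dil ?mulr1.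
rewrite mulmx1 /hitset /= !mulmxA dil_horo// scalerA mulfV ?scale1r//.
by rewrite expf_neq0// gt_eqF.
Qed.

End Translates.

Section Rescaling.
Variables (R : realType) (m : nat).

Lemma dil_unit (s : R) : 0 < s -> dil m s \in unitmx.
Proof. by move=> s0; rewrite unitmxE det_dil// unitr1. Qed.

(** The new parameter is not controlled as [s] varies, but the bound in [mautner] is uniform in
    it. *)
Lemma dil_transv (s : R) (i j : 'I_m.+1) (c : R) : 0 < s ->
  exists c', dil m s *m transv i j c *m invmx (dil m s) = transv i j c'.
Proof.
move=> s0; pose d (k : 'I_m.+1) := if k == ord0 then s ^- m else s.
have d0 k : d k != 0.
  by rewrite /d lt0r_neq0//; case: ifP; rewrite // invr_gt0 exprn_gt0.
exists (d i * c / d j); apply: (canLR (mulmxK (dil_unit s0))).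
apply/matrixP => k l; rewrite mul_transv !mul_diag_mx.
rewrite !mxE -![if _ == _ then _ else s]/(d _).
case: (eqVneq k i) => [->|_] /=; last by rewrite !mulr0n !mul0r mulr0 !addr0 mulr_natr.
rewrite mul1r mulrDr [d i * (i == l)%:R]mulr_natr; congr (_ + _).
case: (eqVneq l j) => _ /=; last by rewrite !mulr0n !mulr0.
by rewrite !mulr1n mulr1 divfK ?mulrA.
Qed.

Lemma mulmx_near1 (n : nat) (k : R) : 0 < k -> exists2 r, 0 < r & forall A B : 'M[R]_n,
  `|A - 1%:M| <= r -> `|B - 1%:M| <= r -> `|A *m B - 1%:M| <= k.
Proof.
move=> k0; pose r := Num.min 1 (k / (2 * n%:R + 1)).
have N0 : 0 < 2 * n%:R + 1 :> R by rewrite ltr_wpDl// mulr_ge0.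
have r0 : 0 < r by rewrite lt_min ltr01 divr_gt0.
have [r1 rk] : r <= 1 /\ r * (2 * n%:R + 1) <= k.
  have : r <= r by [].
  by rewrite {2}/r le_min ler_pdivlMr// => /andP.
exists r => // A B Ar Br.
have n1 : `|1%:M : 'M[R]_n| <= 1.
  by apply/mx_norm_leP => // i j; rewrite mxE normr_nat; case: (_ == _).
have B2 : `|B| <= 2.
  rewrite -[B](subrK 1%:M); apply: le_trans (ler_normD _ _) _.
  by rewrite (_ : 2 = 1 + 1 :> R)//; apply: lerD => //; exact: le_trans r1.
have -> : A *m B - 1%:M = (A - 1%:M) *m B + (B - 1%:M).
  by rewrite mulmxBl mul1mx addrA subrK.
apply: le_trans (ler_normD _ _) _; apply: le_trans rk.
rewrite mulrDr mulr1 lerD//; apply: le_trans (mulmx_norm_le_mx _ _) _.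
rewrite (_ : r * _ = n%:R * r * 2); last by ring.
by apply: ler_pM => //; rewrite ?mulr_ge0// ler_wpM2l.
Qed.

Lemma horo_near1 (v : 'cV[R]_m) : `|horo v - 1%:M| <= `|v|.
Proof.
apply/mx_norm_leP => // i j.
have -> : (horo v - 1%:M) i j = - (pad v i ord0 * (j == ord0)%:R).
  by rewrite mxE horoE [(- 1%:M) _ _]mxE [1%:M _ _]mxE addrAC subrr add0r.
rewrite normrN normrM normr_nat -[leRHS]mulr1; apply: ler_pM => //; last by case: (_ == _).
case: (unliftP ord0 i) => [l|] ->; last by rewrite pad0 normr0.
by rewrite padS; exact: mx_norm_ge.
Qed.

End Rescaling.

Lemma open_box (R : realType) n (q : 'cV[R]_n) (r : R) : open (box q r).
Proof.
apply: (@open_forall _ _ (fun i (w : 'cV[R]_n) => `|w i ord0 - q i ord0| < r)) => i.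
rewrite [X in open X](_ : _ = (fun w : 'cV[R]_n => w i ord0 : R) @^-1` ball (q i ord0) r).
  apply: open_comp => [w _|]; first exact: coord_continuous.
  exact: ball_open.
by apply/seteqP; split=> w /=; rewrite distrC.
Qed.

(** * Dilated averages and their convergence *)

Section Average.
Variables (R : realType) (m : nat).
Local Notation X := (borel_lattice_space R m.+1).
Local Notation Y := (m.-tuple (measurableTypeR R)).
Local Notation Omega := (m.+1.-tuple (m.+1.-tuple (measurableTypeR R))).
Variables (mu : probability X R) (mu_inv : SL_invariant mu) (c T : R).
Hypothesis c0 : 0 < c.
Implicit Types (L : seq 'cV[R]_m) (s : R).

Let phi : X -> R := \1_(lhit (cone c T) : set X).

Let bphi : bmeas phi.
Proof. by apply: bmeas_indic; apply: measurable_lhit; exact: open_cone. Qed.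

Definition dilavg L s (x : X) : R := avg phi L (act (dil m s) x).

Lemma bmeas_dilavg L s : bmeas (dilavg L s).
Proof. by apply: bmeas_act; exact: bmeas_avg. Qed.

Lemma dilavg01 L s x : L != [::] -> 0 <= dilavg L s x <= 1.
Proof.
move=> L0; have sL : 0 < (size L)%:R :> R by rewrite ltr0n lt0n size_eq0.
have p01 y : 0 <= phi y <= 1 by rewrite /phi indicE; case: (_ \in _); rewrite /= ?ler01 ?lexx.
apply/andP; split.
  apply: mulr_ge0; first by rewrite invr_ge0 ltW.
  by apply: sumr_ge0 => v _; case/andP: (p01 (act (horo v) (act (dil m s) x))).
rewrite ler_pdivrMl// mulr1 -sum1_size natr_sum; apply: ler_sum => v _.
by case/andP: (p01 (act (horo v) (act (dil m s) x))).
Qed.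

Lemma mean_dilavg L s : L != [::] -> mean mu (dilavg L s) = mean mu phi.
Proof. by move=> L0; rewrite mean_act//; [exact: mean_avg|exact: bmeas_avg]. Qed.

Lemma measurable_dilavg_gam L s : 0 < s ->
  measurable_fun setT (fun p : Omega * X => dilavg L s (act (gam p.1) p.2)).
Proof.
move=> s0; rewrite (_ : (fun p => _) = fun p : Omega * X => (size L)%:R^-1 *
    \sum_(v <- L) \1_[set p | hit (cone c T)
      (horo v *m dil m s *m gam p.1 *m SLmx (repr p.2))] p).
  apply: measurable_funM; first exact: measurable_cst.
  apply: measurable_sum => v; apply: measurable_indic.
  apply: (@measurable_hit_mul _ _ Omega X R m
    (fun w => horo v *m dil m s *m gam w) (fun x => SLmx (repr x))) => //.
    by move=> i j; exact: measurable_mulgam.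
  by move=> q r; apply: measurable_lhit; exact: open_box.
apply/funext => -[w x]; congr (_ * _); apply: eq_bigr => v _.
rewrite /phi !indicE /= -!act_mul ?det_mulmx ?det_horo ?det_dil ?det_gam ?mulr1//.
congr (nat_of_bool _)%:R; apply/idP/idP; rewrite !inE.
  by move=> /lhit_act; apply; rewrite !det_mulmx ?det_horo ?det_dil ?det_gam ?mulr1.
move=> H; apply/lhit_act => //.
by rewrite !det_mulmx ?det_horo ?det_dil ?det_gam ?mulr1.
Qed.

Lemma dilavg_horo L s g (x : Y) : 0 < s -> \det g = 1 ->
  dilavg L s (act g (act (horo (colt x)) (coset (SL1 R m.+1)))) =
  (size L)%:R^-1 * \sum_(v <- L) \1_(hitset c T (dil m s *m (horo (s ^- m.+1 *: v) *m g))) x.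
Proof.
move=> s0 dg; congr (_ * _); apply: eq_bigr => v _.
rewrite /phi !indicE; congr (nat_of_bool _)%:R.
by apply/idP/idP; rewrite !inE => /(act_translateE _ _ _ _ s0 dg).
Qed.

Lemma measurable_dilavg_gam_horo L s : 0 < s ->
  measurable_fun setT (fun p : Omega * Y =>
    dilavg L s (act (gam p.1) (act (horo (colt p.2)) (coset (SL1 R m.+1))))).
Proof.
move=> s0; rewrite (_ : (fun p => _) = fun p : Omega * Y => (size L)%:R^-1 *
    \sum_(v <- L) \1_[set p | hit (cone c T)
      (dil m s *m horo (s ^- m.+1 *: v) *m gam p.1 *m horo (colt p.2))] p).
  apply: measurable_funM; first exact: measurable_cst.
  apply: measurable_sum => v; apply: measurable_indic.
  apply: (@measurable_hit_mul _ _ Omega Y R m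
    (fun w => dil m s *m horo (s ^- m.+1 *: v) *m gam w) (fun x => horo (colt x))) => //.
    by move=> i j; exact: measurable_mulgam.
  by move=> q r; apply: measurable_hit_box => i j; exact: measurable_horo_colt.
apply/funext => -[w x]; rewrite dilavg_horo ?det_gam//; congr (_ * _).
by apply: eq_bigr => v _; rewrite !indicE /= !mulmxA.
Qed.

(** Transvections have displacement at most 2000 times the geometric bound. Factoring [A] into
    transvections gives a constant [N] depending on [A] but not on [n], so the series still
    converges. *)
Lemma disp_dilavg (L : nat -> seq 'cV[R]_m) (s : nat -> R) A : (forall n, 0 < s n) ->
  cont1 mu phi -> (forall n v, disp mu (avg phi (L n)) (horo v) <= (2 ^ n.+1)%:R^-1) ->
  \det A = 1 -> (\sum_(n <oo) (disp mu (dilavg (L n) (s n)) A)%:E < +oo)%E.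
Proof.
move=> s0 cphi HL dA.
suff [N HN] : exists N : R, forall n, disp mu (dilavg (L n) (s n)) A <= N / (2 ^ n.+1)%:R.
  apply: (geometric_summable _ HN) => n; apply: mean_ge0 => x; exact: sqr_ge0.
have e0 n : 0 < (2 ^ n.+1)%:R^-1 :> R by rewrite invr_gt0 ltr0n expn_gt0.
have base i j b : i != j -> forall n,
    disp mu (dilavg (L n) (s n)) (transv i j b) <= 2000 / (2 ^ n.+1)%:R.
  move=> ij n; rewrite disp_conj ?det_transv ?det_dil//; last exact: bmeas_avg.
  have [b' ->] := dil_transv i j b (s0 n).
  apply: (@mautner R m mu mu_inv) => //; first exact: bmeas_avg.
  exact: cont1_avg.
have step A1 A2 : \det A1 = 1 -> \det A2 = 1 ->
    (exists N : R, forall n, disp mu (dilavg (L n) (s n)) A1 <= N / (2 ^ n.+1)%:R) ->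
    (exists N : R, forall n, disp mu (dilavg (L n) (s n)) A2 <= N / (2 ^ n.+1)%:R) ->
    exists N : R, forall n, disp mu (dilavg (L n) (s n)) (A1 *m A2) <= N / (2 ^ n.+1)%:R.
  move=> d1 d2 [N1 H1] [N2 H2]; exists (2 * N1 + 2 * N2) => n.
  apply: le_trans (disp_mul mu_inv (bmeas_dilavg _ _) d1 d2) _.
  rewrite [leRHS](_ : _ = 2 * (N1 / (2 ^ n.+1)%:R) + 2 * (N2 / (2 ^ n.+1)%:R)); last by ring.
  by apply: lerD; rewrite ler_pM2l.
move: A dA; apply: transv_ind => [|i j b A ij dA IH|i j b A ij dA IH].
- exists 0 => n; rewrite mul0r (_ : disp _ _ _ = 0)// -[RHS](mean_cst mu 0).
  by congr mean; apply/funext => x; rewrite act1 subrr expr0n.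
- apply: step (det_transv b ij) dA _ IH; exists 2000; exact: base.
- apply: step dA (det_transv b ij) IH _; exists 2000; exact: base.
Qed.

End Average.

Section Equidistribution.
Variables (R : realType) (m : nat).
Local Notation X := (borel_lattice_space R m.+1).
Local Notation Y := (m.-tuple (measurableTypeR R)).
Local Notation Omega := (m.+1.-tuple (m.+1.-tuple (measurableTypeR R))).
Variables (mu : probability X R) (mu_inv : SL_invariant mu).

Lemma small_rescaled (L : seq 'cV[R]_m) (r : R) : 0 < r ->
  exists2 S, 1 <= S & forall s, S <= s -> forall v, v \in L -> `|s ^- m.+1 *: v| <= r.
Proof.
move=> r0; elim: L => [|v L [S S1 HS]]; first by exists 1.
exists (Num.max S (`|v| / r)) => [|s]; first by rewrite le_max S1.
rewrite ge_max ler_pdivrMr// => /andP[Ss vs] u; rewrite in_cons => /orP[/eqP->|]; last exact: HS.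
have s1 : 1 <= s by exact: le_trans Ss.
have s0 : 0 < s by exact: lt_le_trans s1.
rewrite normrZ gtr0_norm ?invr_gt0 ?exprn_gt0// ler_pdivrMl ?exprn_gt0//.
apply: le_trans vs _; rewrite ler_wpM2r ?(ltW r0)//.
by rewrite exprS ler_peMr ?(ltW s0)// exprn_ege1.
Qed.

Definition hit_prob (c T : R) A : R := mean (uniform_cube R m) (\1_(hitset c T A) : Y -> R).

(** Two possibly different matrices near 1: an average guarantees a term above a lower bound and a
    term below an upper one, but no single term between them. *)
Definition straddled (c T k l h s : R) :=
  (exists2 g : 'M[R]_m.+1, `|g - 1%:M| <= k & l <= hit_prob c T (dil m s *m g)) /\
  (exists2 g : 'M[R]_m.+1, `|g - 1%:M| <= k & hit_prob c T (dil m s *m g) <= h).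

Lemma avg_straddle (I : eqType) (L : seq I) (f : I -> R) (a : R) : L != [::] ->
  a < (size L)%:R^-1 * \sum_(v <- L) f v -> exists2 v, v \in L & a < f v.
Proof.
move=> L0 aL; apply: contrapT => no; move: aL; apply/negP; rewrite -leNgt.
have sL : 0 < (size L)%:R :> R by rewrite ltr0n lt0n size_eq0.
rewrite ler_pdivrMl// -sum1_size natr_sum mulr_suml [leRHS](eq_bigr (fun=> a)) => [|i _]; last exact: mul1r.
rewrite [X in X <= _]big_seq [X in _ <= X]big_seq; apply: ler_sum => v vL.
by rewrite leNgt; apply/negP => av; apply: no; exists v.
Qed.

Lemma mean_dilavg_horo c T (L : seq 'cV[R]_m) s g : 0 < s -> \det g = 1 ->
  mean (uniform_cube R m) (fun x : Y => dilavg c T L s (act g (act (horo (colt x)) (coset (SL1 R m.+1)))))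
  = (size L)%:R^-1 * \sum_(v <- L) hit_prob c T (dil m s *m (horo (s ^- m.+1 *: v) *m g)).
Proof.
move=> s0 dg; have bi v := @bmeas_indic _ Y R _ (measurable_hitset c T (dil m s *m (horo (s ^- m.+1 *: v) *m g))).
rewrite -mean_sum// -meanZ; last exact: bmeas_sum.
by congr mean; apply/funext => x; rewrite dilavg_horo.
Qed.

(** If the claim failed for arbitrarily large [s], bad parameters would form a sequence to which the
    convergence along random matrices applies, giving averages that converge to the mean. Some
    translate in a late average then contradicts badness. *)
Lemma equidistribution_straddled c T k e : 0 < c -> 0 < k -> 0 < e ->
  cont1 mu (\1_(lhit (cone c T) : set X) : X -> R) ->
  exists S, forall s, S <= s ->
    straddled c T k (mean mu (\1_(lhit (cone c T) : set X) : X -> R) - e)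
      (mean mu (\1_(lhit (cone c T) : set X) : X -> R) + e) s.
Proof.
set phi := (\1__); set h := mean mu phi => c0 k0 e0 cphi; apply: contrapT => no.
have bphi : bmeas phi by apply: bmeas_indic; apply: measurable_lhit; exact: open_cone.
have [r r0 Hr] := @mulmx_near1 R m.+1 k k0.
have e2 n : 0 < (2 ^ n.+1)%:R^-1 :> R by rewrite invr_gt0 ltr0n expn_gt0.
have [L HL] : {L : nat -> seq 'cV[R]_m & forall n, L n != [::] /\
    forall v, disp mu (avg phi (L n)) (horo v) <= (2 ^ n.+1)%:R^-1}.
  apply: (@choice nat (seq 'cV[R]_m) (fun n L => L != [::] /\
    forall v, disp mu (avg phi L) (horo v) <= (2 ^ n.+1)%:R^-1)) => n.
  by have [L L0 HL] := exists_almost_invariant_avg mu_inv bphi (e2 n); exists L.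
(* [s n] is chosen after [L n], so large that all rescaled translations of [L n] have norm at most
   [r]. *)
have [s Hs] : {s : nat -> R & forall n, [/\ 1 <= s n, ~ straddled c T k (h - e) (h + e) (s n) &
    forall v, v \in L n -> `|s n ^- m.+1 *: v| <= r]}.
  apply: (@choice nat R (fun n s => [/\ 1 <= s, ~ straddled c T k (h - e) (h + e) s &
    forall v, v \in L n -> `|s ^- m.+1 *: v| <= r])) => n.
  have [S S1 HS] := small_rescaled (L n) r0.
  apply: contrapT => H; apply: no; exists S => s Ss; apply: contrapT => ns; apply: H.
  by exists s; split=> //; [exact: le_trans Ss|exact: HS].
have s0 n : 0 < s n by have [s1 _ _] := Hs n; exact: lt_le_trans s1.
have L0 n : L n != [::] by have [] := HL n.
pose Psi n (x : X) := dilavg c T (L n) (s n) x.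
have [C Ch HC] := @equidistribution_of_almost_invariant R m mu mu_inv Psi h
  (fun n => (bmeas_dilavg c T (L n) (s n)).1) (fun n x => dilavg01 c T (s n) x (L0 n))
  (fun n => measurable_dilavg_gam T c0 (L n) (s0 n))
  (fun A dA => disp_dilavg mu_inv s0 cphi (fun n => (HL n).2) dA)
  (fun n => mean_dilavg mu_inv c T (s n) (L0 n)).
pose y (x : Y) : X := act (horo (colt x)) (coset (SL1 R m.+1)).
pose Bad : set (Omega * Y) := [set p | \det (mx_of p.1) != 0] `&`
  [set p | (\sum_(n <oo) ((Psi n (act (gam p.1) (y p.2)) - C n) ^+ 2)%:E)%E = +oo%E].
have mBad : measurable Bad.
  apply: measurableI.
    rewrite (_ : [set p | _] = [set w : Omega | \det (mx_of w) != 0] `*` setT).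
      by apply: measurableX => //; exact: measurable_det_neq0.
    by apply/seteqP; split=> -[w x] /=; [split|case].
  apply: (@measurable_sqr_divergent _ (Omega * Y)%type R
    (fun n p => Psi n (act (gam p.1) (y p.2)) - C n)) => n.
  apply: measurable_funB; last exact: measurable_cst.
  exact: measurable_dilavg_gam_horo.
(* From every [x] and almost every matrix to almost every matrix and almost every [x]: a single [w]
   near 1 then serves almost all [x]. *)
have /(prod_null2 _ _ mBad)/(prod_null1 _ _ mBad) :
    uniform_cube R m [set x | gauss_mx R m.+1 (ysection Bad x) != 0%E] = 0%E.
  rewrite (_ : [set x | _] = set0) ?measure0//; apply/seteqP; split=> // x /=.
  have [N [mN N0 HN]] := HC (y x); move=> /eqP; apply.
  apply: (@subset_measure0 _ _ _ (gauss_mx R m.+1) _ N) => //.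
    exact: measurable_ysection.
  move=> w; rewrite /ysection /= inE => -[dw /= Sw]; apply: contrapT => nN.
  by have /eqP := HN w dw nN; rewrite Sw.
set E := [set w | _] => E0.
have [k1 k10 Hk1] := @gam_near1 R m r r0.
have [mW W0] := @gauss_mx_box R m.+1 k1 k10.
have [w [Ww Ew]] : exists w : Omega, (forall i j, `|mx_of w i j - (i == j)%:R| < k1) /\ ~ E w.
  apply: contrapT => H; move/eqP: W0; apply.
  have mE : measurable E by apply: measurable_neq0; exact: measurable_fun_xsection.
  apply: (@subset_measure0 _ _ _ (gauss_mx R m.+1) _ E) => // w Ww.
  by apply: contrapT => Ew; apply: H; exists w.
have [dw gw] := Hk1 w Ww.
pose f n (x : Y) := Psi n (act (gam w) (y x)).
have f1 n x : `|f n x| <= 1.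
  by have /andP[? ?] := dilavg01 c T (s n) (act (gam w) (y x)) (L0 n); rewrite ger0_norm.
have bf n : bmeas (f n).
  split; last by exists 1.
  exact: (measurableT_comp (measurable_dilavg_gam_horo T c0 (L n) (s0 n))
    (@pair1_measurable _ _ Omega Y w)).
have cvf : (fun n => mean (uniform_cube R m) (f n)) @ \oo --> h.
  apply: (@mean_cvg _ Y R (uniform_cube R m) f h 1 (xsection Bad w)) => //.
  - exact: measurable_xsection.
  - by apply/eqP; apply: contrapT => H; apply: Ew; apply/negP.
  move=> x xB.
  have fC : (fun n => f n x - C n) @ \oo --> (0 : R).
    apply: sqr_summable_cvg0; apply/eqP => H; apply: xB.
    by rewrite /xsection /= inE; split.
  rewrite (_ : f ^~ x = fun n => (f n x - C n) + C n); last by apply/funext => n; rewrite subrK.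
  by rewrite -[X in _ --> X]add0r; apply: cvgD.
(* At this [n] the average over [v] of the hitting probabilities is within [e] of [h]; each of its
   matrices is within [k] of 1 by the choice of [r]. *)
have /cvgrPdist_lt/(_ e e0)[n _ /(_ n (leqnn n))] := cvf.
rewrite /= ltr_distlC /f mean_dilavg_horo ?det_gam// => /andP[lo hi].
have [_ + small] := Hs n; apply.
have gk v : v \in L n -> `|horo (s n ^- m.+1 *: v) *m gam w - 1%:M| <= k.
  by move=> vL; apply: Hr => //; apply: le_trans (horo_near1 _) _; exact: small.
split.
  have [v vL av] := avg_straddle (L0 n) lo.
  by exists (horo (s n ^- m.+1 *: v) *m gam w); [exact: gk|exact: ltW].
have [] := @avg_straddle _ (L n) (fun v => - hit_prob c T (dil m (s n) *m (horo (s n ^- m.+1 *: v) *m gam w))) (- (h + e)) (L0 n).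
  by rewrite sumrN mulrN ltrN2.
by move=> v vL; rewrite ltrN2 => av; exists (horo (s n ^- m.+1 *: v) *m gam w); [exact: gk|exact: ltW].
Qed.

End Equidistribution.

Lemma cone_mono (R : realType) (m : nat) (c T c1 T1 : R) (w : 'cV[R]_m.+1) :
  c <= c1 -> T <= T1 -> cone c T w -> cone c1 T1 w.
Proof.
move=> cc TT [/andP[w0 wT] wi]; split; first by rewrite w0 (lt_le_trans wT).
by move=> i; apply: lt_le_trans (wi i) _; rewrite ler_wpM2r// ltW.
Qed.

Lemma lhit_mono (R : realType) (n : nat) (O O' : set 'cV[R]_n) :
  (forall w, O w -> O' w) -> lhit O `<=` lhit O'.
Proof. by move=> OO' x [z Oz]; exists z; exact: OO'. Qed.

Section TranslateProbability.
Variables (R : realType) (m : nat).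
Local Notation X := (borel_lattice_space R m.+1).
Local Notation Y := (m.-tuple (measurableTypeR R)).
Hypothesis m0 : (0 < m)%N.
Variables (mu : probability X R) (mu_inv : SL_invariant mu).

Lemma cone_params (s1 s T1 : R) : 0 < s1 -> s1 < s -> 0 < T1 ->
  0 < s1 ^+ m.+1 < s ^+ m.+1 /\ 0 < s1 ^- m * T1.
Proof.
move=> s10 s1s T10; have s0 := lt_trans s10 s1s.
split; last by rewrite mulr_gt0// invr_gt0 exprn_gt0.
by rewrite exprn_gt0//= ltr_pXn2r// nnegrE ltW.
Qed.

(** For [A] near 1, the event and its translate both lie between a smaller and a larger cone event,
    so the squared difference of indicators is at most the indicator of the gap, whose measure is at
    most [e]. *)
Lemma cont1_cone_event (s T : R) : 0 < s -> 0 < T ->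
  cont1 mu (\1_(cone_event s T : set X) : X -> R).
Proof.
move=> s0 T0 e e0.
have [s1 [T1 [s2 [T2 [[s10 s1s ss2] [T10 t1t tt2] E12]]]]] := cone_event_margin m0 mu_inv s0 T0 e0.
have [/andP[c10 c1c] t10] := @cone_params s1 s T1 s10 s1s T10.
have [/andP[c0 cc2] t0] := @cone_params s s2 T s0 ss2 T0.
have [k1 k10 H1] := @cone_near R m _ _ _ _ c10 c1c t10 t1t.
have [k2 k20 H2] := @cone_near R m _ _ _ _ c0 cc2 t0 tt2.
have m1 := @measurable_cone_event R m s1 T1; have m2 := @measurable_cone_event R m s2 T2.
have mE := @measurable_cone_event R m s T.
exists (Num.min k1 k2) => [|A dA]; first by rewrite lt_min k10.
rewrite le_min => /andP[/H1[in1 _] /H2[_ out2]].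
rewrite -lee_fin; apply: (@le_trans _ _ (mu (cone_event s2 T2) - mu (cone_event s1 T1))%E); last first.
  by rewrite leeBlDl// fin_num_measure.
rewrite -(mean_indic mu m1) -(mean_indic mu m2) -EFinB lee_fin -meanB; [|exact: bmeas_indic..].
apply: mean_le; [apply: bmeas_disp; exact: bmeas_indic|by apply: bmeasB; exact: bmeas_indic|].
move=> x; rewrite !indicE.
have i1 : cone_event s1 T1 x -> cone_event s T x.
  by apply: lhit_mono => w; apply: cone_mono; exact: ltW.
have i2 : cone_event s T x -> cone_event s2 T2 x.
  by apply: lhit_mono => w; apply: cone_mono; exact: ltW.
have j1 : cone_event s1 T1 x -> cone_event s T (act A x).
  by move=> [z Hz]; apply/lhit_act => //; exists z; rewrite -mulmxA; exact: in1.
have j2 : cone_event s T (act A x) -> cone_event s2 T2 x.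
  by move=> /lhit_act => /(_ dA)[z Hz]; exists z; apply: out2; rewrite mulmxA.
case: (boolP (x \in cone_event s1 T1)) => [|_].
  rewrite inE => xs1.
  by rewrite !mem_set ?subrr ?expr0n//; [exact/i2/i1|exact: i1|exact: j1].
rewrite subr0; case: (boolP (x \in cone_event s2 T2)) => [_|].
  by do 2! case: (_ \in _) => /=; rewrite /= ?subrr ?sub0r ?subr0 ?sqrrN ?expr0n ?expr1n.
rewrite notin_setE => nx2; rewrite !memNset ?subrr ?expr0n//.
  by move=> /i2.
by move=> /j2.
Qed.

Lemma hit_probE (c T : R) (A : 'M[R]_m.+1) : (hit_prob c T A)%:E = uniform_cube R m (hitset c T A).
Proof. by apply: (@mean_indic _ Y R (uniform_cube R m)); exact: measurable_hitset. Qed.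

Lemma hit_prob_horo (c T s : R) (v : 'cV[R]_m) : hit_prob c T (dil m s *m horo v) = hit_prob c T (dil m s).
Proof. exact/EFin_inj/(etrans (hit_probE _ _ _))/(etrans (uniform_cube_hitset _ _ _ _))/esym/hit_probE. Qed.

Lemma le_hit_prob (c T c1 T1 : R) (A B : 'M[R]_m.+1) : hitset c T A `<=` hitset c1 T1 B -> hit_prob c T A <= hit_prob c1 T1 B.
Proof.
move=> AB; rewrite -lee_fin (hit_probE c T A) (hit_probE c1 T1 B).
by apply: (@le_measure _ _ _ (uniform_cube R m)); rewrite ?inE//; exact: measurable_hitset.
Qed.

(** The unknown matrix of [straddled] becomes [horo v] at the price of a slightly larger cone, and
    [v] then disappears by periodicity. *)
Lemma hit_prob_ge (s0 T0 c T e : R) : 0 < s0 -> 0 < T0 ->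
  s0 ^+ m.+1 < c -> s0 ^- m * T0 < T -> 0 < e ->
  exists S, forall s, S <= s -> fine (mu (cone_event s0 T0)) - e <= hit_prob c T (dil m s).
Proof.
move=> s00 T00 cc TT e0; have cgt0 : 0 < s0 ^+ m.+1 by rewrite exprn_gt0.
have tgt0 : 0 < s0 ^- m * T0 by rewrite mulr_gt0// invr_gt0 exprn_gt0.
have [k k0 Hk] := @hitset_sandwich R m _ _ _ _ cgt0 cc tgt0 TT.
have [S HS] := equidistribution_straddled mu_inv cgt0 k0 e0 (cont1_cone_event s00 T00).
exists (Num.max 1 S) => s; rewrite ge_max => /andP[s1 /HS[[g gk lo] _]].
rewrite -(mean_indic mu (@measurable_cone_event R m s0 T0)).
apply: le_trans lo _; have [v /(_ s s1)[sub _]] := Hk g gk.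
by rewrite -(hit_prob_horo c T s v); exact: le_hit_prob.
Qed.

Lemma hit_prob_le (s0 T0 c T e : R) : 0 < s0 -> 0 < T0 -> 0 < c -> 0 < T ->
  c < s0 ^+ m.+1 -> T < s0 ^- m * T0 -> 0 < e ->
  exists S, forall s, S <= s -> hit_prob c T (dil m s) <= fine (mu (cone_event s0 T0)) + e.
Proof.
move=> s00 T00 c0 t0 cc TT e0; have cgt0 : 0 < s0 ^+ m.+1 by rewrite exprn_gt0.
have [k k0 Hk] := @hitset_sandwich R m _ _ _ _ c0 cc t0 TT.
have [S HS] := equidistribution_straddled mu_inv cgt0 k0 e0 (cont1_cone_event s00 T00).
exists (Num.max 1 S) => s; rewrite ge_max => /andP[s1 /HS[_ [g gk hi]]].
rewrite -(mean_indic mu (@measurable_cone_event R m s0 T0)).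
apply: le_trans hi; have [v /(_ s s1)[_ sub]] := Hk g gk.
by rewrite -(hit_prob_horo c T s v); exact: le_hit_prob.
Qed.

End TranslateProbability.

(** * Smallest denominators *)

Section Denominators.
Variables (R : realType) (m : nat).
Local Notation Y := (m.-tuple (measurableTypeR R)).

(** Closed at height [T] because the event asks for [<= T]; the final squeeze compares it with open
    cones. *)
Definition closed_cone (T : R) : set 'cV[R]_m.+1 :=
  [set w | 0 < w ord0 ord0 <= T /\ forall i, `|w (lift ord0 i) ord0| < w ord0 ord0].

Lemma dil_horo_intr (s : R) (x : 'cV[R]_m) (z : 'cV[int]_m.+1)
    (w := dil m s *m horo x *m map_mx intr z) :
  w ord0 ord0 = s ^- m * (z ord0 ord0)%:~R /\
  forall i, w (lift ord0 i) ord0 = s * ((z (lift ord0 i) ord0)%:~R - x i ord0 * (z ord0 ord0)%:~R).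
Proof.
rewrite /w -mulmxA; split=> [|i]; first by rewrite dil0 horo_w0 mxE.
by rewrite dilS horo_wS !mxE.
Qed.

Lemma close_rational (s u p : R) (q : nat) : 0 < s -> (0 < q)%N ->
  `|u - q%:R^-1 * p| < s ^- m.+1 <-> `|s * (p - u * q%:R)| < s ^- m * q%:R.
Proof.
move=> s0 q0; have Q0 : 0 < q%:R :> R by rewrite ltr0n.
have sn : s ^+ m != 0 by rewrite expf_neq0// gt_eqF.
have -> : s * (p - u * q%:R) = - (s * q%:R) * (u - q%:R^-1 * p).
  by field; rewrite gt_eqF.
rewrite normrM normrN [`|s * _|]gtr0_norm ?mulr_gt0//.
have -> : s ^- m * q%:R = (s * q%:R) * s ^- m.+1.
  by rewrite exprS; field; rewrite sn gt_eqF.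
by rewrite ltr_pM2l// mulr_gt0.
Qed.

(** A hit is an integer vector (q, p) with [0 < q]: multiplied by [s q], the inequality
    [|x - p / q| < s ^- m.+1] is the cone condition. If any denominator meets the height bound, the
    least one does. *)
Lemma Qmin_le (s T : R) (x : 'cV[R]_m) : 0 < s ->
  s ^- m * (Qmin x (s ^- m.+1))%:R <= T <-> hit (closed_cone T) (dil m s *m horo x).
Proof.
move=> s0; have sm : 0 < s ^- m by rewrite invr_gt0 exprn_gt0.
have d0 : 0 < s ^- m.+1 by rewrite invr_gt0 exprn_gt0.
have [[q0 [p hp]] lbq] := QminP x d0.
split=> [QT|[z [/andP[w0 wT] wi]]].
  pose z : 'cV[int]_m.+1 := \col_i if unlift ord0 i is Some k then p k ord0 else (Qmin x (s ^- m.+1))%:Z.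
  have z0 : z ord0 ord0 = (Qmin x (s ^- m.+1))%:Z by rewrite mxE unlift_none.
  have zS i : z (lift ord0 i) ord0 = p i ord0 by rewrite mxE liftK.
  have [e0 eS] := dil_horo_intr s x z.
  exists z; rewrite /closed_cone /= e0 z0 -pmulrn; split.
    by rewrite QT andbT mulr_gt0// ltr0n.
  move=> i; rewrite eS z0 zS -pmulrn; apply/close_rational => //.
  by move/(mx_norm_ltP _ d0): hp => /(_ i ord0); rewrite !mxE.
have [e0 eS] := dil_horo_intr s x z; rewrite e0 in w0 wT.
have zp : 0 < z ord0 ord0 by rewrite -(ltr0z R) -(pmulr_rgt0 _ sm).
have zE : z ord0 ord0 = `|z ord0 ord0|%N%:Z by rewrite gtz0_abs.
have Qz : (Qmin x (s ^- m.+1) <= `|z ord0 ord0|)%N.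
  apply: lbq; split; first by rewrite -ltz_nat -zE.
  exists (\col_i z (lift ord0 i) ord0); apply/mx_norm_ltP => // i j.
  rewrite !mxE ord1; apply/close_rational => //; first by rewrite -ltz_nat -zE.
  have := wi i; rewrite e0 eS; rewrite {1 2}zE -pmulrn //.
apply: le_trans wT; rewrite ler_pM2l// zE -pmulrn ler_nat//.
Qed.

Definition unit_cube : set Y := [set x | forall i, 0 <= tnth x i <= 1].

Lemma measurable_unit_cube : measurable unit_cube.
Proof.
rewrite (_ : unit_cube = \bigcap_(i in setT)
  ((fun x : Y => tnth x i) @^-1` `[0, 1]%classic)).
  apply: fin_bigcap_measurable; first exact: finite_finset.
  move=> i _; rewrite -[X in measurable X]setTI.
  by apply: measurable_tnth.
apply/seteqP; split=> x /= H i; first by move=> _ /=; rewrite in_itv/=; exact: H.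
by have := H i I; rewrite /= in_itv.
Qed.

Lemma uniform_cube_unit_cube : uniform_cube R m unit_cube = 1%E.
Proof.
rewrite (_ : unit_cube = [set x : Y | forall i, `[0, 1]%classic (tnth x i)]).
  rewrite (@uniform_cube_box R m (fun=> `[0, 1]%classic))// big1// => i _.
  by rewrite /uniform_prob integral_uniform_pdf1.
by apply/seteqP; split=> x /= H i; have := H i; rewrite in_itv.
Qed.

Lemma measurable_closed_cone_hit T A : measurable [set x : Y | hit (closed_cone T) (A *m horo (colt x))].
Proof.
apply: (@measurable_hit _ Y R m (fun x => A *m horo (colt x))) => z.
pose w (x : Y) := A *m horo (colt x) *m map_mx intr z.
have mw i : measurable_fun setT (fun x => w x i ord0).
  rewrite (_ : (fun x => _) = fun x => \sum_j (A *m horo (colt x)) i j * (map_mx intr z : 'cV[R]_m.+1) j ord0).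
    apply: measurable_sum => j; apply: measurable_funM; last exact: measurable_cst.
    exact: measurable_mul_horo_colt.
  by apply/funext => x; rewrite mxE.
rewrite (_ : [set x | _] = [set x | 0 < w x ord0 ord0] `&` ~` [set x | T < w x ord0 ord0]
    `&` [set x | forall i : 'I_m, `|w x (lift ord0 i) ord0| < w x ord0 ord0]).
  apply: measurableI; first apply: measurableI.
  - by apply: measurable_ltset; [exact: measurable_cst|exact: mw].
  - by apply: measurableC; apply: measurable_ltset; [exact: measurable_cst|exact: mw].
  apply: (@measurable_forall _ _ _ (fun i x =>
    `|w x (lift ord0 i) ord0| < w x ord0 ord0)) => i.
  by apply: measurable_ltset; [apply: measurableT_comp => //|]; exact: mw.
apply/seteqP; split=> x /=.
  by move=> [/andP[w0 wT] wi]; split=> //; split=> //; apply/negP; rewrite -leNgt.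
by move=> [[w0 /negP]]; rewrite -leNgt => wT wi; split=> //; apply/andP.
Qed.

Lemma powR_dil (delta : R) (s := delta `^ (- m.+1%:R^-1)) : 0 < delta ->
  [/\ 0 < s, s ^- m.+1 = delta & s ^- m = delta `^ (m%:R / m.+1%:R)].
Proof.
move=> d0; have s0 : 0 < s by exact: powR_gt0.
split=> //.
  rewrite -powR_mulrn ?ltW// -powRrM mulNr mulVf ?pnatr_eq0// powR_inv1 ?ltW//.
  by rewrite invrK.
by rewrite -powR_mulrn ?ltW// -powRrM -powRN mulNr opprK mulrC.
Qed.

End Denominators.

Unset Implicit Arguments.

Theorem theorem1p3 (R : realType) (m : nat) (m_gt0 : (0 < m)%N)
    (mu : probability (borel_lattice_space R m.+1) R)
    (mu_inv : SL_invariant mu) (T : R) (T_gt0 : 0 < T) :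
  (fun delta : R =>
     uniform_cube R m
       [set x | (forall i, 0 <= tnth x i <= 1) /\
         delta `^ (m%:R / m.+1%:R) *
           (Qmin (\col_i tnth x i) delta)%:R <= T])
    @ 0^'+ -->
  mu [set L | F1 L <= T].
Proof.
pose A s : set (m.-tuple (measurableTypeR R)) := @unit_cube R m `&`
  [set x | hit (closed_cone T) (dil m s *m horo (colt x))].
have mA s : measurable (A s).
  by apply: measurableI; [exact: measurable_unit_cube|exact: measurable_closed_cone_hit].
have AE (delta : R) : 0 < delta -> [set x | (forall i, 0 <= tnth x i <= 1) /\
    delta `^ (m%:R / m.+1%:R) * (Qmin (\col_i tnth x i) delta)%:R <= T] =
    A (delta `^ (- m.+1%:R^-1)).
  move=> d0; have [s0 e1 e2] := powR_dil m d0.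
  have QP (x : m.-tuple (measurableTypeR R)) := Qmin_le T (colt x) s0; rewrite e1 e2 in QP.
  by apply/seteqP; split=> x [x01 Hx]; split=> //; exact/QP.
pose a := fine (mu [set L | F1 L <= T]).
have muE : mu [set L | F1 L <= T] = a%:E.
  by rewrite /a fineK// fin_num_measure//; exact: measurable_F1_le.
(* The restriction to the unit cube, present in [A s] but not in [hitset], costs a null set. *)
have prA c t s : hitset c t (dil m s) `<=` [set x | hit (closed_cone T) (dil m s *m horo (colt x))] ->
    hit_prob c t (dil m s) <= fine (uniform_cube R m (A s)).
  move=> sub; rewrite -lee_fin hit_probE fineK ?fin_num_measure//.
  have mC := @measurable_unit_cube R m; have mH := measurable_hitset c t (dil m s).
  apply: (@le_trans _ _ (uniform_cube R m (A s `|` ~` @unit_cube R m))).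
    apply: (@le_measure _ _ _ (uniform_cube R m)); rewrite ?inE//.
      by apply: measurableU => //; exact: measurableC.
    move=> x Hx; have [xc|xc] := pselect (unit_cube x); last by right.
    by left; split=> //; exact: sub.
  have C0 : uniform_cube R m (~` @unit_cube R m) = 0%E.
    by rewrite (@probability_setC _ _ _ (uniform_cube R m))// uniform_cube_unit_cube subee.
  apply: le_trans (measureU2 _ (mA s) (measurableC mC)) _.
  by rewrite [X in (_ + X <= _)%E](_ : _ = 0%E) ?adde0.
have Apr c t s : [set x | hit (closed_cone T) (dil m s *m horo (colt x))] `<=` hitset c t (dil m s) ->
    fine (uniform_cube R m (A s)) <= hit_prob c t (dil m s).
  move=> sub; rewrite -lee_fin hit_probE fineK ?fin_num_measure//.
  apply: (@le_measure _ _ _ (uniform_cube R m)); rewrite ?inE//; first exact: measurable_hitset.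
  by move=> x [_ /sub].
rewrite muE; apply/fine_cvgP; split; first by near=> d; rewrite AE// fin_num_measure.
apply/cvgrPdist_le => e e0.
have e2 : 0 < e / 2 by rewrite divr_gt0.
(* Half of [e] pays for the gap between the two cone events, the other half for the equidistribution
   error. *)
have [s1 [T1 [s2 [T2 [[s10 s11 s12] [T10 t1t tt2] E12]]]]] :=
  cone_event_margin m_gt0 mu_inv ltr01 T_gt0 e2.
rewrite expr1n invr1 mul1r in t1t tt2.
have sm2 : 0 < s2 ^- m by rewrite invr_gt0 exprn_gt0// (lt_trans _ s12).
have T20 : 0 < T2 by rewrite -(pmulr_rgt0 _ sm2) (lt_trans T_gt0).
have s20 : 0 < s2 by exact: lt_trans s12.
pose E s t := cone_event (m:=m) s t : set (borel_lattice_space R m.+1).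
have mE s t : measurable (E s t) by exact: measurable_cone_event.
have aE : a = fine (mu (E 1 T)).
  by rewrite /a /E cone_event1; congr fine; exact: mu_F1_le.
have c1 : s1 ^+ m.+1 < 1 by rewrite exprn_ilt1// ltW.
have c2 : 1 < s2 ^+ m.+1 by rewrite exprn_egt1// .
have le_mu s t s' t' : s ^+ m.+1 <= s' ^+ m.+1 -> s ^- m * t <= s' ^- m * t' ->
    fine (mu (E s t)) <= fine (mu (E s' t')).
  move=> ss tt; rewrite fine_le ?fin_num_measure// le_measure ?inE//.
  by apply: lhit_mono => w; exact: cone_mono.
have p1a : fine (mu (E s1 T1)) <= a.
  by rewrite aE; apply: le_mu; rewrite !expr1n ?invr1 ?mul1r ltW.
have ap2 : a <= fine (mu (E s2 T2)).
  by rewrite aE; apply: le_mu; rewrite !expr1n ?invr1 ?mul1r ltW.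
have p12 : fine (mu (E s2 T2)) <= fine (mu (E s1 T1)) + e / 2.
  by rewrite -lee_fin EFinD !fineK ?fin_num_measure.
have [S1 H1] := hit_prob_ge m_gt0 mu_inv s10 T10 c1 t1t e2.
(* For the upper bound an open cone must contain the closed one and still lie strictly inside the
   cone of [E s2 T2]: midpoints do. For the lower bound [cone 1 T] itself lies in the closed
   cone. *)
pose c' := (1 + s2 ^+ m.+1) / 2; pose t' := (T + s2 ^- m * T2) / 2.
have [c'1 c'2 c'0] : [/\ 1 < c', c' < s2 ^+ m.+1 & 0 < c'].
  by rewrite /c'; move: (s2 ^+ m.+1) c2 => q q1; split; lra.
have [t'1 t'2 t'0] : [/\ T < t', t' < s2 ^- m * T2 & 0 < t'].
  by rewrite /t'; move: (s2 ^- m * T2) tt2 => q q1; split; lra.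
have [S2 H2] := hit_prob_le m_gt0 mu_inv s20 T20 c'0 t'0 c'2 t'2 e2.
pose S := Num.max 1 (Num.max S1 S2).
have S0 : 0 < S by rewrite lt_max ltr01.
have Sd : 0 < S ^- m.+1 by rewrite invr_gt0 exprn_gt0.
near=> d.
have d0 : 0 < d by near: d; exact: nbhs_right_gt.
have dS : d < S ^- m.+1 by near: d; exact: nbhs_right_lt.
rewrite /= AE//; have [s0 sd _] := powR_dil m d0.
move: (d `^ (- m.+1%:R^-1)) s0 sd => s s0 sd.
have Ss : S <= s.
  rewrite leNgt; apply/negP => sS; move: dS; apply/negP; rewrite -leNgt -sd.
  by rewrite lef_pV2 ?posrE ?exprn_gt0// lerXn2r ?nnegrE ?ltW.
move: Ss; rewrite /S !ge_max => /and3P[_ /H1 lo /H2 hi].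
have {}lo := le_trans lo (prA _ _ _ _); have {}hi := le_trans (Apr _ _ _ _) hi.
rewrite ler_distlC; apply/andP; split.
  have /lo : hitset 1 T (dil m s) `<=` [set x | hit (closed_cone T) (dil m s *m horo (colt x))].
    move=> x [z [/andP[w0 wT] wi]]; exists z; split; first by rewrite w0 ltW.
    by move=> i; have := wi i; rewrite mul1r.
  by move: p12 ap2; rewrite /E; lra.
have /hi : [set x | hit (closed_cone T) (dil m s *m horo (colt x))] `<=` hitset c' t' (dil m s).
  move=> x [z [/andP[w0 wT] wi]]; exists z; split; first by rewrite w0 (le_lt_trans wT).
  by move=> i; apply: lt_trans (wi i) _; rewrite ltr_pMl.
by move: p12 p1a; rewrite /E; lra.
Unshelve. all: by end_near.
Qed.
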